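(* Let $k$ be an algebraically closed field of characteristic $2$, let $L\subset T_{\mathbb{P}^2}$ be an invertible $1$-foliation of degree $-1$ on the projective plane $\mathbb{P}^2=\mathbb{P}^2_k$, and let $Y=\mathbb{P}^2/L$ be the quotient of $\mathbb{P}^2$ by $L$. Then the configuration of the singular points of $Y$ is of type $7A_1$, $D_4^0+3A_1$, $D_6^0+A_1$ or $E_7^0$.
   Context: $k$ is an algebraically closed field of characteristic $p=2$, and $T_X$ denotes the tangent bundle of a smooth variety $X$ over $k$. **1-foliations.** A $1$-foliation of $X$ is a saturated subsheaf $L\subset T_X$ that is closed under Lie brackets and $p$-closed, where $p$-closed means that $\delta^p\in L$ for all local sections $\delta\in L$ ($\delta^p$ is the $p$-fold composite of $\delta$ as a derivation of $\mathcal{O}_X$). It is invertible if $L$ is an invertible sheaf. An invertible $1$-foliation $L$ of $\mathbb{P}^2$ has degree $n$ if $L\cong\mathcal{O}_{\mathbb{P}^2}(n)$. **Quotient.** The quotient $Y=X/L$ is the normal variety with the same underlying topological space as $X$ and structure sheaf $\mathcal{O}_Y=\{f\in\mathcal{O}_X \mid \delta(f)=0 \text{ for all } \delta\in L\}$. The quotient morphism $\pi:X\to Y$ is finite, purely inseparable of degree $p$, and a homeomorphism; points of $Y$ are identified with points of $X$ via $\pi$. **Singularities.** A point $y\in Y$ of the surface $Y$ is a singularity of type $A_1$, $D_{2n}^0$ ($n\ge 2$), or $E_7^0$ if the completed local ring $\widehat{\mathcal{O}}_{Y,y}$ is isomorphic to $k[[X,Y,Z]]/(f)$ with, respectively, $f=Z^2+XY$,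 $f=Z^2+X^2Y+XY^n$, or $f=Z^2+X^3+XY^3$ (Artin's notation for rational double points in characteristic $2$). **Configuration types.** Let $X_0,X_1,X_2$ be homogeneous coordinates of $\mathbb{P}^2$. The configuration of the singular points of $Y$ is of a given type if, after a suitable change of the homogeneous coordinates of $\mathbb{P}^2$ (and identifying points of $Y$ with points of $\mathbb{P}^2$ via $\pi$), the singular points of $Y$ are exactly the following. - Type $7A_1$: seven singularities, all of type $A_1$: the three points $[1:0:0]$, $[0:1:0]$, $[0:0:1]$; one point on each of the three lines $X_0=0$, $X_1=0$, $X_2=0$ different from the three coordinate points; and one point lying on none of these three lines. - Type $D_4^0+3A_1$: a $D_4^0$-singularity at $[1:0:0]$ and three $A_1$-singularities on the line $X_0=0$, namely at $[0:1:0]$, at $[0:0:1]$ and at one further point of the line $X_0=0$. - Type $D_6^0+A_1$: a $D_6^0$-singularity at $[1:0:0]$ and an $A_1$-singularity at $[0:1:0]$. - Type $E_7^0$: a single singularity, of type $E_7^0$, at $[1:0:0]$. *)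

(* Defs.v *)
From HB Require Import structures.
From mathcomp Require Import all_boot all_order all_algebra fraction.
From mathcomp Require Import boolp classical_sets functions.
From mathcomp Require Import mpoly.

Set Implicit Arguments.
Unset Strict Implicit.
Unset Printing Implicit Defensive.

Import GRing.Theory.
Local Open Scope classical_set_scope.
Local Open Scope ring_scope.

Record mseries (N : nat) (R : comNzRingType) :=
  MSeries { mscoef : 'X_{1..N} -> R }.

Section PowerSeries.
Variables (N : nat) (R : comNzRingType).
Implicit Types f g h : mseries N R.

HB.instance Definition _ := gen_eqMixin (mseries N R).
HB.instance Definition _ := gen_choiceMixin (mseries N R).

Lemma mseriesP f g : (forall m, mscoef f m = mscoef g m) -> f = g.
Proof. by case: f g => f [g] /= /funext ->. Qed.

Definition series_of_mpoly (q : {mpoly R[N]}) : mseries N R :=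
  MSeries (fun m => q@_m).

Definition mstrunc (d : nat) f : {mpoly R[N]} :=
  \sum_(m : 'X_{1..N < d}) mscoef f m *: 'X_[m].

Lemma mstruncE d f m : (mdeg m < d)%N -> (mstrunc d f)@_m = mscoef f m.
Proof. exact: mcoeff_mpoly. Qed.

Definition mszero : mseries N R := MSeries (fun _ => 0).
Definition msone : mseries N R := series_of_mpoly 1.
Definition msopp f := MSeries (fun m => - mscoef f m).
Definition msadd f g := MSeries (fun m => mscoef f m + mscoef g m).
Definition msmul f g := MSeries (fun m =>
  \sum_(k : 'X_{1..N < (mdeg m).+1, (mdeg m).+1} | m == (k.1 + k.2)%MM)
     mscoef f k.1 * mscoef g k.2).

Lemma msmul_mpoly (p q : {mpoly R[N]}) f g m :
    (forall m', (mdeg m' <= mdeg m)%N -> p@_m' = mscoef f m') ->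
    (forall m', (mdeg m' <= mdeg m)%N -> q@_m' = mscoef g m') ->
  mscoef (msmul f g) m = (p * q)@_m.
Proof.
move=> Hp Hq; rewrite mcoeffM /=; apply: eq_bigr => k /eqP Dm.
have Dd : (mdeg k.1 + mdeg k.2)%N = mdeg m by rewrite -mdegD -Dm.
rewrite Hp; last by apply: leq_trans (leq_addr (mdeg k.2) _) _; rewrite Dd.
by rewrite Hq //; apply: leq_trans (leq_addl (mdeg k.1) _) _; rewrite Dd.
Qed.

Lemma mstrunc_mul d f g m : (mdeg m < d)%N ->
  mscoef (msmul f g) m = (mstrunc d f * mstrunc d g)@_m.
Proof.
by move=> lt_md; apply: msmul_mpoly => m' le_m'; rewrite mstruncE //;
  apply: leq_ltn_trans le_m' lt_md.
Qed.

Fact msaddA : associative msadd.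
Proof. by move=> f g h; apply: mseriesP => m; rewrite /= addrA. Qed.

Fact msaddC : commutative msadd.
Proof. by move=> f g; apply: mseriesP => m; rewrite /= addrC. Qed.

Fact msadd0 : left_id mszero msadd.
Proof. by move=> f; apply: mseriesP => m; rewrite /= add0r. Qed.

Fact msaddN : left_inverse mszero msopp msadd.
Proof. by move=> f; apply: mseriesP => m; rewrite /= addNr. Qed.

HB.instance Definition _ :=
  GRing.isZmodule.Build (mseries N R) msaddA msaddC msadd0 msaddN.

Fact msmulC : commutative msmul.
Proof.
move=> f g; apply: mseriesP => m.
by rewrite !(mstrunc_mul _ _ (ltnSn (mdeg m))) mulrC.
Qed.

Fact msmulA : associative msmul.
Proof.
move=> f g h; apply: mseriesP => m; set d := (mdeg m).+1.
have E f' m' : (mdeg m' <= mdeg m)%N -> (mstrunc d f')@_m' = mscoef f' m'.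
  by move=> le_m'; rewrite mstruncE.
have E2 f' g' m' : (mdeg m' <= mdeg m)%N ->
    (mstrunc d f' * mstrunc d g')@_m' = mscoef (msmul f' g') m'.
  by move=> le_m'; rewrite (mstrunc_mul (d := d)).
by rewrite (msmul_mpoly (E f) (E2 g h)) (msmul_mpoly (E2 f g) (E h)) mulrA.
Qed.

Fact msmul1 : left_id msone msmul.
Proof.
move=> f; apply: mseriesP => m; set d := (mdeg m).+1.
rewrite (@msmul_mpoly 1 (mstrunc d f)) ?mul1r ?mstruncE // => m' le_m'.
by rewrite mstruncE.
Qed.

Fact msmulDl : left_distributive msmul msadd.
Proof.
move=> f g h; apply: mseriesP => m.
by rewrite /= -big_split; apply: eq_bigr => k _; rewrite /= mulrDl.
Qed.

Fact msone_neq0 : msone != 0.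
Proof.
apply/eqP => /(congr1 (fun f => mscoef f 0%MM)) /=.
by rewrite mcoeff1 eqxx; apply/eqP; exact: oner_neq0.
Qed.

HB.instance Definition _ := GRing.Zmodule_isComNzRing.Build (mseries N R)
  msmulA msmulC msmul1 msmulDl msone_neq0.

End PowerSeries.

(* The local ring is a subring A of an ambient ring R, with maximal ideal m.  *)
(* An element of lim_n A/m^n is given by representatives u n of its           *)
(* components in A/m^n, so that two families u, v define the same element     *)
(* when u n - v n lies in m^n for all n.                                      *)
Section Completion.
Variables (R : comNzRingType) (A m : set R).

Fixpoint ideal_exp (n : nat) : set R :=
  if n is n'.+1 then
    [set x | exists s : seq (R * R),
      (forall z, z \in s -> m z.1 /\ ideal_exp n' z.2) /\
      x = \sum_(z <- s) z.1 * z.2]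
  else A.

Definition coherent (u : nat -> R) : Prop :=
  forall n, A (u n) /\ ideal_exp n (u n.+1 - u n).

Definition lim_eq (u v : nat -> R) : Prop := forall n, ideal_exp n (u n - v n).

(* Isomorphism of k-algebras between k[[X_1,...,X_N]]/(f) and lim_n A/m^n,    *)
(* given as a surjective homomorphism from k[[X_1,...,X_N]] with kernel (f);  *)
(* c : k -> R is the k-algebra structure.                                     *)
Definition completion_iso (k : comNzRingType) (c : k -> R) (N : nat)
    (f : mseries N k) : Prop :=
  exists phi : mseries N k -> nat -> R,
    [/\ forall g, coherent (phi g),
        [/\ forall a, lim_eq (phi (series_of_mpoly a%:MP)) (fun=> c a),
            forall g h, lim_eq (phi (g + h)) (fun n => phi g n + phi h n)
          & forall g h, lim_eq (phi (g * h)) (fun n => phi g n * phi h n)],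
        forall u, coherent u -> exists g, lim_eq (phi g) u
      & forall g, lim_eq (phi g) (fun=> 0) <-> exists h, g = f * h].

(* A, of dimension d, is regular when m is generated by d elements.           *)
Definition regular_local_ring (d : nat) : Prop :=
  exists a : 'I_d -> R, (forall i, m (a i)) /\
    forall x, m x -> exists b : 'I_d -> R,
      (forall i, A (b i)) /\ x = \sum_(i < d) b i * a i.

End Completion.

(* a/b is homogeneous of degree n; hom_fraction does not ask for b != 0.      *)
Definition hom_fraction (k : fieldType) (n : int) (a b : {mpoly k[3]}) : Prop :=
  exists d e : nat, [/\ e%:Z = d%:Z + n, a \is e.-homog & b \is d.-homog].

Definition degree0 (k : fieldType) : pred {fraction {mpoly k[3]}} :=
  fun x => `[< exists a b, [/\ hom_fraction 0 a b, b != 0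
                             & x = tofrac a / tofrac b] >].

Lemma degree0P (k : fieldType) (x : {fraction {mpoly k[3]}}) :
  reflect (exists d a b, [/\ a \is d.-homog, b \is d.-homog, b != 0
                           & x = tofrac a / tofrac b])
          (x \in degree0 (k := k)).
Proof.
apply: (iffP (asboolP _)).
  by move=> [a [b [[d [e []]]]]]; rewrite addr0 => -[->] ha hb b0 ->;
    exists d, a, b.
by move=> [d [a [b [ha hb b0 ->]]]]; exists a, b; split=> //;
  exists d, d; rewrite addr0.
Qed.

Lemma degree0_divring_closed (k : fieldType) : divring_closed (degree0 (k := k)).
Proof.
split.
- by apply/degree0P; exists 0%N, 1, 1; rewrite dhomog1 oner_neq0 divr1 rmorph1.
- move=> x y /degree0P[d [a [b [ha hb b0 ->]]]] /degree0P[e [a' [b' [ha' hb' b'0 ->]]]].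
  apply/degree0P; exists (d + e)%N, (a * b' - a' * b), (b * b'); split.
  + by apply: rpredB; [exact: dhomogM | rewrite mulrC; exact: dhomogM].
  + exact: dhomogM.
  + by rewrite mulf_neq0.
  + rewrite rmorphB !rmorphM /= -mulNr -[in LHS]mulNr.
    by rewrite addf_div ?tofrac_eq0 // mulNr.
- move=> x y /degree0P[d [a [b [ha hb b0 ->]]]] /degree0P[e [a' [b' [ha' hb' b'0 ->]]]].
  apply/degree0P; have [->|a'0] := eqVneq a' 0.
    exists 0%N, 0, 1; split; rewrite ?rpred0 ?dhomog1 ?oner_neq0 //.
    by rewrite rmorph0 mul0r invr0 mulr0 mul0r.
  exists (d + e)%N, (a * b'), (b * a'); split.
  + exact: dhomogM.
  + exact: dhomogM.
  + by rewrite mulf_neq0.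
  + by rewrite !rmorphM /= invf_div mulf_div.
Qed.

HB.instance Definition _ (k : fieldType) :=
  GRing.isDivringClosed.Build {fraction {mpoly k[3]}} (degree0 (k := k))
    (degree0_divring_closed k).

(* Function field of the plane: homogeneous fractions of degree 0.            *)
Record ratfun (k : fieldType) := RatFun {
  ratfun_val :> {fraction {mpoly k[3]}};
  ratfun_valP : ratfun_val \in degree0 (k := k) }.

HB.instance Definition _ (k : fieldType) := [isSub for @ratfun_val k].
HB.instance Definition _ (k : fieldType) := [Choice of ratfun k by <:].
(* The field operations are those induced by the field of fractions, locked   *)
(* to keep unification from unfolding the latter.                             *)
Section RatfunField.
Variable k : fieldType.
Implicit Types x y z : ratfun k.

Fact ratfun_key : unit. Proof. exact: tt. Qed.

Fact ratfun0_subproof : 0 \in degree0 (k := k). Proof. exact: rpred0. Qed.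
Fact ratfun1_subproof : 1 \in degree0 (k := k). Proof. exact: rpred1. Qed.
Fact ratfun_opp_subproof x : - ratfun_val x \in degree0 (k := k).
Proof. by rewrite rpredN; exact: ratfun_valP. Qed.
Fact ratfun_add_subproof x y : ratfun_val x + ratfun_val y \in degree0 (k := k).
Proof. by apply: rpredD; exact: ratfun_valP. Qed.
Fact ratfun_mul_subproof x y : ratfun_val x * ratfun_val y \in degree0 (k := k).
Proof. by apply: rpredM; exact: ratfun_valP. Qed.
Fact ratfun_inv_subproof x : (ratfun_val x)^-1 \in degree0 (k := k).
Proof. by rewrite rpredV; exact: ratfun_valP. Qed.

Definition ratfun0 := locked_with ratfun_key (RatFun ratfun0_subproof).
Definition ratfun1 := locked_with ratfun_key (RatFun ratfun1_subproof).
Definition ratfun_opp :=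
  locked_with ratfun_key (fun x => RatFun (ratfun_opp_subproof x)).
Definition ratfun_add :=
  locked_with ratfun_key (fun x y => RatFun (ratfun_add_subproof x y)).
Definition ratfun_mul :=
  locked_with ratfun_key (fun x y => RatFun (ratfun_mul_subproof x y)).
Definition ratfun_inv :=
  locked_with ratfun_key (fun x => RatFun (ratfun_inv_subproof x)).

Fact ratfun0E : ratfun_val ratfun0 = 0.
Proof. by rewrite [ratfun0]unlock. Qed.
Fact ratfun1E : ratfun_val ratfun1 = 1.
Proof. by rewrite [ratfun1]unlock. Qed.
Fact ratfun_oppE x : ratfun_val (ratfun_opp x) = - ratfun_val x.
Proof. by rewrite [ratfun_opp]unlock. Qed.
Fact ratfun_addE x y : ratfun_val (ratfun_add x y) = ratfun_val x + ratfun_val y.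
Proof. by rewrite [ratfun_add]unlock. Qed.
Fact ratfun_mulE x y : ratfun_val (ratfun_mul x y) = ratfun_val x * ratfun_val y.
Proof. by rewrite [ratfun_mul]unlock. Qed.
Fact ratfun_invE x : ratfun_val (ratfun_inv x) = (ratfun_val x)^-1.
Proof. by rewrite [ratfun_inv]unlock. Qed.

Fact ratfun_val_inj : injective (@ratfun_val k). Proof. exact: val_inj. Qed.

Fact ratfun_addA : associative ratfun_add.
Proof. by move=> x y z; apply: ratfun_val_inj; rewrite !ratfun_addE addrA. Qed.
Fact ratfun_addC : commutative ratfun_add.
Proof. by move=> x y; apply: ratfun_val_inj; rewrite !ratfun_addE addrC. Qed.
Fact ratfun_add0 : left_id ratfun0 ratfun_add.
Proof.
by move=> x; apply: ratfun_val_inj; rewrite ratfun_addE ratfun0E add0r.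
Qed.
Fact ratfun_addN : left_inverse ratfun0 ratfun_opp ratfun_add.
Proof.
move=> x; apply: ratfun_val_inj.
by rewrite ratfun_addE ratfun_oppE ratfun0E addNr.
Qed.

HB.instance Definition _ := GRing.isZmodule.Build (ratfun k)
  ratfun_addA ratfun_addC ratfun_add0 ratfun_addN.

Fact ratfun_mulA : associative ratfun_mul.
Proof. by move=> x y z; apply: ratfun_val_inj; rewrite !ratfun_mulE mulrA. Qed.
Fact ratfun_mulC : commutative ratfun_mul.
Proof. by move=> x y; apply: ratfun_val_inj; rewrite !ratfun_mulE mulrC. Qed.
Fact ratfun_mul1 : left_id ratfun1 ratfun_mul.
Proof.
by move=> x; apply: ratfun_val_inj; rewrite ratfun_mulE ratfun1E mul1r.
Qed.
Fact ratfun_mulDl : left_distributive ratfun_mul ratfun_add.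
Proof.
move=> x y z; apply: ratfun_val_inj.
by rewrite !(ratfun_mulE, ratfun_addE) mulrDl.
Qed.
Fact ratfun1_neq0 : ratfun1 != ratfun0.
Proof.
apply/eqP => /(congr1 (@ratfun_val k)); rewrite ratfun0E ratfun1E.
by apply/eqP; exact: oner_neq0.
Qed.

HB.instance Definition _ := GRing.Zmodule_isComNzRing.Build (ratfun k)
  ratfun_mulA ratfun_mulC ratfun_mul1 ratfun_mulDl ratfun1_neq0.

Fact ratfun_mulVf x : x != 0 -> ratfun_inv x * x = 1.
Proof.
move=> x0; apply: ratfun_val_inj; rewrite ratfun_mulE ratfun_invE ratfun1E.
apply: mulVf; apply: contraNneq x0 => v0; apply/eqP/ratfun_val_inj.
by rewrite v0 ratfun0E.
Qed.
Fact ratfun_inv0 : ratfun_inv 0 = 0.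
Proof. by apply: ratfun_val_inj; rewrite ratfun_invE ratfun0E invr0. Qed.

HB.instance Definition _ :=
  GRing.ComNzRing_isField.Build (ratfun k) ratfun_mulVf ratfun_inv0.

Fact ratfun_val_zmod_morphism : zmod_morphism (@ratfun_val k).
Proof. by move=> x y; rewrite ratfun_addE ratfun_oppE. Qed.
Fact ratfun_val_monoid_morphism : monoid_morphism (@ratfun_val k).
Proof. by split=> [|x y]; [exact: ratfun1E | exact: ratfun_mulE]. Qed.

HB.instance Definition _ := GRing.isZmodMorphism.Build _ _ (@ratfun_val k)
  ratfun_val_zmod_morphism.
HB.instance Definition _ := GRing.isMonoidMorphism.Build _ _ (@ratfun_val k)
  ratfun_val_monoid_morphism.

End RatfunField.

Lemma ratconst_subproof (k : fieldType) (c : k) :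
  tofrac (c%:MP : {mpoly k[3]}) \in degree0 (k := k).
Proof.
apply/degree0P; exists 0%N, c%:MP, 1; split.
- by rewrite -[c]mulr1 mpolyCM mul_mpolyC rpredZ ?dhomog1.
- exact: dhomog1.
- exact: oner_neq0.
- by rewrite rmorph1 divr1.
Qed.

Definition ratconst (k : fieldType) (c : k) : ratfun k :=
  RatFun (ratconst_subproof c).

Section Plane.
Variable k : fieldType.
Local Notation K := (ratfun k).
Local Notation F := {fraction {mpoly k[3]}}.
Implicit Types (P Q : 'rV[k]_3) (U V : set 'rV[k]_3).

(* Points of the plane are given by nonzero vectors of homogeneous            *)
(* coordinates, up to proj_eq.                                                *)
Definition P2 : set 'rV[k]_3 := [set P | P != 0].

Definition proj_eq P Q : Prop := exists2 c : k, c != 0 & P = c *: Q.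

(* Zariski open subsets.  All sheaves below are sheaves of submodules of      *)
(* constant sheaves on an irreducible space, hence given by their sections on *)
(* the nonempty open subsets, with inclusions as restriction maps.            *)
Definition zopen U : Prop :=
  exists G : set {mpoly k[3]},
    (forall g, G g -> exists d : nat, g \is d.-homog) /\
    U = [set P | P != 0 /\ exists2 g, G g & g.@[P 0] != 0].

Definition nzopen U : Prop := zopen U /\ U !=set0.

(* The stalk at P and the sections of O(n), inside the constant sheaf of      *)
(* fractions.                                                                 *)
Definition twist_at (n : int) P : set F :=
  [set x | exists a b, [/\ hom_fraction n a b, b.@[P 0] != 0
                         & x = tofrac a / tofrac b]].

Definition twist (n : int) U : set F := [set x | forall P, U P -> twist_at n P x].

Definition regular_at P : set K := [set f : K | twist_at 0 P (ratfun_val f)].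

Definition OX U : set K := [set f : K | forall P, U P -> regular_at P f].

(* A k-derivation of the structure sheaf on a nonempty open set U is a        *)
(* k-derivation of the function field preserving the local rings at all       *)
(* points of U.                                                               *)
Definition derivation (D : K -> K) : Prop :=
  [/\ forall c : k, D (ratconst c) = 0,
      forall f g, D (f + g) = D f + D g
    & forall f g, D (f * g) = D f * g + f * D g].

Definition TX U : set (K -> K) :=
  [set D | derivation D /\
     forall P, U P -> forall f, regular_at P f -> regular_at P (D f)].

Definition subsheaf_TX (L : set 'rV[k]_3 -> set (K -> K)) : Prop :=
  [/\ forall U, nzopen U -> L U `<=` TX U,
      forall U, nzopen U ->
        [/\ L U (fun=> 0),
            forall D E, L U D -> L U E -> L U (fun x => D x + E x)
          & forall f D, OX U f -> L U D -> L U (fun x => f * D x)],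
      forall U V, nzopen U -> nzopen V -> V `<=` U -> L U `<=` L V
    & forall U D, nzopen U ->
        (forall P, U P -> exists V, [/\ nzopen V, V `<=` U, V P & L V D]) ->
        L U D].

(* Saturation of L means that TX / L is torsion-free.                         *)
Definition saturated (L : set 'rV[k]_3 -> set (K -> K)) : Prop :=
  forall U f D, nzopen U -> OX U f -> f != 0 -> TX U D ->
    L U (fun x => f * D x) -> L U D.

Definition lie_closed (L : set 'rV[k]_3 -> set (K -> K)) : Prop :=
  forall U D E, nzopen U -> L U D -> L U E -> L U (fun x => D (E x) - E (D x)).

Definition p_closed (p : nat) (L : set 'rV[k]_3 -> set (K -> K)) : Prop :=
  forall U D, nzopen U -> L U D -> L U (iter p D).

Definition one_foliation (p : nat) (L : set 'rV[k]_3 -> set (K -> K)) : Prop :=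
  [/\ subsheaf_TX L, saturated L, lie_closed L & p_closed p L].

(* O(n) and L are isomorphic as O_X-modules on W.                             *)
Definition iso_twist_on (W : set 'rV[k]_3) (n : int)
    (L : set 'rV[k]_3 -> set (K -> K)) : Prop :=
  exists phi : set 'rV[k]_3 -> F -> (K -> K),
    (forall U, nzopen U -> U `<=` W ->
      [/\ set_bij (twist n U) (L U) (phi U),
          forall s t, twist n U s -> twist n U t ->
            phi U (s + t) = (fun x => phi U s x + phi U t x)
        & forall f s, OX U f -> twist n U s ->
            phi U (ratfun_val f * s) = (fun x => f * phi U s x)]) /\
    (forall U V s, nzopen U -> nzopen V -> V `<=` U -> U `<=` W ->
      twist n U s -> phi V s = phi U s).

Definition invertible_sheaf (L : set 'rV[k]_3 -> set (K -> K)) : Prop :=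
  forall P, P2 P -> exists W, [/\ zopen W, W P & iso_twist_on W 0 L].

Definition has_degree (L : set 'rV[k]_3 -> set (K -> K)) (n : int) : Prop :=
  iso_twist_on P2 n L.

Section Quotient.
Variable L : set 'rV[k]_3 -> set (K -> K).

Definition OY U : set K :=
  [set f | OX U f /\
     forall V D, nzopen V -> V `<=` U -> L V D -> D f = 0].

(* The local ring at P and its maximal ideal, formed by the nonunits.         *)
Definition OY_at P : set K :=
  [set f | exists U, [/\ zopen U, U P & OY U f]].

Definition mY_at P : set K :=
  [set f | OY_at P f /\ ~ (exists2 g, OY_at P g & f * g = 1)].

Definition singular_at P : Prop := ~ regular_local_ring (OY_at P) (mY_at P) 2.

Definition singularity_type P (f : {mpoly k[3]}) : Prop :=
  completion_iso (OY_at P) (mY_at P) (@ratconst k) (series_of_mpoly f).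

Definition vec3 (a b c : k) : 'rV[k]_3 := \row_(j < 3) [:: a; b; c]`_j.

Definition A1_eq : {mpoly k[3]} := 'X_2 ^+ 2 + 'X_0 * 'X_1.
(* n is half the subscript: this is D_{2n}^0.                                 *)
Definition D0_eq (n : nat) : {mpoly k[3]} :=
  'X_2 ^+ 2 + 'X_0 ^+ 2 * 'X_1 + 'X_0 * 'X_1 ^+ n.
Definition E70_eq : {mpoly k[3]} := 'X_2 ^+ 2 + 'X_0 ^+ 3 + 'X_0 * 'X_1 ^+ 3.

(* In suitable coordinates, the singular points are exactly the z.1, with z   *)
(* in s, and have the types z.2.  The point with new coordinates v has old    *)
(* coordinates v *m M.                                                        *)
Definition sing_config (s : seq ('rV[k]_3 * {mpoly k[3]})) : Prop :=
  exists2 M : 'M[k]_3, M \in unitmx &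
    (forall P, P2 P ->
       (singular_at P <-> exists2 z, z \in s & proj_eq P (z.1 *m M))) /\
    (forall z, z \in s -> singularity_type (z.1 *m M) z.2).

Definition config_7A1 : Prop :=
  exists a1 a2 b0 b2 c0 c1 d0 d1 d2 : k,
    all (fun x => x != 0) [:: a1; a2; b0; b2; c0; c1; d0; d1; d2] /\
    sing_config [:: (vec3 1 0 0, A1_eq);
                    (vec3 0 1 0, A1_eq);
                    (vec3 0 0 1, A1_eq);
                    (vec3 0 a1 a2, A1_eq);
                    (vec3 b0 0 b2, A1_eq);
                    (vec3 c0 c1 0, A1_eq);
                    (vec3 d0 d1 d2, A1_eq)].

Definition config_D40_3A1 : Prop :=
  exists a1 a2 : k, [/\ a1 != 0, a2 != 0 &
    sing_config [:: (vec3 1 0 0, D0_eq 2);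
                    (vec3 0 1 0, A1_eq);
                    (vec3 0 0 1, A1_eq);
                    (vec3 0 a1 a2, A1_eq)]].

Definition config_D60_A1 : Prop :=
  sing_config [:: (vec3 1 0 0, D0_eq 3); (vec3 0 1 0, A1_eq)].

Definition config_E70 : Prop := sing_config [:: (vec3 1 0 0, E70_eq)].

End Quotient.
End Plane.

(* Main.v *)
Require Import Defs.
From HB Require Import structures.
From mathcomp Require Import all_boot all_order all_algebra fraction ring zify.
From mathcomp Require Import boolp classical_sets functions mpoly.

(** Multiplying the generator 1/X_j of O(-1) by X_j turns the isomorphism of O(-1)
    with L into one derivation Delta, homogeneous of degree 1, whose minors with
    the Euler field are cubic forms W i j ([wronsk_polys]).  By p-closedness the
    quotient of a partial derivative of W i j in the third direction by W i j is a
    section of O(-1), so this derivative is zero ([W_deriv]).  It follows that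
    W i j = X_i A_j + X_j A_i with quadratic forms A_j all of whose partial
    derivatives vanish.  In characteristic 2 these are combinations of X_0^2,
    X_1^2, X_2^2, so L is generated by the vector field with value x^(2) m at x,
    for a 3 by 3 matrix m, where x^(2) has the squares of the coordinates of x.
    Since L is saturated, m has rank at least 2 ([foliation_generated]).

    Thus the foliation is given by the Frobenius-semilinear map
    phi(x) = x^(2) m on k^3.  Let A_j and Y_j be the coefficients of the field and the
    coordinates in a basis.  The quartic A_0 Y_1 Y_2 + A_1 Y_0 Y_2 + A_2 Y_0 Y_1 is
    annihilated by the vector field, and every form of even degree with this property
    is t^2 times the quartic plus a square ([kernel_nabla]).  If the basis
    begins with the point P, the local ring of Y at P therefore consists of the
    s^2 + t^2 f with s, t regular at P, where f is the quartic in the affine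
    coordinates x, y at P ([OY_iota]).  This ring is generated over k by x^2, y^2
    and f up to completion, so when f = h(u, v) for local coordinates u, v and a
    suitable polynomial h over the field with two elements, the completion is
    k[[X, Y, Z]]/(Z^2 + h) ([double_point_completion]) and the point is singular
    ([double_point_singular]).  When P is not an eigenvector of phi, f is part of
    a system of local coordinates and the point is regular
    ([singular_eigenvector]).

    Over an algebraically closed field phi has a basis of fixed vectors on a
    subspace and is nilpotent on a complement.  The rank of m leaves four cases,
    according to the number 3, 2, 1 or 0 of independent fixed vectors
    ([semilin_normal_form]).  In each of them the eigenvectors are found by
    solving the equation v_i^2 = a v_i and its analogues, and f can be read off:
    the four cases give 7A_1, D_4^0 + 3A_1, D_6^0 + A_1 and E_7^0. *)

Set Implicit Arguments.
Unset Strict Implicit.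
Unset Printing Implicit Defensive.

Import GRing.Theory.
Local Open Scope classical_set_scope.
Local Open Scope ring_scope.
(** * Local divisibility implies divisibility *)

Section LocalDivisibility.
Variable k : closedFieldType.

(** The quotient A / B is regular at every point p, with c a denominator not
    vanishing there. *)
Definition local_dvd (R : idomainType) (T : Type) (ev : T -> R -> k) (A B : R) :=
  forall p, exists c e : R, c * A = e * B /\ ev p c != 0.

Section Step.
Variables (R : idomainType) (io : {rmorphism k -> R}) (T : Type).
Variable ev : T -> {rmorphism R -> k}.
Hypothesis ev_io : forall p a, ev p (io a) = a.
Hypothesis ev_neq0 : forall r : R, r != 0 -> exists p, ev p r != 0.
Hypothesis ldvd : forall A B : R, B != 0 ->
  local_dvd ev A B -> exists G, A = G * B.

Definition evp (pb : T * k) : {rmorphism {poly R} -> k} :=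
  horner_eval pb.2 \o map_poly (ev pb.1).

Lemma evpE p b (q : {poly R}) : evp (p, b) q = ev p q.[io b].
Proof. by rewrite /= /horner_eval -{1}(ev_io p b) horner_map. Qed.

Lemma evp_neq0 (q : {poly R}) : q != 0 -> exists pb, evp pb q != 0.
Proof.
move=> q0; have /ev_neq0[p lp] : lead_coef q != 0 by rewrite lead_coef_eq0.
have /closed_nonrootP[b rb] : map_poly (ev p) q != 0.
  apply: contraNneq lp => E; rewrite /lead_coef.
  by rewrite -[ev p _]/((ev p : R -> k) _) -coef_map /= E coef0.
by exists (p, b).
Qed.

(** Newton interpolation: A is the sum of its value at a point x0 outside of l,
    which is divisible by b, and of a multiple of X - x0, whose cofactor has
    divisible values outside of x0 and l. *)
Lemma fiberwise_dvd (b : R) n (A : {poly R}) (l : seq k) : (size A <= n)%N ->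
    (forall x, x \notin l -> exists g, A.[io x] = g * b) ->
  exists G, A = G * b%:P.
Proof.
elim: n A l => [|n IHn] A l sA HA.
  by exists 0; rewrite mul0r; apply/eqP; rewrite -size_poly_leq0.
have [x0 x0l] : exists x0, x0 \notin l.
  have /closed_nonrootP[x rx] : \prod_(y <- l) ('X - y%:P) != 0 :> {poly k}.
    by apply/monic_neq0/monic_prod_XsubC.
  by exists x; rewrite root_prod_XsubC in rx.
have [g0 Dg0] := HA _ x0l.
have /factor_theorem[Q DQ] : root (A - A.[io x0]%:P) (io x0).
  by rewrite rootE !hornerE subrr.
have DA : A = Q * ('X - (io x0)%:P) + A.[io x0]%:P by rewrite -DQ subrK.
have sQ : (size Q <= n)%N.
  have [->|Q0] := eqVneq Q 0; first by rewrite size_poly0.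
  have : (size (A - A.[io x0]%:P)%R <= n.+1)%N.
    apply: leq_trans (size_polyD _ _) _; rewrite size_polyN geq_max sA.
    by apply: leq_trans (size_polyC_leq1 _) _.
  by rewrite DQ size_Mmonic ?monicXsubC // size_XsubC addn2 ltnS.
have [|G DG] := IHn Q (x0 :: l) sQ.
  move=> x; rewrite inE negb_or => /andP[xx0 xl].
  have [g Dg] := HA _ xl.
  have u0 : io (x - x0) * io (x - x0)^-1 = 1.
    by rewrite -rmorphM divff ?rmorph1 // subr_eq0.
  exists ((g - g0) * io (x - x0)^-1).
  have := congr1 (fun p => p.[io x]) DA; rewrite !hornerE Dg Dg0 -rmorphB => E.
  have {E} E : Q.[io x] * io (x - x0) = (g - g0) * b.
    by rewrite mulrBl E addrK.
  by rewrite -[LHS]mulr1 -u0 mulrA E mulrAC.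
exists (G * ('X - (io x0)%:P) + g0%:P).
by rewrite DA Dg0 DG polyCM mulrDl; congr (_ + _); rewrite mulrAC.
Qed.

(** The locus where s and the last variable vanish has codimension two, so it
    does not matter that nothing is assumed there.

    Reduce to A and B without common factor of positive degree.  If B has
    positive degree then a resultant r, which lies in the ideal (A, B), has
    B dividing r c for every local denominator c; a zero of B outside of the
    zeros of r contradicts this.  So B is constant, and it divides the values
    of A. *)
Lemma local_dvd_poly (s : R) (A B : {poly R}) : s != 0 -> B != 0 ->
    (forall p b, (ev p s != 0) || (b != 0) ->
       exists c e, c * A = e * B /\ evp (p, b) c != 0) ->
  exists G, A = G * B.
Proof.
move=> s0; have [n] := ubnP (size B); elim: n A B => // n IHn A B.
rewrite ltnS => sB B0 loc.
have [A0|A0] := eqVneq A 0; first by exists 0; rewrite mul0r.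
have [sB1|sB1] := leqP (size B) 1.
  have DB := size1_polyC sB1; rewrite DB in loc *.
  apply: (@fiberwise_dvd _ (size A) A [:: 0]) => // x; rewrite inE => x0.
  apply: ldvd => [|p]; first by rewrite DB polyC_eq0 in B0.
  have [|c [e [ce c0]]] := loc p x; first by rewrite x0 orbT.
  exists c.[io x], e.[io x]; split; last by rewrite -evpE.
  by rewrite -!hornerM ce !hornerE.
have [sg|sg] := ltnP 1 (size (gcdp A B)).
  have /Pdiv.Idomain.dvdpP[[c1 A1] /= c10 DA] := dvdp_gcdl A B.
  have /Pdiv.Idomain.dvdpP[[c2 B1] /= c20 DB] := dvdp_gcdr A B.
  set d := gcdp A B in sg DA DB.
  have d0 : d != 0 by rewrite -size_poly_gt0 ltnW.
  have B10 : B1 != 0.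
    apply: contraNneq B0 => B10; move/eqP: DB.
    by rewrite B10 mul0r scale_poly_eq0 (negPf c20).
  have [|||G DG] := IHn (c2 *: A1) (c1 *: B1).
  - rewrite size_scale //; apply: leq_trans sB.
    rewrite -(size_scale B c20) DB size_mul //.
    by case: (size d) sg => // -[|m] // _; rewrite !addnS /= ltnS leq_addr.
  - by rewrite scale_poly_eq0 negb_or c10.
  - move=> p b /loc[c [e [ce c0]]]; exists c, e; split=> //.
    apply: (mulIf d0); rewrite -!mulrA -!scalerAl -DA -DB.
    by rewrite !scalerA [c1 * c2]mulrC -!scalerAr ce.
  exists G; have cc : c1 * c2 != 0 by rewrite mulf_neq0.
  suff: (c1 * c2) *: A = (c1 * c2) *: (G * B).
    move/eqP; rewrite -subr_eq0 -scalerBr scale_poly_eq0 (negPf cc) subr_eq0.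
    by move/eqP.
  rewrite [c1 * c2]mulrC -[LHS]scalerA DA scalerAl DG -mulrA -scalerAl -DB.
  by rewrite scalerA -scalerAr [c1 * c2]mulrC.
have [r r0 [u [v Dr]]] : exists2 r, r != 0 & exists u v, r%:P = u * A + v * B.
  have [sA|sA] := leqP (size A) 1.
    have DA := size1_polyC sA; exists A`_0.
      by rewrite -polyC_eq0 -DA.
    by exists 1, 0; rewrite mul0r addr0 mul1r -DA.
  exists (resultant A B); first by rewrite resultant_eq0 -leqNgt.
  by have [[u v] _ D] := resultant_in_ideal sA sB1; exists u, v.
have [p] : exists p, ev p (r * lead_coef B * s) != 0.
  by apply: ev_neq0; rewrite !mulf_neq0 ?lead_coef_eq0.
rewrite !rmorphM !mulf_eq0 !negb_or => /andP[/andP[pr pB] ps].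
have /closed_rootP[b rb] : size (map_poly (ev p) B) != 1%N.
  rewrite neq_ltn; apply/orP; right; rewrite size_poly_eq //.
have [|c [e [ce]]] := loc p b; first by rewrite ps.
have rcB : r%:P * c = (u * e + v * c) * B.
  by rewrite Dr !mulrDl -[u * A * c]mulrA [A * c]mulrC ce; ring.
have /(congr1 (evp (p, b))) := rcB.
rewrite !rmorphM [evp _ B](rootP rb) mulr0 => /eqP.
by rewrite mulf_eq0 evpE hornerC (negPf pr) => /= /eqP ->; rewrite eqxx.
Qed.

End Step.
End LocalDivisibility.

Section ThreeVariables.
Variable k : closedFieldType.
Local Notation P1 := {poly k}.
Local Notation P2' := {poly {poly k}}.
Local Notation P3 := {poly {poly {poly k}}}.

Definition ev0 (_ : unit) : {rmorphism k -> k} := idfun.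
Definition io1 : {rmorphism k -> P1} := polyC.
Definition io2 : {rmorphism k -> P2'} := polyC \o polyC.
Definition io3 : {rmorphism k -> P3} := polyC \o polyC \o polyC.
Definition ev1 := evp ev0.
Definition ev2 := evp ev1.
Definition ev3 := evp ev2.

Lemma ev_io1 p a : ev1 p (io1 a) = a.
Proof. by case: p => p b; rewrite (@evpE _ _ idfun) //= hornerC. Qed.
Lemma ev_io2 p a : ev2 p (io2 a) = a.
Proof. by case: p => p b; rewrite (@evpE _ _ io1) ?hornerC ?ev_io1 //; apply: ev_io1. Qed.

Lemma ev_neq01 (r : P1) : r != 0 -> exists p, ev1 p r != 0.
Proof. by apply: evp_neq0 => // r' r0; exists tt. Qed.
Lemma ev_neq02 (r : P2') : r != 0 -> exists p, ev2 p r != 0.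
Proof. exact: (evp_neq0 ev_neq01). Qed.
Lemma ev_neq03 (r : P3) : r != 0 -> exists p, ev3 p r != 0.
Proof. exact: (evp_neq0 ev_neq02). Qed.

Lemma local_dvd1 (A B : P1) : B != 0 -> local_dvd ev1 A B -> exists G, A = G * B.
Proof.
move=> B0 loc; apply: (@local_dvd_poly _ _ idfun _ ev0 _ _ _ 1) => //.
- by move=> r r0; exists tt.
- by move=> a b b0 _; exists (a / b); rewrite divfK.
- exact: oner_neq0.
Qed.

Lemma local_dvd2 (A B : P2') : B != 0 -> local_dvd ev2 A B -> exists G, A = G * B.
Proof.
move=> B0 loc; apply: (@local_dvd_poly _ _ io1 _ ev1 _ _ _ 1) => //.
- exact: ev_io1.
- exact: ev_neq01.
- exact: local_dvd1.
- exact: oner_neq0.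
Qed.

Lemma local_dvd3 (A B : P3) : B != 0 ->
    (forall p b, (ev2 p 'X != 0) || (b != 0) ->
       exists c e, c * A = e * B /\ ev3 (p, b) c != 0) ->
  exists G, A = G * B.
Proof.
move=> B0 loc; apply: (@local_dvd_poly _ _ io2 _ ev2 _ _ _ 'X) => //.
- exact: ev_io2.
- exact: ev_neq02.
- exact: local_dvd2.
- by rewrite polyX_eq0.
Qed.

Variables i j l : 'I_3.
Hypothesis uniq_ijl : uniq [:: i; j; l].

Lemma neq_ijl : [/\ i != j, i != l & j != l].
Proof. by move: uniq_ijl; rewrite /= !inE !negb_or => /and3P[/andP[]]. Qed.

Lemma ord3_cases (n : 'I_3) : [\/ n = i, n = j | n = l].
Proof.
have : n \in [:: i; j; l].
  have sub : {subset [:: i; j; l] <= enum 'I_3} by move=> m _; rewrite mem_enum.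
  have [|_ ->] := uniq_min_size uniq_ijl sub; last by rewrite mem_enum.
  by rewrite size_enum_ord.
by rewrite !inE => /or3P[] /eqP ->; [constructor 1 | constructor 2 | constructor 3].
Qed.

(** The last two variables to be adjoined are j and i, the ones for which the
    local hypothesis of [local_dvd_poly] is stated. *)
Definition nest_var (n : 'I_3) : P3 :=
  if n == i then 'X else if n == j then 'X%:P else 'X%:P%:P.
Definition nest : {rmorphism {mpoly k[3]} -> P3} := mmap io3 nest_var.

Definition unnest1 : {rmorphism P1 -> {mpoly k[3]}} :=
  horner_eval 'X_l \o map_poly (@mpolyC 3 k).
Definition unnest2 : {rmorphism P2' -> {mpoly k[3]}} :=
  horner_eval 'X_j \o map_poly unnest1.
Definition unnest3 : {rmorphism P3 -> {mpoly k[3]}} :=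
  horner_eval 'X_i \o map_poly unnest2.

Lemma unnest3C q : unnest3 q%:P = unnest2 q.
Proof. by rewrite -[LHS]/((map_poly unnest2 q%:P).['X_i]) map_polyC hornerC. Qed.
Lemma unnest2C q : unnest2 q%:P = unnest1 q.
Proof. by rewrite -[LHS]/((map_poly unnest1 q%:P).['X_j]) map_polyC hornerC. Qed.
Lemma unnest1C c : unnest1 c%:P = c%:MP.
Proof. by rewrite -[LHS]/((map_poly (@mpolyC 3 k) c%:P).['X_l]) map_polyC hornerC. Qed.
Lemma unnest3X : unnest3 'X = 'X_i.
Proof. by rewrite -[LHS]/((map_poly unnest2 'X).['X_i]) map_polyX hornerX. Qed.
Lemma unnest2X : unnest2 'X = 'X_j.
Proof. by rewrite -[LHS]/((map_poly unnest1 'X).['X_j]) map_polyX hornerX. Qed.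
Lemma unnest1X : unnest1 'X = 'X_l.
Proof. by rewrite -[LHS]/((map_poly (@mpolyC 3 k) 'X).['X_l]) map_polyX hornerX. Qed.

Definition unnestE :=
  (unnest3C, unnest2C, unnest1C, unnest3X, unnest2X, unnest1X).

Lemma nestC c : nest c%:MP = c%:P%:P%:P.
Proof. exact: mmapC. Qed.
Lemma nestX m : nest 'X_[m] = \prod_n nest_var n ^+ m n.
Proof. exact: mmapX. Qed.

Lemma nestK q : unnest3 (nest q) = q.
Proof.
have [ij il jl] := neq_ijl.
elim/mpolyind: q => [|c m p _ _ IH]; first by rewrite !rmorph0.
rewrite (rmorphD nest) (rmorphD unnest3) IH; congr (_ + _).
rewrite -mul_mpolyC (rmorphM nest) (rmorphM unnest3); congr (_ * _).
  by rewrite nestC !unnestE.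
rewrite nestX [RHS]mpolyXE_id (rmorph_prod unnest3); apply: eq_bigr => n _.
rewrite (rmorphXn unnest3); congr (_ ^+ _); rewrite /nest_var.
have [->|->|->] := ord3_cases n.
- by rewrite eqxx !unnestE.
- by rewrite eq_sym (negPf ij) eqxx !unnestE.
- by rewrite eq_sym (negPf il) eq_sym (negPf jl) !unnestE.
Qed.

Lemma ev3E x y z (q : P3) : ev3 (tt, x, y, z) q = q.[z%:P%:P].[y%:P].[x].
Proof. by rewrite (evpE ev_io2) (evpE ev_io1) (@evpE _ _ idfun). Qed.

Lemma ev_nest (v : 'I_3 -> k) q : ev3 (tt, v l, v j, v i) (nest q) = q.@[v].
Proof.
have [ij il jl] := neq_ijl.
elim/mpolyind: q => [|c m p _ _ IH]; first by rewrite !rmorph0.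
rewrite (rmorphD nest) (rmorphD (ev3 _)) IH mevalD; congr (_ + _).
rewrite -mul_mpolyC (rmorphM nest) (rmorphM (ev3 _)) mevalM mevalC; congr (_ * _).
  by rewrite nestC ev3E !hornerC.
rewrite nestX mevalX (rmorph_prod (ev3 _)); apply: eq_bigr => n _.
rewrite (rmorphXn (ev3 _)) ev3E; congr (_ ^+ _); rewrite /nest_var.
have [->|->|->] := ord3_cases n.
- by rewrite eqxx !(hornerX, hornerC).
- by rewrite eq_sym (negPf ij) eqxx !(hornerX, hornerC).
- by rewrite eq_sym (negPf il) eq_sym (negPf jl) !(hornerX, hornerC).
Qed.

(** The variables are adjoined one at a time, with [local_dvd_poly] as the
    inductive step. *)
Lemma local_dvd_mpoly (A B : {mpoly k[3]}) : B != 0 ->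
    (forall v : 'I_3 -> k, (v i != 0) || (v j != 0) ->
       exists c e, c * A = e * B /\ c.@[v] != 0) ->
  exists G, A = G * B.
Proof.
have [ij il jl] := neq_ijl; move=> B0 loc.
have [||G DG] := @local_dvd3 (nest A) (nest B).
- by apply: contraNneq B0 => E; rewrite -(nestK B) E rmorph0.
- move=> [[[] x] y] z.
  have -> : ev2 (tt, x, y) 'X = y by rewrite (evpE ev_io1) hornerX ev_io1.
  pose v n := if n == i then z else if n == j then y else x.
  have vi : v i = z by rewrite /v eqxx.
  have vj : v j = y by rewrite /v eq_sym (negPf ij) eqxx.
  have vl : v l = x by rewrite /v eq_sym (negPf il) eq_sym (negPf jl).
  rewrite orbC => h; have [|c [e [ce c0]]] := loc v; first by rewrite vi vj.
  exists (nest c), (nest e); split; first by rewrite -!(rmorphM nest) ce.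
  by rewrite -vi -vj -vl ev_nest.
by exists (unnest3 G); rewrite -(nestK A) DG rmorphM nestK.
Qed.

Lemma mpoly3_neq0 (A : {mpoly k[3]}) : A != 0 -> exists v, A.@[v] != 0.
Proof.
have [ij il jl] := neq_ijl; move=> A0.
have [|[[[[] x] y] z] h] := @ev_neq03 (nest A).
  by apply: contraNneq A0 => E; rewrite -(nestK A) E rmorph0.
exists (fun n => if n == i then z else if n == j then y else x).
rewrite -ev_nest eqxx [j == i]eq_sym (negPf ij) eqxx.
by rewrite [l == i]eq_sym (negPf il) [l == j]eq_sym (negPf jl).
Qed.

End ThreeVariables.
(** * Homogeneous polynomials in characteristic two *)

Section Char2.
Variable R : comNzRingType.
Hypothesis R2 : 2%N \in [pchar R].

Lemma sqrD2 (x y : R) : (x + y) ^+ 2 = x ^+ 2 + y ^+ 2.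
Proof. by rewrite sqrrD mulrn_pchar // addr0. Qed.

Lemma sqr_sum2 I (r : seq I) (P : pred I) (E : I -> R) :
  (\sum_(i <- r | P i) E i) ^+ 2 = \sum_(i <- r | P i) E i ^+ 2.
Proof. by apply: (big_morph (fun x => x ^+ 2) sqrD2); rewrite expr0n. Qed.

End Char2.

Section ClosedChar2.
Variable k : closedFieldType.

Lemma sqrt_ex (a : k) : exists b, b ^+ 2 == a.
Proof.
have /closed_rootP[b] : size ('X^2 - a%:P) != 1%N by rewrite size_XnsubC.
by rewrite rootE !hornerE subr_eq0; exists b.
Qed.
Definition sqrtk a := xchoose (sqrt_ex a).
Lemma sqrtkK a : sqrtk a ^+ 2 = a.
Proof. exact/eqP/(xchooseP (sqrt_ex a)). Qed.

End ClosedChar2.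

Section Homogeneous.
Variables (k : closedFieldType) (n : nat).
Hypothesis k2 : 2%N \in [pchar k].
Implicit Types p q : {mpoly k[n]}.

Lemma pchar2_mpoly : 2%N \in [pchar {mpoly k[n]}].
Proof. by rewrite pchar_lalg. Qed.

Lemma mderivXU i j : ('X_i : {mpoly k[n]})^`M(j) = (i == j)%:R.
Proof.
rewrite mderivX mnm1E; case: eqP => [->|_]; last by rewrite scale0r.
by rewrite scale1r (_ : (_ - _)%MM = 0%MM) ?mpolyX0 //; apply/mnmP => l; rewrite !mnmE subnn.
Qed.

Lemma mderiv_homog d p i : p \is d.+1.-homog -> p^`M(i) \is d.-homog.
Proof.
move=> /dhomogP hp; apply/dhomogP => m.
rewrite mcoeff_msupp mcoeff_deriv => h.
have : (m + U_(i))%MM \in msupp p.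
  by rewrite mcoeff_msupp; apply: contraNneq h => ->; rewrite mul0rn.
by move/hp; rewrite /= mdegD mdeg1 addn1 => -[].
Qed.

Lemma euler_homog d p : p \is d.-homog -> \sum_i 'X_i * p^`M(i) = p *+ d.
Proof.
move=> /dhomogP hp; rewrite {1}(mpolyE p) [in RHS](mpolyE p) -sumrMnl.
under eq_bigr => i _ do rewrite raddf_sum mulr_sumr.
rewrite exchange_big; apply: eq_big_seq => m /hp /= <-.
rewrite mdegE -sumrMnr; apply: eq_bigr => i _.
rewrite mderivZ -scalerAr mderivX -scalerAr scalerMnr; congr (_ *: _).
have [->|mi] := posnP (m i); first by rewrite scale0r.
by rewrite -mpolyXD addmC submK ?scaler_nat // lep1mP -lt0n.
Qed.

Lemma mderiv_sqr p i : p^`M(i)^`M(i) = 0.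
Proof.
apply/mpolyP => m; rewrite !mcoeff_deriv mcoeff0 -mulrnA.
rewrite mnmDE mnm1E eqxx addn1.
have : ~~ odd ((m i).+2 * (m i).+1) by rewrite oddM /= negbK; case: odd.
move/even_halfK <-.
by rewrite -mul2n mulrnA (mulrn_pchar k2) mul0rn.
Qed.

Lemma linear_mderiv0 p : p \is 1.-homog -> (forall i, p^`M(i) = 0) -> p = 0.
Proof.
move=> hp dp; rewrite -[p]mulr1n -(euler_homog hp).
by apply: big1 => i _; rewrite dp mulr0.
Qed.

Lemma homog0_mderiv p i : p \is 0.-homog -> p^`M(i) = 0.
Proof.
move=> hp; apply/mpolyP => m; rewrite mcoeff_deriv mcoeff0.
by rewrite (dhomog_nemf_coeff hp) ?mul0rn //= mdegD mdeg1 addn1.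
Qed.

(** Only monomials with even exponents have zero partial derivatives, and every
    coefficient is a square. *)
Lemma sqrt_homog d p : p \is (d.*2).-homog -> (forall i, p^`M(i) = 0) ->
  exists2 s, s \is d.-homog & p = s ^+ 2.
Proof.
move=> /dhomogP hp dp.
have even m i : m \in msupp p -> ~~ odd (m i).
  move=> mp; apply/negP => odd_mi.
  have mi : (U_(i) <= m)%MM by rewrite lep1mP; case: (m i) odd_mi.
  have := congr1 (mcoeff (m - U_(i))%MM) (dp i).
  rewrite mcoeff_deriv submK // mcoeff0 mnmBE mnm1E eqxx subn1 prednK; last first.
    by case: (m i) odd_mi.
  rewrite -[m i]odd_double_half odd_mi.
  rewrite mulrnDr mulr1n -muln2 mulrnA mulrn_pchar // addr0.
  by apply/eqP; rewrite mcoeff_eq0 mp.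
pose half (m : 'X_{1..n}) := [multinom (m i)./2 | i < n].
have Dm m : m \in msupp p -> (half m *+ 2)%MM = m.
  move=> mp; apply/mnmP => i; rewrite mulmnE mnmE muln2.
  by rewrite -[RHS]odd_double_half (negPf (even _ _ mp)).
exists (\sum_(m <- msupp p) sqrtk p@_m *: 'X_[half m]).
  rewrite big_seq; apply: rpred_sum => m mp; apply: rpredZ; rewrite dhomogX /=.
  by rewrite -(eqn_pmul2r (isT : 0 < 2)%N) -mdegMn Dm // muln2 hp.
rewrite (sqr_sum2 pchar2_mpoly) {1}(mpolyE p); apply: eq_big_seq => m mp.
by rewrite exprZn sqrtkK mpolyXn Dm.
Qed.

End Homogeneous.
(** * Fractions, local rings and derivations of the plane *)

Section RatconstMorphism.
Variable k : fieldType.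

Fact ratconst_zmod_morphism : zmod_morphism (@ratconst k).
Proof. by move=> a b; apply: ratfun_val_inj; rewrite /= mpolyCB !rmorphB. Qed.
Fact ratconst_monoid_morphism : monoid_morphism (@ratconst k).
Proof.
by split=> [|a b]; apply: ratfun_val_inj; rewrite /= ?mpolyCM ?(rmorph1, rmorphM).
Qed.

HB.instance Definition _ :=
  GRing.isZmodMorphism.Build k (ratfun k) (@ratconst k) ratconst_zmod_morphism.
HB.instance Definition _ :=
  GRing.isMonoidMorphism.Build k (ratfun k) (@ratconst k) ratconst_monoid_morphism.

End RatconstMorphism.

Lemma mpoly_ring_ind (R : comNzRingType) n (Q : {mpoly R[n]} -> Prop) :
    (forall c, Q c%:MP) -> (forall i, Q 'X_i) ->
    (forall p q, Q p -> Q q -> Q (p + q)) ->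
    (forall p q, Q p -> Q q -> Q (p * q)) ->
  forall p, Q p.
Proof.
move=> QC QX QD QM; elim/mpolyind => [|c m p _ _ Qp]; first exact: (QC 0).
apply: QD => //; rewrite -mul_mpolyC; apply: (QM) => //.
rewrite mpolyXE_id; apply: (big_ind Q) => //; first exact: (QC 1).
by move=> i _; elim: (m i) => [|e IH]; [exact: (QC 1) | rewrite exprS; apply: QM].
Qed.

Section Twist.
Variable k : closedFieldType.
Local Notation Px := {mpoly k[3]}.
Local Notation F := {fraction Px}.
Local Notation K := (ratfun k).
Implicit Types (P Q : 'rV[k]_3) (a b c : Px) (x y : F) (n m : int).

Lemma meval_neq0 P a : a.@[P 0] != 0 -> a != 0.
Proof. by apply: contraNneq => ->; rewrite meval0. Qed.

Lemma neq0_coord P : P != 0 -> exists j, P 0 j != 0.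
Proof. by move/rV0Pn => [j]; exists j. Qed.

Lemma homogX i : ('X_i : Px) \is 1.-homog.
Proof. by rewrite dhomogX /= mdeg1. Qed.

Lemma mpolyXU_neq0 i : ('X_i : Px) != 0.
Proof.
apply/eqP => /(congr1 (mcoeff U_(i)%MM)); rewrite mcoeffX eqxx mcoeff0.
by apply/eqP; exact: oner_neq0.
Qed.

Lemma hom_fraction0 d a b : a \is d.-homog -> b \is d.-homog -> hom_fraction 0 a b.
Proof. by move=> ha hb; exists d, d; rewrite addr0. Qed.

Lemma twist_poly d P a : a \is d.-homog -> twist_at d%:Z P (tofrac a).
Proof.
move=> ha; exists a, 1; split; last by rewrite rmorph1 divr1.
  by exists 0%N, d; split; rewrite ?dhomog1 ?add0r.
by rewrite meval1 oner_neq0.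
Qed.

Lemma twistV d P b : b \is d.-homog -> b.@[P 0] != 0 ->
  twist_at (- d%:Z) P (tofrac b)^-1.
Proof.
move=> hb b0; exists 1, b; split=> //; last by rewrite rmorph1 div1r.
by exists d, 0%N; split; rewrite ?dhomog1 ?subrr.
Qed.

Lemma twistM n m P x y : twist_at n P x -> twist_at m P y ->
  twist_at (n + m) P (x * y).
Proof.
move=> [a [b [[d [e [De ha hb]]] b0 ->]]] [a' [b' [[d' [e' [De' ha' hb']]] b'0 ->]]].
exists (a * a'), (b * b'); split; last by rewrite !rmorphM mulf_div.
  exists (d + d')%N, (e + e')%N; split; try exact: dhomogM.
  by rewrite !PoszD De De' addrACA.
by rewrite mevalM mulf_neq0.
Qed.

Lemma twistD n P x y : twist_at n P x -> twist_at n P y -> twist_at n P (x + y).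
Proof.
move=> [a [b [[d [e [De ha hb]]] b0 ->]]] [a' [b' [[d' [e' [De' ha' hb']]] b'0 ->]]].
exists (a * b' + a' * b), (b * b'); split.
- exists (d + d')%N, (e + d')%N; split; last exact: dhomogM.
    by rewrite !PoszD De addrAC.
  apply: rpredD; first exact: dhomogM.
  suff -> : (e + d' = e' + d)%N by apply: dhomogM.
  by lia.
- by rewrite mevalM mulf_neq0.
- by rewrite rmorphD !rmorphM addf_div // tofrac_eq0 (meval_neq0 b0, meval_neq0 b'0).
Qed.

Lemma twistC P (s : k) : twist_at 0 P (tofrac s%:MP).
Proof.
apply: (@twist_poly 0%N).
by rewrite -[s]mulr1 mpolyCM mul_mpolyC rpredZ ?dhomog1.
Qed.

Lemma twist0 n P : P != 0 -> twist_at n P 0.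
Proof.
case: n => [n _|n /neq0_coord[j Pj]].
  by rewrite -(rmorph0 (@tofrac Px)); apply: twist_poly; apply: rpred0.
rewrite -(mul0r (tofrac ('X_j ^+ n.+1))^-1) -(rmorph0 (@tofrac Px)) -[Negz n]add0r.
apply: twistM; first by apply: (@twist_poly 0%N); apply: rpred0.
rewrite NegzE; apply: twistV; first by rewrite -{2}[n.+1]mul1n; apply: dhomogMn (homogX j).
by rewrite rmorphXn /= mevalXU expf_neq0.
Qed.

Lemma twistN n P x : twist_at n P x -> twist_at n P (- x).
Proof.
move=> h; rewrite -mulN1r -[n]add0r; apply: twistM h.
by rewrite -(rmorph1 (@tofrac Px)) -rmorphN -mpolyC1 -mpolyCN; apply: twistC.
Qed.

(** The inclusion of the function field is inverted on fractions of degree 0. *)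
Definition mkratfun x : K := insubd (0 : K) x.

Lemma degree0_twist P x : twist_at 0 P x -> x \in degree0 (k := k).
Proof.
by move=> [a [b [h b0 ->]]]; apply/asboolP; exists a, b; rewrite (meval_neq0 b0).
Qed.

Lemma mkratfunK x : x \in degree0 (k := k) -> ratfun_val (mkratfun x) = x.
Proof. by move=> h; rewrite [LHS]val_insubd h. Qed.

Lemma twist_ratfun P x : twist_at 0 P x -> exists2 g, regular_at P g & ratfun_val g = x.
Proof.
by move=> h; exists (mkratfun x); rewrite /regular_at /= mkratfunK //; apply: degree0_twist h.
Qed.

Lemma regularD P (f g : K) : regular_at P f -> regular_at P g -> regular_at P (f + g).
Proof. by rewrite /regular_at /= rmorphD; apply: twistD. Qed.
Lemma regularM P (f g : K) : regular_at P f -> regular_at P g -> regular_at P (f * g).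
Proof. by rewrite /regular_at /= rmorphM; apply: (@twistM 0 0). Qed.
Lemma regularC P (s : k) : regular_at P (ratconst s : K).
Proof. exact: twistC. Qed.
Lemma regularN P (f : K) : regular_at P f -> regular_at P (- f).
Proof. by rewrite /regular_at /= rmorphN; apply: twistN. Qed.

Lemma regular_rep P (f : K) : regular_at P f -> exists d a b,
  [/\ a \is d.-homog, b \is d.-homog, b.@[P 0] != 0 & ratfun_val f = tofrac a / tofrac b].
Proof.
move=> [a [b [[d [e [De ha hb]]] b0 ->]]]; exists d, a, b; split=> //.
by move: De; rewrite addr0 => -[<-].
Qed.

(** ** Open subsets *)

Definition basic_open b : set 'rV[k]_3 :=
  fun P => P != 0 /\ b.@[P 0] != 0.

(** In [zopen] the condition P != 0 compares the coordinates as functions, here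
    it compares vectors. *)
Lemma zopenE (U : set 'rV[k]_3) : zopen U <-> exists G : set Px,
  (forall g, G g -> exists d : nat, g \is d.-homog) /\
  (forall P, U P <-> P != 0 /\ exists2 g, G g & g.@[P 0] != 0).
Proof.
have fun0 P : (P != 0) <-> (fun_of_matrix P != 0).
  split; apply: contraNneq => E; first by apply/eqP/matrixP => i j; rewrite E mxE.
  by apply/eqP; rewrite E; apply/funext => i; apply/funext => j; rewrite mxE.
split=> -[G [hG UG]]; exists G; split=> //.
  by move=> P; rewrite UG /= -(propext (fun0 P)).
by apply/seteqP; split=> P /=; rewrite -(propext (fun0 P)) UG.
Qed.

Lemma zopen_basic d b : b \is d.-homog -> zopen (basic_open b).
Proof.
move=> hb; apply/zopenE; exists [set b]; split; first by move=> g ->; exists d.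
by move=> P; split=> -[P0 h]; split=> //; [exists b | case: h => g ->].
Qed.

Lemma zopenI (U V : set 'rV[k]_3) : zopen U -> zopen V -> zopen (U `&` V).
Proof.
move=> /zopenE[G [hG UG]] /zopenE[H [hH VH]]; apply/zopenE.
exists [set f | exists g h, [/\ G g, H h & f = g * h]]; split.
  move=> f [g [h [/hG[d hg] /hH[e hh] ->]]]; exists (d + e)%N; exact: dhomogM.
move=> P; split.
  move=> [/UG[P0 [g Gg g0]] /VH[_ [h Hh h0]]]; split=> //.
  by exists (g * h); [exists g, h | rewrite mevalM mulf_neq0].
move=> [P0 [f [g [h [Gg Hh ->]]]]]; rewrite mevalM mulf_eq0 negb_or => /andP[g0 h0].
by split; [apply/UG | apply/VH]; split=> //; [exists g | exists h].
Qed.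

Lemma nzopenI (U V : set 'rV[k]_3) : nzopen U -> nzopen V -> nzopen (U `&` V).
Proof.
move=> [zU [P UP]] [zV [Q VQ]]; split; first exact: zopenI.
move: zU zV => /zopenE[G [_ UG]] /zopenE[H [_ VH]].
move: UP VQ => /UG[_ [g Gg g0]] /VH[_ [h Hh h0]].
have [|v] := @mpoly3_neq0 k 0 1 2 isT (g * h * 'X_0).
  by rewrite !mulf_neq0 ?(meval_neq0 g0, meval_neq0 h0) // mpolyXU_neq0.
rewrite !mevalM !mulf_eq0 !negb_or mevalXU => /andP[/andP[gv hv] v0].
pose R : 'rV[k]_3 := \row_j v j.
have E : R 0 =1 v by move=> j; rewrite mxE.
have R0 : R != 0 by apply: contraNneq v0 => R0; rewrite -E R0 mxE.
by exists R; split; [apply/UG | apply/VH]; (split; first exact: R0);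
  [exists g | exists h] => //; rewrite (meval_eq _ E).
Qed.

Lemma regular_open P (f : K) : P != 0 -> regular_at P f ->
  exists U, [/\ zopen U, U P & OX U f].
Proof.
move=> P0 /regular_rep[d [a [b [ha hb b0 Df]]]]; exists (basic_open b); split=> //.
  exact: zopen_basic hb.
move=> Q [Q0 bQ]; exists a, b; split=> //; exact: hom_fraction0 ha hb.
Qed.

End Twist.
Fact der_dehom_subproof (E : comNzRingType) (a b a' b' e : E) :
  a' * e * b + a * (b' * e) = (a' * b + a * b') * e.
Proof. ring. Qed.

Section Derivations.
Variable k : closedFieldType.
Local Notation Px := {mpoly k[3]}.
Local Notation F := {fraction Px}.
Local Notation K := (ratfun k).

Section OneDerivation.
Variables (D : K -> K) (derD : derivation D).

Lemma derC c : D (ratconst c) = 0. Proof. by case: derD => h _ _; apply: h. Qed.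
Lemma derA : {morph D : f g / f + g}.
Proof. by case: derD => _ h _; apply: h. Qed.
Lemma derM f g : D (f * g) = D f * g + f * D g.
Proof. by case: derD => _ _ h; apply: h. Qed.
Lemma der1 : D 1 = 0. Proof. by have := derC 1; rewrite rmorph1. Qed.
Lemma der_div f g h : g != 0 -> f * g = h -> D f = (D h - f * D g) / g.
Proof. by move=> g0 <-; rewrite derM addrK mulfK. Qed.

End OneDerivation.

Lemma derivation_scale (f : K) D : derivation D -> derivation (fun x => f * D x).
Proof.
move=> [D0 D1 D2]; split.
- by move=> c; rewrite D0 mulr0.
- by move=> x y; rewrite D1 mulrDr.
- by move=> x y; rewrite D2 mulrDr mulrA mulrCA.
Qed.

Section Chart.
Variable l : Px.
Hypotheses (l_homog : l \is 1.-homog) (l_neq0 : l != 0).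

Definition aff_coord i : K := mkratfun (tofrac 'X_i / tofrac l).

Lemma aff_coordE i : ratfun_val (aff_coord i) = tofrac 'X_i / tofrac l.
Proof.
by apply/mkratfunK/degree0P; exists 1%N, 'X_i, l; rewrite l_homog homogX.
Qed.

Fact dehom_key : unit. Proof. exact: tt. Qed.
(** On forms of degree d this is the division by the d-th power of the linear
    form l; it is locked since its unfolding by simplification is not wanted. *)
Definition dehom : {rmorphism Px -> K} :=
  locked_with dehom_key (mmap (@ratconst k) aff_coord : {rmorphism Px -> K}).

Lemma dehomC c : dehom c%:MP = ratconst c.
Proof. by rewrite [dehom]unlock /= mmapC. Qed.
Lemma dehomX i : dehom 'X_i = aff_coord i.
Proof. by rewrite [dehom]unlock /= mmapX mmap1U. Qed.

Lemma dehomE d a : a \is d.-homog ->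
  ratfun_val (dehom a) = tofrac a / tofrac l ^+ d.
Proof.
move=> /dhomogP ha; rewrite {1 2}(mpolyE a) !rmorph_sum mulr_suml.
apply: eq_big_seq => m /ha /= <-.
rewrite -mul_mpolyC !rmorphM dehomC -mulrA; congr (_ * _).
rewrite mpolyXE_id !rmorph_prod mdegE -prodrXr -prodf_div /=.
apply: eq_bigr => i _; rewrite !rmorphXn dehomX /= aff_coordE.
by rewrite expr_div_n.
Qed.

Lemma dehom_neq0 d a : a \is d.-homog -> a != 0 -> dehom a != 0.
Proof.
move=> ha a0; apply/eqP => /(congr1 (@ratfun_val k)).
rewrite (dehomE ha) rmorph0 => /eqP.
by rewrite mulf_eq0 invr_eq0 expf_eq0 !tofrac_eq0 (negPf a0) (negPf l_neq0) andbF.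
Qed.

Lemma dehom_div d a b (f : K) : a \is d.-homog -> b \is d.-homog -> b != 0 ->
  ratfun_val f = tofrac a / tofrac b -> f = dehom a / dehom b.
Proof.
move=> ha hb b0 Df; apply: ratfun_val_inj.
rewrite fmorph_div /= (dehomE ha) (dehomE hb) Df invf_div mulrA mulfVK //.
by rewrite expf_neq0 // tofrac_eq0.
Qed.

Section AtPoint.
Variables (P : 'rV[k]_3) (lP : l.@[P 0] != 0).

Lemma regular_coord i : regular_at P (aff_coord i).
Proof.
rewrite /regular_at /= aff_coordE.
apply: (@twistM _ 1%:Z (- 1%:Z)); last exact: twistV.
by apply: twist_poly; exact: homogX.
Qed.

Lemma regular_dehom a : regular_at P (dehom a).
Proof.
elim/mpoly_ring_ind: a => [c|i|a b ha hb|a b ha hb].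
- by rewrite dehomC; apply: regularC.
- by rewrite dehomX; apply: regular_coord.
- by rewrite rmorphD; apply: regularD.
- by rewrite rmorphM; apply: regularM.
Qed.

Lemma regular_dehomV d b : b \is d.-homog -> b.@[P 0] != 0 ->
  regular_at P (dehom b)^-1.
Proof.
move=> hb b0; rewrite /regular_at /= fmorphV /= (dehomE hb) invf_div.
have E0 : d%:Z - d%:Z = 0 by rewrite subrr.
rewrite -E0; apply: twistM; last exact: twistV.
by rewrite -rmorphXn; apply: twist_poly; rewrite -{2}[d]mul1n; apply: dhomogMn.
Qed.

End AtPoint.

Lemma der_dehom D a : derivation D ->
  D (dehom a) = \sum_i dehom a^`M(i) * D (aff_coord i).
Proof.
move=> derD; elim/mpoly_ring_ind: a => [c|i|a b Ea Eb|a b Ea Eb].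
- by rewrite dehomC derC // big1 // => i _; rewrite mderivC rmorph0 mul0r.
- rewrite dehomX (bigD1 i) //= mderivXU eqxx rmorph1 mul1r big1 ?addr0 // => j ji.
  by rewrite mderivXU eq_sym (negPf ji) rmorph0 mul0r.
- rewrite rmorphD derA // Ea Eb -big_split; apply: eq_bigr => i _.
  by rewrite /= mderivD rmorphD mulrDl.
- rewrite rmorphM derM // Ea Eb mulr_suml mulr_sumr -big_split /=.
  by apply: eq_bigr => i _; rewrite der_dehom_subproof mderivM (rmorphD dehom) !(rmorphM dehom).
Qed.

(** A regular function is a quotient of dehomogenized forms, to which the chain
    rule [der_dehom] and the quotient rule apply. *)
Lemma TX_of_coord (U : set 'rV[k]_3) D :
    (forall P, U P -> l.@[P 0] != 0) -> derivation D ->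
    (forall P, U P -> forall i, regular_at P (D (aff_coord i))) ->
  TX U D.
Proof.
move=> Ul derD DU; split=> // P UP f /regular_rep[d [a [b [ha hb b0 Df]]]].
have regD c : regular_at P (D (dehom c)).
  rewrite der_dehom // -big_enum /=.
  apply: (big_ind (fun f => regular_at P f)).
  - by rewrite -(rmorph0 (@ratconst k)); apply: regularC.
  - by move=> x y; apply: regularD.
  - by move=> i _; apply: regularM; [apply: regular_dehom (Ul _ UP) _ | apply: DU].
have bn := meval_neq0 b0; have Df' := dehom_div ha hb bn Df.
have b1 := dehom_neq0 hb bn.
rewrite (@der_div D derD f (dehom b) (dehom a)) //; last by rewrite Df' divfK.
apply: regularM; last exact: regular_dehomV hb b0.
apply: regularD => //; apply: regularN; apply: regularM => //.
by exists a, b; split=> //; exact: hom_fraction0 ha hb.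
Qed.

End Chart.
End Derivations.
(** ** Sections of line bundles *)

Section Sections.
Variable k : closedFieldType.
Local Notation Px := {mpoly k[3]}.
Local Notation F := {fraction Px}.

Lemma pihomog_mulr d (b G : Px) i :
  b \is d.-homog -> pihomog mdeg (d + i) (b * G) = b * pihomog mdeg i G.
Proof.
move=> hb; rewrite {1}(pihomog_partitionE (leqnn (mmeasure mdeg G))) mulr_sumr.
rewrite raddf_sum /=.
have [lt_i|le_i] := ltnP i (mmeasure mdeg G).
  rewrite (bigD1 (Ordinal lt_i)) //= big1 ?addr0 => [|j ji].
    by rewrite pihomog_dE // dhomogM // pihomogP.
  apply: (@pihomog_ne0 _ _ _ (d + j)%N).
    by rewrite eqn_add2l; apply: contraNneq ji => /= ji; apply/eqP/val_inj.
  by rewrite dhomogM // pihomogP.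
have -> : pihomog mdeg i G = 0.
  rewrite {1}(pihomog_partitionE (leqnn (mmeasure mdeg G))) raddf_sum big1 //= => j _.
  apply: (@pihomog_ne0 _ _ _ j); last exact: pihomogP.
  by rewrite neq_ltn (leq_trans (ltn_ord j) le_i).
rewrite mulr0 big1 // => j _; apply: (@pihomog_ne0 _ _ _ (d + j)%N).
  by rewrite eqn_add2l neq_ltn (leq_trans (ltn_ord j) le_i).
by rewrite dhomogM // pihomogP.
Qed.

(** Compare the homogeneous components of b * G with those of G. *)
Lemma homog_factor d e (b G : Px) : b \is d.-homog -> b != 0 ->
  b * G \is e.-homog -> if (d <= e)%N then G \is (e - d).-homog : Prop else G = 0.
Proof.
move=> hb b0 hG.
have piG i : (d + i != e)%N -> pihomog mdeg i G = 0.
  move=> di; have := pihomog_mulr G i hb.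
  rewrite (@pihomog_ne0 _ _ _ e) 1?eq_sym // => /esym/eqP.
  by rewrite mulf_eq0 (negPf b0) => /eqP.
rewrite (pihomog_partitionE (leqnn (mmeasure mdeg G))).
case: leqP => de.
  apply: rpred_sum => i _; have [<-|/piG ->] := eqVneq (d + i)%N e.
    by rewrite addKn pihomogP.
  exact: rpred0.
by apply: big1 => i _; apply: piG; rewrite neq_ltn ltn_addr ?orbT.
Qed.

Lemma third_index (i j : 'I_3) : i != j -> exists l, uniq [:: i; j; l].
Proof.
by case: i j => [[|[|[|]]] //= Hi] [[|[|[|]]] //= Hj] // _;
  [exists (inord 2) | exists (inord 1) | exists (inord 2) | exists (inord 0)
   | exists (inord 1) | exists (inord 0)];
  rewrite /= !inE -!val_eqE /= inordK.
Qed.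

(** A section of O(n) extends over a point, here the one where the coordinates
    i and j both vanish.  For the numerator and denominator of a fraction this is
    [local_dvd_mpoly]; the degree of the quotient is then forced. *)
Lemma section_poly (n : int) (x : F) (i j : 'I_3) : i != j ->
    (forall P : 'rV[k]_3, P != 0 -> (P 0 i != 0) || (P 0 j != 0) -> twist_at n P x) ->
  exists2 G : Px, x = tofrac G &
    match n with Posz d => G \is d.-homog : Prop | Negz _ => G = 0 end.
Proof.
move=> ij loc; have [l u] := third_index ij.
have rowE (v : 'I_3 -> k) : (\row_m v m : 'rV[k]_3) 0 =1 v by move=> m; rewrite mxE.
have row0 (v : 'I_3 -> k) m : v m != 0 -> (\row_m v m : 'rV[k]_3) != 0.
  by apply: contraNneq => E; rewrite -rowE E mxE.
have [||A [B [[d [e [De hA hB]]] B1 Dx]]] := loc (delta_mx 0 i).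
- by apply: contraNneq (oner_neq0 k) => /rowP/(_ i); rewrite !mxE !eqxx => <-.
- by rewrite mxE !eqxx oner_neq0.
have B0 := meval_neq0 B1.
have [|G DG] := local_dvd_mpoly u (A := A) B0.
  move=> v v0; set P : 'rV[k]_3 := \row_m v m.
  have P0 : P != 0 by case/orP: v0 => /row0.
  have [|a [b [_ b0 Dx']]] := loc P P0; first by rewrite !mxE.
  exists b, a; split; last by rewrite (meval_eq _ (rowE v)) in b0.
  have bn := meval_neq0 b0.
  apply/eqP; rewrite -tofrac_eq !rmorphM /= mulrC.
  by rewrite -eqr_div ?tofrac_eq0 // -Dx -Dx'.
exists G; first by rewrite Dx DG rmorphM mulfK // tofrac_eq0.
have hG : B * G \is e.-homog by rewrite mulrC -DG.
have := homog_factor hB B0 hG.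
move: De; case: n {loc} => n De; case: leqP => h //.
- by have -> : (e - d = n)%N by lia.
- by lia.
- by lia.
Qed.

End Sections.
Fact unscale_subproof (E : fieldType) (X x : E) (n : int) : X != 0 ->
  X ^ n * (x * X ^ (- n)) = x.
Proof. by move=> X0; rewrite mulrCA -expfzDr // subrr expr0z mulr1. Qed.

Fact mulKf_subproof (E : fieldType) (u y : E) : u != 0 -> u * y / u = y.
Proof. by move=> u0; rewrite mulrAC divff // mul1r. Qed.

Fact p_closed_subproof (E : fieldType) (X c w : E) : X != 0 ->
  c * (w / X ^+ 3) * X ^+ 5 = X ^+ 2 * c * w.
Proof. by move=> X0; field. Qed.

Fact saturation_subproof (E : fieldType) (X a b : E) (d e : nat) (n : int) :
    X != 0 -> b != 0 -> e%:Z = d%:Z + n ->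
  b / X ^+ d * (a / b * X ^ (- n)) = a / X ^+ e.
Proof.
move=> X0 b0 De; rewrite !exprnP De expfzDr // -invr_expz.
have Xd : X ^ d%:Z != 0 by rewrite expfz_neq0.
have Xn : X ^ n != 0 by rewrite expfz_neq0.
by move: (X ^ d%:Z) (X ^ n) Xd Xn => u v u0 v0; field; rewrite u0 v0 b0.
Qed.

Fact scale_wronsk_subproof (E : fieldType) (X x D w : E) (n : int) : X != 0 ->
  w = X ^+ 2 * (X * D) -> x * X ^ (- n) * D = (x * w) * X ^ (- (n + 3)).
Proof.
move=> X0 ->; rewrite opprD expfzDr // -(invr_expz X 3%:Z) -exprnP.
by move: (X ^ (- n)) => u; field.
Qed.

Fact plucker_subproof (E : fieldType) (x y z A B : E) : y != 0 -> z != 0 ->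
  z * (y ^+ 2 * (A * (z / y) + x / z * B)) = y * (z ^+ 2 * A) + x * (y ^+ 2 * B).
Proof. by move=> y0 z0; field; rewrite y0 z0. Qed.

Fact Delta_dehom_subproof (E : fieldType) (X q w : E) (n : nat) : X != 0 ->
  q / X ^+ n * w = (q * (X ^+ 2 * w)) / X ^+ n.+2.
Proof. by move=> X0; rewrite !exprS; field; rewrite X0 expf_neq0. Qed.

Fact Delta_dehom_subproof2 (E : fieldType) (X q : E) (n : nat) : X != 0 ->
  (X * q) / X ^+ n.+2 = q / X ^+ n.+1.
Proof. by move=> X0; rewrite !exprS; field; rewrite X0 expf_neq0. Qed.

Fact cancel_subproof (E : fieldType) (u y : E) : u != 0 -> 1 / u * (y * u) = y.
Proof. by move=> u0; field. Qed.

Fact Delta_frac_subproof (E : fieldType) (X q b : E) (d : nat) :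
    X != 0 -> b != 0 ->
  q / X ^+ d.*2 * ((b / X ^+ d)^-1) ^+ 2 = q / b ^+ 2.
Proof.
move=> X0 b0; rewrite -mul2n mulnC exprM.
have := expf_neq0 d X0; move: (X ^+ d) => Y Y0.
by field; rewrite b0 Y0.
Qed.

(** * The vector field of a foliation of degree -1 *)

(** ** Vector fields with coefficients in the span of the squares *)

Section SquareFields.
Variables (k : closedFieldType) (m : 'M[k]_3).
Hypothesis k2 : 2%N \in [pchar k].
Local Notation Px := {mpoly k[3]}.

(** The j-th coefficient of a vector field; at a point x the coefficients form
    the vector x^(2) m, where x^(2) has the squares of the coordinates of x. *)
Definition frob_field (j : 'I_3) : Px := \sum_r m r j *: 'X_r ^+ 2.

Definition nabla (p : Px) := \sum_i frob_field i * p^`M(i).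

Lemma frob_field_homog j : frob_field j \is 2.-homog.
Proof.
by apply: rpred_sum => r _; apply: rpredZ; exact: (dhomogMn 2 (homogX k r)).
Qed.

Lemma nablaD p q : nabla (p + q) = nabla p + nabla q.
Proof. by rewrite -big_split; apply: eq_bigr => i _; rewrite /= mderivD mulrDr. Qed.

Lemma nablaM p q : nabla (p * q) = nabla p * q + p * nabla q.
Proof.
rewrite mulr_suml mulr_sumr -big_split; apply: eq_bigr => i _ /=.
by rewrite mderivM mulrDr !mulrA; congr (_ + _); rewrite [p * _]mulrC.
Qed.

Lemma nabla_sqr p : nabla (p ^+ 2) = 0.
Proof. by rewrite expr2 nablaM mulrC addrr_pchar2 // pchar2_mpoly. Qed.

End SquareFields.

Section FoliationOfDegreeMinusOne.
Variables (k : closedFieldType) (L : set 'rV[k]_3 -> set (ratfun k -> ratfun k)).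
Local Notation Px := {mpoly k[3]}.
Local Notation F := {fraction Px}.
Local Notation K := (ratfun k).
Local Notation tf := (@tofrac Px).
Implicit Types (P Q : 'rV[k]_3).
Hypothesis k2 : 2%N \in [pchar k].
Hypotheses (Lsub : subsheaf_TX L) (Lsat : saturated L) (Lpcl : p_closed 2 L).
Variable phi : set 'rV[k]_3 -> F -> (K -> K).
Hypothesis phiP : forall U, nzopen U -> U `<=` @P2 k ->
  [/\ set_bij (twist (-1) U) (L U) (phi U),
      forall s t, twist (-1) U s -> twist (-1) U t ->
        phi U (s + t) = (fun x => phi U s x + phi U t x)
    & forall f s, OX U f -> twist (-1) U s ->
        phi U (ratfun_val f * s) = (fun x => f * phi U s x)].
Hypothesis phi_res : forall U V s, nzopen U -> nzopen V -> V `<=` U ->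
  U `<=` @P2 k -> twist (-1) U s -> phi V s = phi U s.

Lemma pchar2_frac : 2%N \in [pchar F].
Proof. exact: (rmorph_pchar tf (pchar2_mpoly _ k2)). Qed.

Definition chart (j : 'I_3) := basic_open ('X_j : Px).

Lemma chartE j P : chart j P <-> P != 0 /\ P 0 j != 0.
Proof. by rewrite /chart /basic_open mevalXU. Qed.

Lemma zopen_P2 (U : set 'rV[k]_3) : zopen U -> U `<=` @P2 k.
Proof. by move=> /zopenE[G [_ UG]] P /UG[]. Qed.

Lemma nzopen_chart j : nzopen (chart j).
Proof.
split; first exact: zopen_basic (homogX k j).
exists (delta_mx 0 j); apply/chartE; rewrite mxE !eqxx oner_neq0; split=> //.
by apply: contraNneq (oner_neq0 k) => /rowP/(_ j); rewrite !mxE !eqxx => <-.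
Qed.

(** The generator of O(-1) where X_j does not vanish.  Its image [chart_field j]
    generates the foliation there. *)
Definition Xinv j : F := (tf 'X_j)^-1.

Lemma twist_Xinv j (U : set 'rV[k]_3) : U `<=` chart j -> twist (-1) U (Xinv j).
Proof.
move=> Uj P /Uj/chartE[_ Pj].
by apply: (@twistV _ 1%N); rewrite ?homogX ?mevalXU.
Qed.

Definition ratio i j : K := aff_coord ('X_j : Px) i.

Lemma ratioE i j : ratfun_val (ratio i j) = tf 'X_i / tf 'X_j.
Proof. by apply: aff_coordE; [exact: homogX | exact: mpolyXU_neq0]. Qed.

Lemma tfX_neq0 i : tf 'X_i != 0.
Proof. by rewrite tofrac_eq0 mpolyXU_neq0. Qed.

Lemma OX_ratio i j (U : set 'rV[k]_3) : U `<=` chart j -> OX U (ratio i j).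
Proof.
move=> Uj P /Uj/chartE[_ Pj]; apply: regular_coord; rewrite ?mevalXU //.
  exact: homogX.
exact: mpolyXU_neq0.
Qed.

Definition chart_field j : K -> K := phi (chart j) (Xinv j).

Lemma chart_field_in j : L (chart j) (chart_field j).
Proof.
have [[fn _ _] _ _] := phiP (nzopen_chart j) (zopen_P2 (nzopen_chart j).1).
by apply: fn; apply: twist_Xinv.
Qed.

Lemma L_res (U V : set 'rV[k]_3) D : nzopen U -> nzopen V -> V `<=` U -> L U D -> L V D.
Proof. by case: Lsub => _ _ h _ nU nV VU; apply: h. Qed.

Lemma L_TX U D : nzopen U -> L U D -> TX U D.
Proof. by case: Lsub => h _ _ _ nU; apply: h. Qed.

Lemma L_scale U f D : nzopen U -> OX U f -> L U D -> L U (fun x => f * D x).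
Proof. by case: Lsub => _ h _ _ nU; case: (h U nU) => _ _; apply. Qed.

Lemma chart_field_der j : derivation (chart_field j).
Proof. by have [] := L_TX (nzopen_chart j) (chart_field_in j). Qed.

Lemma chart_field_change i j x : chart_field i x = ratio j i * chart_field j x.
Proof.
have nV := nzopenI (nzopen_chart i) (nzopen_chart j).
set V := _ `&` _ in nV.
have Vi : V `<=` chart i by move=> P [].
have Vj : V `<=` chart j by move=> P [].
have sub a := zopen_P2 (nzopen_chart a).1.
rewrite /chart_field -(phi_res (nzopen_chart i) nV Vi (sub i)); last exact: twist_Xinv.
rewrite -(phi_res (nzopen_chart j) nV Vj (sub j)); last exact: twist_Xinv.
have [_ _ lin] := phiP nV (zopen_P2 nV.1).
have -> : Xinv i = ratfun_val (ratio j i) * Xinv j.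
  by rewrite ratioE /Xinv mulrAC divff ?mul1r // tfX_neq0.
by rewrite lin //; [apply: OX_ratio | apply: twist_Xinv].
Qed.

Lemma chart_generates j U D : nzopen U -> U `<=` chart j -> L U D ->
  exists2 g, OX U g & D = fun x => g * chart_field j x.
Proof.
move=> nU Uj LD; have U2 := zopen_P2 nU.1.
have [[_ _ surj] _ lin] := phiP nU U2.
have [s hs <-] := surj _ LD.
have h0 P : U P -> twist_at 0 P (s * tf 'X_j).
  move=> UP; apply: (@twistM _ (-1) 1); first exact: hs.
  by apply: twist_poly; exact: homogX.
have [P UP] := nU.2; have [g _ Dg] := twist_ratfun (h0 P UP).
have Og : OX U g by move=> Q UQ; rewrite /regular_at /= Dg; apply: h0.
exists g => //; rewrite /chart_field.
rewrite -(phi_res (nzopen_chart j) nU Uj (zopen_P2 (nzopen_chart j).1)); last first.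
  exact: twist_Xinv.
by rewrite -lin //; [rewrite Dg mulfK // tfX_neq0 | apply: twist_Xinv].
Qed.

Lemma chart_field_neq0 j : exists x, chart_field j x != 0.
Proof.
apply: contrapT => no.
have nU := nzopen_chart j; have U2 := zopen_P2 nU.1.
have [[_ inj _] add _] := phiP nU U2.
have t0 : twist (-1) (chart j) 0 by move=> P /chartE[P0 _]; apply: twist0.
have phi0 x : phi (chart j) 0 x = 0.
  have := congr1 (fun f => f x) (add _ _ t0 t0); rewrite addr0 => /eqP.
  by rewrite -subr_eq0 opprD addrA subrr sub0r oppr_eq0 => /eqP.
have /inj : phi (chart j) (Xinv j) = phi (chart j) 0.
  apply/funext => x; rewrite phi0; apply/eqP; apply: contrapT => /negP h.
  by apply: no; exists x.
move=> /(_ (mem_set (twist_Xinv (fun _ h => h))) (mem_set t0))/eqP.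
by rewrite invr_eq0 (negPf (tfX_neq0 j)).
Qed.

(** The foliation is O(-1), so the derivations X_j D_j, with D_j the generator
    where X_j does not vanish, agree.  They form one derivation with values in
    fractions of degree one. *)
Definition Delta (g : K) : F := tf 'X_0 * ratfun_val (chart_field 0 g).

Lemma DeltaE j g : Delta g = tf 'X_j * ratfun_val (chart_field j g).
Proof.
rewrite /Delta (chart_field_change 0 j) rmorphM /= ratioE mulrA.
by rewrite mulrCA divff ?mulr1 // tfX_neq0.
Qed.

Lemma Delta_eq0 j g : (Delta g = 0) <-> (chart_field j g = 0).
Proof.
rewrite (DeltaE j); split=> [/eqP|->]; last by rewrite rmorph0 mulr0.
by rewrite mulf_eq0 (negPf (tfX_neq0 j)) => /eqP h; apply: ratfun_val_inj; rewrite h rmorph0.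
Qed.

Lemma DeltaM f g : Delta (f * g) = Delta f * ratfun_val g + ratfun_val f * Delta g.
Proof.
rewrite /Delta (derM (chart_field_der 0)) rmorphD !rmorphM mulrDr mulrA.
by congr (_ + _); rewrite mulrCA.
Qed.

Lemma Delta_sqr f : Delta (f ^+ 2) = 0.
Proof. by rewrite expr2 DeltaM [Delta f * _]mulrC addrr_pchar2 // pchar2_frac. Qed.

Lemma Delta_twist P g : P != 0 -> regular_at P g -> twist_at 1 P (Delta g).
Proof.
move=> P0 hg; have [j Pj] := neq0_coord P0; rewrite (DeltaE j).
have [_ h] := L_TX (nzopen_chart j) (chart_field_in j).
apply: (@twistM _ 1 0); first by apply: twist_poly; exact: homogX.
by apply: h hg; apply/chartE.
Qed.

Lemma Delta_dehom l a : Delta (dehom l a) =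
  \sum_i ratfun_val (dehom l a^`M(i)) * Delta (aff_coord l i).
Proof.
rewrite /Delta (der_dehom l a (chart_field_der 0)) rmorph_sum mulr_sumr.
by apply: eq_bigr => i _; rewrite rmorphM mulrCA.
Qed.

(** For a vector field with coefficients A_i this is X_j A_i + X_i A_j, the
    minor formed with the Euler field. *)
Definition wronsk i j : F := tf 'X_j ^+ 2 * Delta (ratio i j).

Lemma ratio_trans i l j : ratio i j = ratio i l * ratio l j.
Proof.
apply: ratfun_val_inj; rewrite rmorphM /= !ratioE mulrA mulfVK //.
exact: tfX_neq0.
Qed.

Lemma ratioii i : ratio i i = 1.
Proof. by apply: ratfun_val_inj; rewrite ratioE rmorph1 divff // tfX_neq0. Qed.

Lemma wronskii i : wronsk i i = 0.
Proof.
by rewrite /wronsk ratioii /Delta (der1 (chart_field_der 0)) rmorph0 !mulr0.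
Qed.

Lemma wronsk_plucker i j l :
  tf 'X_l * wronsk i j = tf 'X_j * wronsk i l + tf 'X_i * wronsk l j.
Proof.
rewrite /wronsk (ratio_trans i l j) DeltaM !ratioE.
by apply: plucker_subproof; apply: tfX_neq0.
Qed.

Lemma wronskC i j : wronsk i j = wronsk j i.
Proof.
have /esym/eqP := wronsk_plucker i i j.
rewrite wronskii mulr0 -mulrDr mulf_eq0 (negPf (tfX_neq0 i)) /= addr_eq0.
by rewrite oppr_pchar2 ?pchar2_frac // => /eqP.
Qed.

Lemma twist_expz n P j : P 0 j != 0 -> twist_at n P (tf 'X_j ^ n).
Proof.
have hXn d : ('X_j : Px) ^+ d \is d.-homog.
  by rewrite -{2}[d]mul1n; apply: dhomogMn (homogX k j).
move=> Pj; case: n => d; first by rewrite -exprnP -rmorphXn; apply: twist_poly.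
rewrite NegzE -exprnN -rmorphXn; apply: twistV => //.
by rewrite rmorphXn /= mevalXU expf_neq0.
Qed.

Lemma wronsk_twist i j P : P != 0 -> P 0 j != 0 -> twist_at 3 P (wronsk i j).
Proof.
move=> P0 Pj; apply: (@twistM _ 2 1); first exact: (twist_expz 2 Pj).
apply: Delta_twist => //.
by apply: (@OX_ratio i j (chart j)) => //; apply/chartE.
Qed.

(** By definition [wronsk i j] is regular where X_j does not vanish, and by
    symmetry also where X_i does not vanish. *)
Lemma wronsk_polys : exists W : 'I_3 -> 'I_3 -> Px, forall i j,
  W i j \is 3.-homog /\ wronsk i j = tf (W i j).
Proof.
suff h i : exists W : 'I_3 -> Px, forall j, W j \is 3.-homog /\ wronsk i j = tf (W j).
  by have [W hW] := choice h; exists W.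
have [j|W hW] := @choice _ _ (fun j G => G \is 3.-homog /\ wronsk i j = tf G);
  last by exists W.
have [<-|ij] := eqVneq i j.
  by exists 0; rewrite wronskii rmorph0; split=> //; apply: rpred0.
have [P P0|G -> hG] := @section_poly k 3 (wronsk i j) i j ij; last by exists G.
by case/orP=> Pij; last exact: wronsk_twist; rewrite wronskC; apply: wronsk_twist.
Qed.

(** The factor x turns the generator into a derivation E that is regular near P,
    since the Wronskians are its values on the affine coordinates.  By saturation
    E belongs to the foliation, so it is a regular multiple of the generator. *)
Lemma wronsk_saturated n x a b P : hom_fraction n a b -> b != 0 ->
    x = tf a / tf b -> P != 0 ->
    (forall i j, twist_at (n + 3) P (x * wronsk i j)) ->
  twist_at n P x.
Proof.
move=> [d [e [De ha hb]]] b0 Dx P0 hx; have [j Pj] := neq0_coord P0.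
have hXj := homogX k j; have Xj0 := mpolyXU_neq0 k j; have tX0 := tfX_neq0 j.
have tb0 : tf b != 0 by rewrite tofrac_eq0.
pose y := x * tf 'X_j ^ (- n).
have Ey : tf b / tf 'X_j ^+ d * y = tf a / tf 'X_j ^+ e.
  by rewrite /y Dx; exact (@saturation_subproof _ _ _ _ _ _ _ tX0 tb0 De).
have [v Dv] : exists v : K, ratfun_val v = y.
  exists (dehom 'X_j a / dehom 'X_j b).
  rewrite fmorph_div /= (dehomE hXj Xj0 ha) (dehomE hXj Xj0 hb) -Ey.
  apply: mulKf_subproof; apply: mulf_neq0; first exact: tb0.
  by apply: invr_neq0; apply: expf_neq0; exact: tX0.
pose E f := v * chart_field j f.
have derE : derivation E by apply: derivation_scale; exact: chart_field_der.
have regE i : regular_at P (E (ratio i j)).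
  have Ew : wronsk i j = tf 'X_j ^+ 2 *
      (tf 'X_j * ratfun_val (chart_field j (ratio i j))) by rewrite /wronsk (DeltaE j).
  rewrite /regular_at /= /E rmorphM /= Dv.
  rewrite (@scale_wronsk_subproof _ _ x _ _ n tX0 Ew).
  have E0 : (n + 3) + - (n + 3) = 0 by rewrite subrr.
  by rewrite -E0; apply: twistM; [exact: hx | exact: twist_expz].
have [U0 [zU0 U0P regU0]] := regular_open P0 (regE 0).
have [U1 [zU1 U1P regU1]] := regular_open P0 (regE 1).
have [U2 [zU2 U2P regU2]] := regular_open P0 (regE 2).
pose U := chart j `&` (U0 `&` (U1 `&` U2)).
have nC := nzopen_chart j.
have CP : chart j P by apply/chartE.
have nU : nzopen U.
  split; last by exists P.
  by apply: zopenI; [exact: nC.1 | apply: zopenI => //; apply: zopenI].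
have UC : U `<=` chart j by move=> Q [].
have TE : TX U E.
  apply: (@TX_of_coord k 'X_j) => //.
    by move=> Q [/chartE[_ Qj] _]; rewrite mevalXU.
  move=> Q [_ [Q0 [Q1 Q2]]] i; rewrite -/(ratio i j).
  have [->|->|->] : [\/ i = 0, i = 1 | i = 2] by exact: (@ord3_cases 0 1 2).
  - exact: regU0.
  - exact: regU1.
  - exact: regU2.
have regd c (Q : 'rV[k]_3) : U Q -> regular_at Q (dehom 'X_j c).
  by move=> [/chartE[_ Qj] _]; apply: regular_dehom => //; rewrite mevalXU.
have vE : dehom 'X_j b * v = dehom 'X_j a.
  apply: ratfun_val_inj; rewrite rmorphM /= (dehomE hXj Xj0 ha) (dehomE hXj Xj0 hb).
  by rewrite Dv Ey.
have LE : L U E.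
  apply: (Lsat nU (f := dehom 'X_j b)) => //.
  - by move=> Q; apply: regd.
  - exact: (dehom_neq0 hXj Xj0 hb).
  - rewrite (_ : (fun f => _) = fun f => dehom 'X_j a * chart_field j f); last first.
      by apply/funext => f; rewrite /E mulrA vE.
    apply: L_scale => //; first by move=> Q; apply: regd.
    exact: (L_res nC nU UC (chart_field_in j)).
have [g Og Eg] := chart_generates nU UC LE.
have [f f0] := chart_field_neq0 j.
have vg : v = g by apply: (mulIf f0); have := congr1 (fun h => h f) Eg.
have : regular_at P v by rewrite vg; apply: Og; split.
rewrite /regular_at /= Dv => /(twistM (twist_expz n Pj)).
by rewrite addr0 (@unscale_subproof _ _ x n tX0).
Qed.

Section Wronskians.
Variable W : 'I_3 -> 'I_3 -> Px.
Hypothesis W_homog : forall i j, W i j \is 3.-homog.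
Hypothesis W_E : forall i j, wronsk i j = tf (W i j).

Lemma tf_inj : injective tf.
Proof. by move=> a b /eqP; rewrite tofrac_eq => /eqP. Qed.

Lemma WC i j : W i j = W j i.
Proof. by apply: tf_inj; rewrite -!W_E wronskC. Qed.
Lemma Wii i : W i i = 0.
Proof. by apply: tf_inj; rewrite -W_E wronskii rmorph0. Qed.
Lemma W_plucker i j l : 'X_l * W i j = 'X_j * W i l + 'X_i * W l j.
Proof. by apply: tf_inj; rewrite rmorphD !rmorphM /= -!W_E wronsk_plucker. Qed.

Lemma chart_field_ratio i j : chart_field i (ratio j i) = dehom 'X_i (W j i).
Proof.
have h3 := W_homog j i.
apply: ratfun_val_inj; rewrite (dehomE (homogX k i) (mpolyXU_neq0 k i) h3).
rewrite -W_E /wronsk (DeltaE i) mulrA -exprSr mulrC mulKf //.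
by rewrite expf_neq0 // tfX_neq0.
Qed.

Lemma sum_ord3 (V : nmodType) (E : 'I_3 -> V) i j l : uniq [:: i; j; l] ->
  \sum_m E m = E i + E j + E l.
Proof.
move=> u; have [ij il jl] := neq_ijl u.
rewrite (bigD1 i) //= (bigD1 j) 1?eq_sym //= (bigD1 l) /=; last first.
  by rewrite eq_sym il eq_sym.
rewrite big1 ?addr0 ?addrA // => m /andP[/andP[mi mj] ml].
by case: (ord3_cases u m) mi mj ml => ->; rewrite eqxx.
Qed.

(** The square of a generator of the foliation is a multiple of it; evaluate
    both at X_j / X_i. *)
Lemma p_closed_wronsk i j l : uniq [:: i; j; l] -> exists2 c : K, OX (chart i) c &
  tf ((W i j)^`M(j) * W i j + (W i j)^`M(l) * W i l) =
  tf 'X_i ^+ 2 * ratfun_val c * tf (W i j).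
Proof.
move=> u; have nU := nzopen_chart i.
have [c Oc Ec] := chart_generates nU (fun _ h => h) (Lpcl nU (chart_field_in i)).
exists c => //.
have := congr1 (fun f => f (ratio j i)) Ec; rewrite /= chart_field_ratio.
rewrite (der_dehom 'X_i _ (chart_field_der i)) (sum_ord3 _ u) -!/(ratio _ _).
rewrite !chart_field_ratio Wii rmorph0 mulr0 add0r -!rmorphM -rmorphD.
have hd m : (W j i)^`M(m) \is 2.-homog by apply: mderiv_homog.
have h5 : (W j i)^`M(j) * W j i + (W j i)^`M(l) * W l i \is 5.-homog.
  by apply: rpredD; exact: (dhomogM (hd _) (W_homog _ _)).
move/(congr1 (@ratfun_val k)); rewrite rmorphM /=.
rewrite (dehomE (homogX k i) (mpolyXU_neq0 k i) h5).
rewrite (dehomE (homogX k i) (mpolyXU_neq0 k i) (W_homog j i)).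
rewrite (WC j i) (WC l i) => /(congr1 (fun y => y * tf 'X_i ^+ 5)).
have X0 := tfX_neq0 i.
rewrite mulfVK ?expf_neq0 // => ->.
by rewrite p_closed_subproof.
Qed.

Lemma twist_wronsk_chart i j l P : uniq [:: i; j; l] -> W i j != 0 ->
  P != 0 -> P 0 i != 0 -> twist_at (-1) P (tf (W i j)^`M(l) / tf (W i j)).
Proof.
move=> u W0 P0 Pi; have [c Oc Ec] := p_closed_wronsk u.
have w0 : tf (W i j) != 0 by rewrite tofrac_eq0.
have hd m : (W i j)^`M(m) \is 2.-homog by apply: mderiv_homog.
set x := _ / _.
have hij : twist_at 2 P (x * wronsk i j).
  by rewrite W_E /x divfK //; apply: twist_poly.
have hil : twist_at 2 P (x * wronsk i l).
  have -> : x * wronsk i l = tf 'X_i ^+ 2 * ratfun_val c - tf (W i j)^`M(j).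
    apply: (mulIf w0); rewrite mulrBl -Ec rmorphD !rmorphM /= W_E.
    by rewrite addrAC subrr add0r /x mulrAC divfK // mulrC.
  apply: twistD; last by apply: twistN; apply: twist_poly.
  apply: (@twistM _ 2 0); first exact: (twist_expz 2 Pi).
  by apply: Oc; apply/chartE.
have hjl : twist_at 2 P (x * wronsk j l).
  have -> : x * wronsk j l = tf 'X_i ^ (-1) *
      (tf 'X_l * (x * wronsk i j) + tf 'X_j * (x * wronsk i l)).
    have X0 := tfX_neq0 i; apply: (mulfI X0); rewrite [RHS]mulrA -[in RHS]invr_expz.
    rewrite expr1z divff // mul1r mulrCA wronsk_plucker (wronskC j i).
    by rewrite mulrDr; congr (_ + _); rewrite mulrCA.
  apply: (@twistM _ (-1) 3); first exact: twist_expz.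
  by apply: twistD; (apply: (@twistM _ 1 2) => //; apply: twist_poly; exact: homogX).
apply: (wronsk_saturated (n := -1) (a := (W i j)^`M(l)) (b := W i j)) => //.
  by exists 3%N, 2%N; split.
have h0 m : twist_at 2 P (x * wronsk m m) by rewrite wronskii mulr0; apply: twist0.
by move=> a b; case: (ord3_cases u a) => ->; case: (ord3_cases u b) => ->;
  do ?[exact: h0 | exact: hij | exact: hil | exact: hjl | rewrite wronskC].
Qed.

(** By p-closedness the ratio of a partial derivative of a coefficient by that
    coefficient is a section of O(-1), so it is zero. *)
Lemma W_deriv i j l : uniq [:: i; j; l] -> (W i j)^`M(l) = 0.
Proof.
move=> u; have [->|W0] := eqVneq (W i j) 0; first by rewrite mderiv0.
have [ij il jl] := neq_ijl u.
have u' : uniq [:: j; i; l] by rewrite /= !inE negb_or eq_sym ij jl il.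
have [P P0|G DG G0] := @section_poly k (-1) (tf (W i j)^`M(l) / tf (W i j)) i j ij.
  case/orP=> Pij; first exact: twist_wronsk_chart.
  by rewrite WC; apply: twist_wronsk_chart => //; rewrite WC.
apply/eqP; rewrite -tofrac_eq0 -(divfK (_ : tf (W i j) != 0) (tf _)) ?tofrac_eq0 //.
by rewrite DG G0 rmorph0 mul0r.
Qed.

Let px2 := pchar2_mpoly 3 k2.

(** All partial derivatives of this linear form vanish. *)
Lemma W_deriv2 i j l : uniq [:: i; j; l] -> (W i j)^`M(i)^`M(j) = 0.
Proof.
move=> u; have h1 : (W i j)^`M(i)^`M(j) \is 1.-homog.
  by do 2!apply: mderiv_homog.
apply: (linear_mderiv0 h1) => m; case: (ord3_cases u m) => ->.
- by rewrite (mderiv_comm i j) mderiv_sqr.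
- by rewrite mderiv_sqr.
- by rewrite (mderiv_comm j l) (mderiv_comm i l) (W_deriv u) !mderiv0.
Qed.

(** Differentiate the relation [W_plucker] with respect to X_l, then X_j. *)
Lemma W_deriv_unique i j l : uniq [:: i; j; l] -> (W i j)^`M(i) = (W l j)^`M(l).
Proof.
move=> u; have [ij il jl] := neq_ijl u.
have uilj : uniq [:: i; l; j] by rewrite /= !inE negb_or il ij [l == j]eq_sym jl.
have ulji : uniq [:: l; j; i].
  by rewrite /= !inE negb_or ![l == _]eq_sym [j == i]eq_sym jl il ij.
have E1 : W i j = 'X_j * (W i l)^`M(l) + 'X_i * (W l j)^`M(l).
  have := congr1 (mderiv l) (W_plucker i j l).
  rewrite mderivD !mderivM !mderivXU eqxx (negPf jl) (negPf il) (W_deriv u).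
  by rewrite mulr0 addr0 mul1r !mul0r !add0r.
rewrite [in LHS]E1 mderivD !mderivM !mderivXU eqxx [j == i]eq_sym (negPf ij).
rewrite (mderiv_comm l i) (W_deriv2 uilj) (mderiv_comm l i) (W_deriv ulji).
by rewrite mderiv0 !mulr0 mul0r !addr0 add0r mul1r.
Qed.

(** The partial derivative of [W i j] in the direction i does not depend on i;
    it is the j-th coefficient of the vector field. *)
Definition coef_field j : Px := if j == 0 then (W 1 0)^`M(1) else (W 0 j)^`M(0).

Lemma coef_fieldE i j : i != j -> coef_field j = (W i j)^`M(i).
Proof.
move=> ij; rewrite /coef_field.
case: (eqVneq j 0) ij => [->|j0] ij.
  have [->//|i1] := eqVneq i 1; symmetry; apply: W_deriv_unique.
  by rewrite /= !inE negb_or ij i1 /=.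
have [->//|i0] := eqVneq i 0; symmetry; apply: W_deriv_unique.
by rewrite /= !inE negb_or ij i0 j0.
Qed.

Lemma W_coef_field i j : W i j = 'X_i * coef_field j + 'X_j * coef_field i.
Proof.
have [<-|ij] := eqVneq i j; first by rewrite addrr_pchar2 // Wii.
have [l u] := third_index ij.
rewrite (coef_fieldE ij) (@coef_fieldE j i) 1?eq_sym // (WC j i).
have := euler_homog (W_homog i j).
rewrite (sum_ord3 _ u) (W_deriv u) mulr0 addr0 => ->.
by rewrite mulrS (mulrn_pchar px2) addr0.
Qed.

Lemma coef_field_homog j : coef_field j \is 2.-homog.
Proof. by rewrite /coef_field; case: ifP => _; apply: mderiv_homog. Qed.

Lemma coef_field_deriv m j : (coef_field j)^`M(m) = 0.
Proof.
have [i ij] : exists i, i != j.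
  by exists (if j == 0 then 1 else 0); case: (eqVneq j 0) => [->|] //; rewrite eq_sym.
have [l u] := third_index ij; rewrite (coef_fieldE ij).
case: (ord3_cases u m) => ->; first exact: mderiv_sqr.
  exact: W_deriv2 u.
by rewrite mderiv_comm (W_deriv u) mderiv0.
Qed.

End Wronskians.

(** All partial derivatives of the coefficients vanish, so the coefficients are
    squares of linear forms. *)
Lemma wronsk_matrix : exists m : 'M[k]_3, forall i j,
  wronsk i j = tf ('X_i * frob_field m j + 'X_j * frob_field m i).
Proof.
have [W hW] := wronsk_polys.
have W_homog i j : W i j \is 3.-homog by case: (hW i j).
have W_E i j : wronsk i j = tf (W i j) by case: (hW i j).
have h j : exists s : 'I_3 -> k, coef_field W j = \sum_r s r *: 'X_r ^+ 2.
  have [s /dhomogP hs ->] := @sqrt_homog k 3 k2 1 _ (coef_field_homog W_homog j)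
    (fun m => coef_field_deriv W_homog W_E m j).
  exists (fun r => s@_U_(r) ^+ 2).
  suff {1}-> : s = \sum_r s@_U_(r) *: 'X_r.
    rewrite (sqr_sum2 (pchar2_mpoly 3 k2)).
    by apply: eq_bigr => r _; rewrite exprZn.
  apply/mpolyP => m; rewrite raddf_sum /=.
  have [/eqP mm|mm] := boolP (mdeg m == 1%N).
    have /mdeg1P[r /eqP ->] : mdeg m == 1%N by rewrite mm.
    rewrite (bigD1 r) //= mcoeffZ mcoeffX eqxx mulr1 big1 ?addr0 // => r' rr'.
    rewrite mcoeffZ mcoeffX; case: eqP => [/mnmP/(_ r)|]; last by rewrite mulr0.
    by rewrite !mnm1E eqxx (negPf rr').
  have -> : s@_m = 0.
    by apply: contraNeq mm; rewrite -mcoeff_msupp => /hs /= ->.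
  rewrite big1 // => r _; rewrite mcoeffZ mcoeffX.
  case: (U_(r)%MM =P m) mm => [<-|_ _]; last by rewrite mulr0.
  by rewrite mdeg1.
have [s hs] := choice h.
exists (\matrix_(r, j) s j r) => i j.
rewrite W_E (W_coef_field W_homog W_E) !hs; congr tf.
by congr (_ * _ + _ * _); apply: eq_bigr => r _; rewrite mxE.
Qed.

Section Matrix.
Variable m : 'M[k]_3.
Hypothesis wronskE : forall i j,
  wronsk i j = tf ('X_i * frob_field m j + 'X_j * frob_field m i).

(** The Euler field, by which the vector field is determined only up to a
    multiple, annihilates forms of even degree. *)
Lemma Delta_dehom_even d p : p \is (d.*2).-homog ->
  Delta (dehom 'X_0 p) = tf (nabla m p) / tf 'X_0 ^+ d.*2.
Proof.
have X0 := tfX_neq0 0; have hX0 := homogX k 0; have X0' := mpolyXU_neq0 k 0.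
rewrite Delta_dehom; case: d => [|d] hp.
  rewrite /nabla big1 => [|i _]; last first.
    by rewrite homog0_mderiv // !rmorph0 mul0r.
  by rewrite big1 ?rmorph0 ?mul0r // => i _; rewrite homog0_mderiv // mulr0.
have hd i : p^`M(i) \is (d.*2.+1).-homog by apply: mderiv_homog.
have -> : \sum_i ratfun_val (dehom 'X_0 p^`M(i)) * Delta (aff_coord 'X_0 i) =
    tf (\sum_i p^`M(i) * ('X_i * frob_field m 0 + 'X_0 * frob_field m i)) /
      tf 'X_0 ^+ d.*2.+3.
  rewrite rmorph_sum mulr_suml; apply: eq_bigr => i _.
  rewrite (dehomE hX0 X0' (hd i)) rmorphM /= -wronskE.
  exact: (@Delta_dehom_subproof _ _ _ (Delta (aff_coord 'X_0 i)) _ X0).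
have -> : \sum_i p^`M(i) * ('X_i * frob_field m 0 + 'X_0 * frob_field m i) =
    'X_0 * nabla m p.
  have -> : \sum_i p^`M(i) * ('X_i * frob_field m 0 + 'X_0 * frob_field m i) =
      (\sum_i 'X_i * p^`M(i)) * frob_field m 0 + 'X_0 * nabla m p.
    rewrite mulr_suml mulr_sumr -big_split; apply: eq_bigr => i _ /=.
    rewrite mulrDr; congr (_ + _); first by rewrite mulrCA mulrA.
    by rewrite mulrCA; congr (_ * _); rewrite mulrC.
  rewrite (euler_homog hp) -mul2n mulrnA (mulrn_pchar (pchar2_mpoly 3 k2)).
  by rewrite mul0rn mul0r add0r.
by rewrite rmorphM; exact: (@Delta_dehom_subproof2 _ _ (tf (nabla m p)) _ X0).
Qed.

(** Squares are constants, so a/b = ab/b^2 reduces to a form of even degree. *)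
Lemma Delta_frac d a b g : a \is d.-homog -> b \is d.-homog -> b != 0 ->
  ratfun_val g = tf a / tf b -> Delta g = tf (nabla m (a * b)) / tf b ^+ 2.
Proof.
move=> ha hb b0 Dg; have tb0 : tf b != 0 by rewrite tofrac_eq0.
have X0 := tfX_neq0 0; have hX0 := homogX k 0; have X0' := mpolyXU_neq0 k 0.
have b1 := dehom_neq0 hX0 X0' hb b0.
have -> : g = dehom 'X_0 (a * b) * (dehom 'X_0 b)^-1 ^+ 2.
  rewrite (dehom_div hX0 X0' ha hb b0 Dg) rmorphM expr2 -mulrA; congr (_ * _).
  by rewrite mulrA divff // mul1r.
have hab : a * b \is (d.*2).-homog by rewrite -addnn; apply: dhomogM.
rewrite DeltaM Delta_sqr mulr0 addr0 (Delta_dehom_even hab) rmorphXn fmorphV /=.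
rewrite (dehomE hX0 X0' hb).
exact: (@Delta_frac_subproof _ _ (tf (nabla m (a * b))) _ d X0 tb0).
Qed.

(** Near P every section of the foliation is a multiple of one chart field, which
    is Delta up to a factor. *)
Lemma OY_atE P : P != 0 -> OY_at L P = [set g | regular_at P g /\ Delta g = 0].
Proof.
move=> P0; have [j Pj] := neq0_coord P0.
have nC := nzopen_chart j; have CP : chart j P by apply/chartE.
apply/seteqP; split=> g /=.
  move=> [U [zU UP [Og h]]]; split; first exact: Og.
  have nU : nzopen U by split=> //; exists P.
  have nV := nzopenI nU nC.
  have LV := L_res nC nV (fun Q UQ => UQ.2) (chart_field_in j).
  by apply/(Delta_eq0 j)/(h _ _ nV _ LV) => Q [].
move=> [rg Dg]; have [U [zU UP OU]] := regular_open P0 rg.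
exists U; split=> //; split=> // V D nV VU LD.
have nW := nzopenI nV nC.
have LW := L_res nV nW (fun Q VQ => VQ.1) LD.
have [f _ ->] := chart_generates nW (fun Q VQ => VQ.2) LW.
by rewrite (iffLR (Delta_eq0 j g)) // mulr0.
Qed.

Lemma linear_zero (s : 'I_3 -> k) :
  exists2 P : 'rV[k]_3, P != 0 & \sum_r s r * P 0 r = 0.
Proof.
have u : uniq [:: 0; 1; 2 : 'I_3] by [].
have [s0|s0] := eqVneq (s 0) 0.
  exists (delta_mx 0 0).
    by apply: contraNneq (oner_neq0 k) => /rowP/(_ 0); rewrite !mxE !eqxx => <-.
  by rewrite (sum_ord3 _ u) !mxE /= s0 mul0r !mulr0 !addr0.
exists (\row_r (if r == 0 then s 1 else if r == 1 then - s 0 else 0)).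
  apply: contraNneq s0 => /rowP/(_ 1); rewrite !mxE /= => /eqP.
  by rewrite oppr_eq0.
by rewrite (sum_ord3 _ u) !mxE /= mulr0 addr0 mulrN mulrC subrr.
Qed.

(** If m had rank at most 1, then all coefficients would be multiples of the
    square of one linear form l, and 1/l^2 would be regular on the line l = 0 by
    [wronsk_saturated]. *)
Lemma frob_rank : (1 < \rank m)%N.
Proof.
rewrite ltnNge; apply/negP => rk.
have [s [r E]] : exists s r : 'I_3 -> k, forall i j, m i j = s i ^+ 2 * r j.
  have h1 : exists (c : 'cV[k]_3) (r : 'rV[k]_3), m = c *m r.
    case: (posnP (\rank m)) => [/eqP|r0].
      by rewrite mxrank_eq0 => /eqP ->; exists 0, 0; rewrite mul0mx.
    have r1 : \rank m = 1%N by apply/eqP; rewrite eqn_leq rk.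
    by move: (mulmx_base m); move: (col_base m) (row_base m); rewrite r1 => c r <-; exists c, r.
  have [c [r ->]] := h1; exists (fun i => sqrtk (c i 0)), (fun j => r 0 j) => i j.
  by rewrite mxE big_ord1 sqrtkK.
have [s' [r' [l0 Dl]]] : exists s' r' : 'I_3 -> k,
    \sum_i s' i *: 'X_i != 0 :> Px /\
    (forall j, frob_field m j = r' j *: (\sum_i s' i *: 'X_i) ^+ 2).
  have Dl j : frob_field m j = r j *: (\sum_i s i *: 'X_i) ^+ 2.
    rewrite (sqr_sum2 (pchar2_mpoly 3 k2)) scaler_sumr; apply: eq_bigr => i _.
    by rewrite E exprZn scalerA mulrC.
  have [l0|l0] := eqVneq (\sum_i s i *: 'X_i : Px) 0; last by exists s, r.
  exists (fun i => (i == 0)%:R), (fun=> 0); split=> [|j].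
    rewrite (bigD1 0) //= big1 => [|i /negPf ->]; last by rewrite scale0r.
    by rewrite addr0 scale1r mpolyXU_neq0.
  by rewrite Dl l0 expr0n scaler0 scale0r.
set l : Px := \sum_i _ in l0 Dl.
have hl : l \is 1.-homog by apply: rpred_sum => i _; apply: rpredZ (homogX k i).
have hl2 : l ^+ 2 \is 2.-homog := dhomogMn 2 hl.
have l20 : l ^+ 2 != 0 by rewrite expf_neq0.
have [P P0 lP] := linear_zero s'.
have tl0 : tf (l ^+ 2) != 0 by rewrite tofrac_eq0.
have [|||||a [b [_ b0 Dab]]] :=
    @wronsk_saturated (-2) (tf 1 / tf (l ^+ 2)) 1 (l ^+ 2) P.
- by exists 2%N, 0%N; split; rewrite ?dhomog1.
- exact: l20.
- by [].
- exact: P0.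
- move=> i j; have -> : tf 1 / tf (l ^+ 2) * wronsk i j = tf (r' j *: 'X_i + r' i *: 'X_j).
    rewrite wronskE !Dl -!scalerAr !scalerAl -mulrDl [tf (_ * l ^+ 2)]rmorphM /= rmorph1.
    exact: cancel_subproof tl0.
  have h1 : r' j *: 'X_i + r' i *: 'X_j \is 1.-homog for mdeg.
    by apply: rpredD; apply: rpredZ; exact: homogX.
  exact: (twist_poly P h1).
have bn := meval_neq0 b0.
move: Dab => /eqP; rewrite eqr_div ?tofrac_eq0 // -!rmorphM tofrac_eq mul1r.
move=> /eqP Db; move: b0; rewrite Db mevalM rmorphXn /= raddf_sum /=.
rewrite (eq_bigr (fun i => s' i * P 0 i)) => [|i _]; last by rewrite mevalZ mevalXU.
by rewrite lP expr0n mulr0 eqxx.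
Qed.

End Matrix.

End FoliationOfDegreeMinusOne.

(** A foliation of degree -1 is generated by the vector field with
    coefficients [frob_field m]: this records what is used of it. *)
Record generated_by (k : closedFieldType) (L : set 'rV[k]_3 -> set (ratfun k -> ratfun k))
    (m : 'M[k]_3) : Prop := GeneratedBy {
  gen_rank : (1 < \rank m)%N;
  gen_saturated : forall n x a b (P : 'rV[k]_3), hom_fraction n a b -> b != 0 ->
    x = tofrac a / tofrac b -> P != 0 ->
    (forall i j, twist_at (n + 3) P
       (x * tofrac ('X_i * frob_field m j + 'X_j * frob_field m i))) ->
    twist_at n P x;
  gen_regular : forall (P : 'rV[k]_3) g, P != 0 -> OY_at L P g -> regular_at P g;
  gen_OY : forall (P : 'rV[k]_3) d a b g, P != 0 -> a \is d.-homog -> b \is d.-homog ->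
    b.@[P 0] != 0 -> ratfun_val g = tofrac a / tofrac b ->
    OY_at L P g <-> nabla m (a * b) = 0 }.

Lemma foliation_generated (k : closedFieldType) (k2 : 2%N \in [pchar k])
    (L : set 'rV[k]_3 -> set (ratfun k -> ratfun k)) :
  one_foliation 2 L -> has_degree L (-1) -> exists m, generated_by L m.
Proof.
move=> [Lsub Lsat _ Lpcl] [phi [phiP phi_res]].
have [m hm] := wronsk_matrix k2 Lsub Lsat Lpcl phiP phi_res.
exists m; split.
- exact: (frob_rank k2 Lsub Lsat phiP phi_res hm).
- move=> n x a b P hab b0 Dx P0 h.
  apply: (wronsk_saturated Lsub Lsat phiP phi_res hab b0 Dx P0) => i j.
  by rewrite hm; apply: h.
- by move=> P g P0; rewrite (OY_atE Lsub phiP phi_res P0) => -[].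
move=> P d a b g P0 ha hb b0 Dg; have bn := meval_neq0 b0.
have tb0 : tofrac b != 0 by rewrite tofrac_eq0.
rewrite (OY_atE Lsub phiP phi_res P0) /=.
rewrite (Delta_frac k2 Lsub phiP hm ha hb bn Dg); split=> [[_]|->].
  move=> /eqP; rewrite mulf_eq0 invr_eq0 expf_eq0 /= (negPf tb0) orbF.
  by rewrite tofrac_eq0 => /eqP.
rewrite rmorph0 mul0r; split=> //.
by exists a, b; split=> //; exact: hom_fraction0 ha hb.
Qed.
(** * Functions annihilated by the vector field *)

Fact cross_subproof (R : comNzRingType) (R2 : 2%N \in [pchar R])
    (y0 y1 y2 a0 a1 a2 c0 c1 c2 : R) :
    y0 * c0 + y1 * c1 + y2 * c2 = 0 -> a0 * c0 + a1 * c1 + a2 * c2 = 0 ->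
  c0 * (y0 * a2 + y2 * a0) = c1 * (y1 * a2 + y2 * a1).
Proof.
move=> Ey Ea; apply/eqP; rewrite -subr_eq0 oppr_pchar2 //.
have -> : c0 * (y0 * a2 + y2 * a0) + c1 * (y1 * a2 + y2 * a1) =
  a2 * (y0 * c0 + y1 * c1 + y2 * c2) + y2 * (a0 * c0 + a1 * c1 + a2 * c2) -
  (a2 * y2 * c2) *+ 2 by ring.
by rewrite Ey Ea (mulrn_pchar R2) !mulr0 addr0 subr0.
Qed.

Fact kernel_subproof (E : fieldType) (a b c e : E) :
  b != 0 -> a * c = e * b -> a / b * c = e.
Proof. by move=> b0 h; rewrite mulrAC h mulfK. Qed.

Section Frame.
Variables (k : closedFieldType) (m : 'M[k]_3).
Hypothesis k2 : 2%N \in [pchar k].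
Local Notation Px := {mpoly k[3]}.
Local Notation F := {fraction Px}.
Local Notation tf := (@tofrac Px).
Let px2 := pchar2_mpoly 3 k2.
Let u012 : uniq [:: 0; 1; 2 : 'I_3] := isT.

Variable M : 'M[k]_3.
Hypothesis unitM : M \in unitmx.

(** Linear forms and partial derivatives for the coordinates in which the rows
    of M are the coordinate points. *)
Definition new_coord j : Px := \sum_i invmx M i j *: 'X_i.
Definition new_deriv i (p : Px) : Px := \sum_j M i j *: p^`M(j).
Definition new_field j : Px := \sum_i invmx M i j *: frob_field m i.

Notation Y := new_coord.
Notation A := new_field.
Notation dY := new_deriv.

Lemma new_coord_homog j : Y j \is 1.-homog.
Proof. by apply: rpred_sum => i _; apply: rpredZ (homogX k i). Qed.
Lemma new_field_homog j : A j \is 2.-homog.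
Proof. by apply: rpred_sum => i _; apply: rpredZ (frob_field_homog m i). Qed.

Lemma sum_invmxl i j : \sum_r M i r * invmx M r j = (i == j)%:R.
Proof. by have := congr1 (fun N : 'M_3 => N i j) (mulmxV unitM); rewrite !mxE. Qed.
Lemma sum_invmxr i j : \sum_r invmx M i r * M r j = (i == j)%:R.
Proof. by have := congr1 (fun N : 'M_3 => N i j) (mulVmx unitM); rewrite !mxE. Qed.

Lemma change_back (E : 'I_3 -> Px) i :
  E i = \sum_j M j i *: \sum_r invmx M r j *: E r.
Proof.
transitivity (\sum_r (r == i)%:R *: E r).
  rewrite (bigD1 i) //= eqxx scale1r big1 ?addr0 // => r /negPf ->.
  by rewrite scale0r.
under [RHS]eq_bigr => j _ do rewrite scaler_sumr.
rewrite exchange_big; apply: eq_bigr => r _ /=.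
rewrite -sum_invmxr scaler_suml; apply: eq_bigr => j _.
by rewrite scalerA mulrC.
Qed.

Lemma coord_new i : 'X_i = \sum_j M j i *: Y j.
Proof. exact: change_back. Qed.
Lemma field_new i : frob_field m i = \sum_j M j i *: A j.
Proof. exact: change_back. Qed.

Lemma deriv_new j p : p^`M(j) = \sum_i invmx M j i *: dY i p.
Proof.
under [RHS]eq_bigr => i _ do rewrite scaler_sumr.
rewrite exchange_big /= (bigD1 j) //= [X in _ + X]big1 => [|r rj].
  rewrite addr0; under eq_bigr => i _ do rewrite scalerA.
  by rewrite -scaler_suml sum_invmxr eqxx scale1r.
under eq_bigr => i _ do rewrite scalerA.
by rewrite -scaler_suml sum_invmxr eq_sym (negPf rj) scale0r.
Qed.

Lemma new_deriv_eq0 p : (forall i, dY i p = 0) -> forall j, p^`M(j) = 0.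
Proof. by move=> h j; rewrite deriv_new big1 // => i _; rewrite h scaler0. Qed.

Lemma new_derivD i p q : dY i (p + q) = dY i p + dY i q.
Proof. by rewrite -big_split; apply: eq_bigr => j _; rewrite mderivD scalerDr. Qed.

Lemma new_derivM i p q : dY i (p * q) = dY i p * q + p * dY i q.
Proof.
rewrite mulr_suml mulr_sumr -big_split; apply: eq_bigr => j _ /=.
by rewrite mderivM scalerDr scalerAl scalerAr.
Qed.

Lemma new_deriv_coord i j : dY i (Y j) = (i == j)%:R.
Proof.
rewrite -(mpolyC_nat 3 k) -sum_invmxl raddf_sum; apply: eq_bigr => r _ /=.
rewrite /new_coord (raddf_sum (mderiv r)) (bigD1 r) //= mderivZ mderivXU eqxx big1 => [|s sr].
  by rewrite addr0 scalerA -mul_mpolyC mulr1.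
by rewrite mderivZ mderivXU (negPf sr) scaler0.
Qed.

Lemma new_deriv_field i j : dY i (A j) = 0.
Proof.
rewrite /new_deriv big1 // => r _; rewrite /new_field (raddf_sum (mderiv r)) big1 ?scaler0 //= => s _.
rewrite mderivZ /frob_field (raddf_sum (mderiv r)) big1 ?scaler0 //= => t _.
rewrite mderivZ expr2 mderivM mderivXU.
by rewrite mulrC addrr_pchar2 ?scaler0.
Qed.

Lemma new_deriv2E i j p :
  dY i (dY j p) = \sum_r \sum_s (M i r * M j s) *: p^`M(s)^`M(r).
Proof.
apply: eq_bigr => r _; rewrite /new_deriv (raddf_sum (mderiv r)) scaler_sumr.
by apply: eq_bigr => s _; rewrite /= mderivZ scalerA.
Qed.

Lemma new_derivC i j p : dY i (dY j p) = dY j (dY i p).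
Proof.
rewrite !new_deriv2E exchange_big; apply: eq_bigr => r _; apply: eq_bigr => s _.
by rewrite mulrC mderiv_comm.
Qed.

(** In characteristic two the symmetric terms cancel in pairs. *)
Lemma new_deriv_sqr i p : dY i (dY i p) = 0.
Proof.
pose E r s := (M i r * M i s) *: p^`M(s)^`M(r).
have EC r s : E r s = E s r by rewrite /E mulrC mderiv_comm.
have E0 r : E r r = 0 by rewrite /E mderiv_sqr // scaler0.
rewrite new_deriv2E -/E; under eq_bigr => r _ do rewrite -/(E r _).
rewrite !(sum_ord3 _ u012) -!/(E _ _) !E0 (EC 1 0) (EC 2 0) (EC 2 1).
have -> : 0 + E 0 1 + E 0 2 + (E 0 1 + 0 + E 1 2) + (E 0 2 + E 1 2 + 0) =
  (E 0 1 + E 0 2 + E 1 2) *+ 2 by ring.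
exact: mulrn_pchar.
Qed.

Lemma euler_new d p : p \is d.-homog -> \sum_j Y j * dY j p = p *+ d.
Proof.
move=> hp; rewrite -(euler_homog hp).
transitivity (\sum_j \sum_i M j i *: (Y j * p^`M(i))).
  by apply: eq_bigr => j _; rewrite mulr_sumr; apply: eq_bigr => i _; rewrite -scalerAr.
rewrite exchange_big; apply: eq_bigr => i _ /=.
rewrite [in RHS]coord_new mulr_suml; apply: eq_bigr => j _.
by rewrite scalerAl.
Qed.

Lemma nabla_new p : nabla m p = \sum_j A j * dY j p.
Proof.
symmetry; transitivity (\sum_j \sum_i M j i *: (A j * p^`M(i))).
  by apply: eq_bigr => j _; rewrite mulr_sumr; apply: eq_bigr => i _; rewrite -scalerAr.
rewrite exchange_big; apply: eq_bigr => i _ /=.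
rewrite [in RHS]field_new mulr_suml; apply: eq_bigr => j _.
by rewrite scalerAl.
Qed.


(** Its partial derivatives are the minors formed by the coordinates and the
    coefficients of the vector field, which makes it a first integral. *)
Definition quartic : Px := A 0 * Y 1 * Y 2 + A 1 * Y 0 * Y 2 + A 2 * Y 0 * Y 1.

Lemma quartic_homog : quartic \is 4.-homog.
Proof.
have h a b c : A a * Y b * Y c \is 4.-homog.
  exact: (dhomogM (dhomogM (new_field_homog a) (new_coord_homog b)) (new_coord_homog c)).
by apply: rpredD (h _ _ _); exact: rpredD (h _ _ _) (h _ _ _).
Qed.

Lemma deriv_quartic0 : dY 0 quartic = Y 1 * A 2 + Y 2 * A 1.
Proof.
rewrite !new_derivD !new_derivM !new_deriv_field !new_deriv_coord /=.
by move: (Y 0) (Y 1) (Y 2) (A 0) (A 1) (A 2) => y0 y1 y2 a0 a1 a2; ring.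
Qed.
Lemma deriv_quartic1 : dY 1 quartic = Y 0 * A 2 + Y 2 * A 0.
Proof.
rewrite !new_derivD !new_derivM !new_deriv_field !new_deriv_coord /=.
by move: (Y 0) (Y 1) (Y 2) (A 0) (A 1) (A 2) => y0 y1 y2 a0 a1 a2; ring.
Qed.
Lemma deriv_quartic2 : dY 2 quartic = Y 0 * A 1 + Y 1 * A 0.
Proof.
rewrite !new_derivD !new_derivM !new_deriv_field !new_deriv_coord /=.
by move: (Y 0) (Y 1) (Y 2) (A 0) (A 1) (A 2) => y0 y1 y2 a0 a1 a2; ring.
Qed.
Lemma deriv_quartic_homog i : dY i quartic \is 3.-homog.
Proof.
by apply: rpred_sum => j _; apply: rpredZ; apply: mderiv_homog quartic_homog.
Qed.

(** The minors in the old coordinates are linear combinations of those in the new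
    ones. *)
Lemma wronsk_quartic i j : exists s : 'I_3 -> k,
  'X_i * frob_field m j + 'X_j * frob_field m i = \sum_r s r *: dY r quartic.
Proof.
pose w a b := Y a * A b + Y b * A a.
have wC a b : w a b = w b a by rewrite /w addrC.
have w0 a : w a a = 0 by rewrite /w addrr_pchar2.
pose c a b := M a i * M b j.
exists (fun r => if r == 0 then c 1 2 + c 2 1 else if r == 1 then c 0 2 + c 2 0
                 else c 0 1 + c 1 0).
have -> : 'X_i * frob_field m j + 'X_j * frob_field m i =
    \sum_a \sum_b c a b *: w a b.
  have E i' j' : 'X_i' * frob_field m j' =
      \sum_a \sum_b (M a i' * M b j') *: (Y a * A b).
    rewrite (coord_new i') (field_new j') mulr_suml; apply: eq_bigr => a _.
    rewrite mulr_sumr; apply: eq_bigr => b _.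
    by rewrite -scalerAl -scalerAr scalerA.
  rewrite !E [X in _ + X]exchange_big -big_split; apply: eq_bigr => a _.
  rewrite -big_split; apply: eq_bigr => b _ /=.
  by rewrite scalerDr [M b j * _]mulrC.
rewrite !(sum_ord3 _ u012) /= !w0 (wC 1 0) (wC 2 0) (wC 2 1) !scaler0.
rewrite deriv_quartic0 deriv_quartic1 deriv_quartic2.
rewrite -!/(w _ _) !scalerDl.
move: (_ *: _) (_ *: _) (_ *: _) (_ *: _) (_ *: _) (_ *: _) => a1 a2 a3 a4 a5 a6.
by rewrite !(add0r, addr0); ring.
Qed.

Section Kernel.
Variable L : set 'rV[k]_3 -> set (ratfun k -> ratfun k).
Hypothesis gen : generated_by L m.

(** Otherwise the vector field would be a multiple of the Euler field, and any
    rational function, for instance 1/X_0^2 on the line X_0 = 0, would be regular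
    by saturation. *)
Lemma deriv_quartic_neq0 : exists j, dY j quartic != 0.
Proof.
apply: contrapT => no; have z j : dY j quartic = 0.
  by apply/eqP; apply: contrapT => /negP h; apply: no; exists j.
have w0 i j : 'X_i * frob_field m j + 'X_j * frob_field m i = 0.
  by have [s ->] := wronsk_quartic i j; apply: big1 => r _; rewrite z scaler0.
have hX2 : ('X_0 : Px) ^+ 2 \is 2.-homog := dhomogMn 2 (homogX k 0).
have X20 : ('X_0 : Px) ^+ 2 != 0 by rewrite expf_neq0 // mpolyXU_neq0.
pose P : 'rV[k]_3 := delta_mx 0 1.
have P0 : P != 0.
  by apply: contraNneq (oner_neq0 k) => /rowP/(_ 1); rewrite !mxE !eqxx => <-.
have [|||||a [b [_ b0 Dab]]] :=
    gen_saturated gen (n := -2) (x := tf 1 / tf ('X_0 ^+ 2)) (a := 1)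
      (b := 'X_0 ^+ 2) (P := P).
- by exists 2%N, 0%N; split; rewrite ?dhomog1.
- exact: X20.
- by [].
- exact: P0.
- by move=> i j; rewrite w0 rmorph0 mulr0; apply: twist0.
have bn := meval_neq0 b0.
move: Dab => /eqP; rewrite eqr_div ?tofrac_eq0 // -!rmorphM tofrac_eq mul1r.
move=> /eqP Db; move: b0; rewrite Db mevalM rmorphXn /= mevalXU !mxE /=.
by rewrite expr0n mulr0 eqxx.
Qed.

(** The gradient of p is orthogonal to the coordinates and to the vector field,
    hence proportional to the gradient of the quartic.  The factor is a
    polynomial because the foliation is saturated, and a square because the
    gradients are closed. *)
Lemma kernel_nabla d p : p \is (d.*2).-homog -> nabla m p = 0 ->
  exists s t, [/\ s \is d.-homog, t \is (d - 2).-homog, ((d < 2)%N -> t = 0)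
                & p = t ^+ 2 * quartic + s ^+ 2].
Proof.
move=> hp np; case: d hp => [|d] hp.
  have [s hs ->] := sqrt_homog k2 hp (fun i => homog0_mderiv i hp).
  by exists s, 0; split; rewrite ?rpred0 // expr0n mul0r add0r.
have hc i : dY i p \is (d.*2.+1).-homog.
  by apply: rpred_sum => j _; apply: rpredZ; apply: mderiv_homog.
have Ey : Y 0 * dY 0 p + Y 1 * dY 1 p + Y 2 * dY 2 p = 0.
  rewrite -(sum_ord3 (fun j => Y j * dY j p) u012) (euler_new hp).
  by rewrite -mul2n mulrnA (mulrn_pchar px2) mul0rn.
have Ea : A 0 * dY 0 p + A 1 * dY 1 p + A 2 * dY 2 p = 0.
  by rewrite -(sum_ord3 (fun j => A j * dY j p) u012) -nabla_new.
have cross i j : dY i p * dY j quartic = dY j p * dY i quartic.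
  have c01 : dY 0 p * dY 1 quartic = dY 1 p * dY 0 quartic.
    by rewrite deriv_quartic0 deriv_quartic1; exact (cross_subproof px2 Ey Ea).
  have c02 : dY 0 p * dY 2 quartic = dY 2 p * dY 0 quartic.
    move: Ey Ea; rewrite ![_ + _ 1 * _ + _]addrAC => Ey' Ea'.
    rewrite deriv_quartic0 deriv_quartic2 [Y 1 * A 2 + _]addrC.
    exact (cross_subproof px2 Ey' Ea').
  have c12 : dY 1 p * dY 2 quartic = dY 2 p * dY 1 quartic.
    move: Ey Ea; rewrite -![_ + _ 1 * _ + _]addrA => Ey' Ea'.
    rewrite addrC in Ey'; rewrite addrC in Ea'.
    rewrite deriv_quartic1 deriv_quartic2 addrC [Y 0 * A 2 + _]addrC.
    exact (cross_subproof px2 Ey' Ea').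
  by case: (ord3_cases u012 i) => ->; case: (ord3_cases u012 j) => ->.
have [j0 q0] := deriv_quartic_neq0.
have tq0 : tf (dY j0 quartic) != 0 by rewrite tofrac_eq0.
have Ecross i : tf (dY j0 p) / tf (dY j0 quartic) * tf (dY i quartic) = tf (dY i p).
  apply: kernel_subproof tq0 _; rewrite -!rmorphM; congr tf.
  exact: cross.
pose n : int := d.*2.+1%:Z - 3.
have [P P0 _|K DK hK] := @section_poly k n (tf (dY j0 p) / tf (dY j0 quartic)) 0 1 isT.
  apply: (gen_saturated gen _ q0 erefl P0).
    by exists 3%N, d.*2.+1; split=> //; rewrite ?deriv_quartic_homog // /n; lia.
  move=> i j; have [s ->] := wronsk_quartic i j.
  have -> : tf (dY j0 p) / tf (dY j0 quartic) * tf (\sum_r s r *: dY r quartic) =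
            tf (\sum_r s r *: dY r p).
    move: (_ / _) Ecross => x Ecross.
    rewrite 2!(rmorph_sum tf) mulr_sumr; apply: eq_bigr => r _.
    rewrite -!mul_mpolyC (rmorphM tf _ (dY r quartic)) (rmorphM tf _ (dY r p)).
    by rewrite /= -(Ecross r); exact: mulrCA.
  have hs : \sum_r s r *: dY r p \is (d.*2.+1).-homog.
    by apply: rpred_sum => r _; apply: rpredZ.
  by have := twist_poly P hs; congr (twist_at _ _ _); rewrite /n; lia.
have Dc i : dY i p = K * dY i quartic.
  by apply/eqP; rewrite -tofrac_eq -Ecross DK rmorphM.
have mixed i j : dY i K * dY j quartic = dY j K * dY i quartic.
  have := new_derivC i j p; rewrite !Dc !new_derivM (new_derivC i j).
  by move/addIr.
have dK i : dY i K = 0.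
  have z : dY j0 K = 0.
    have := new_deriv_sqr j0 p; rewrite Dc new_derivM new_deriv_sqr mulr0 addr0.
    by move/eqP; rewrite mulf_eq0 (negPf q0) orbF => /eqP.
  have /eqP := mixed i j0; rewrite z mul0r mulf_eq0 (negPf q0) orbF.
  by move/eqP.
have [t [ht t0 DKt]] : exists t, [/\ t \is (d.+1 - 2).-homog, ((d.+1 < 2)%N -> t = 0)
                                   & K = t ^+ 2].
  have [d2|d2] := ltnP d.+1 2.
    exists 0; split; rewrite ?rpred0 // expr0n.
    have d0 : d = 0%N by lia.
    by move: hK; rewrite /n d0.
  have hK' : K \is ((d.+1 - 2).*2).-homog.
    by move: hK; have -> : n = (d.+1 - 2).*2%:Z by rewrite /n; lia.
  have [t ht DKt] := sqrt_homog k2 hK' (new_deriv_eq0 dK).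
  by exists t; split=> //; lia.
have hr : p + t ^+ 2 * quartic \is (d.+1.*2).-homog.
  apply: rpredD => //; have [d2|d2] := ltnP d.+1 2.
    by rewrite t0 // expr0n mul0r rpred0.
  have -> : (d.+1.*2 = (d.+1 - 2) * 2 + 4)%N by lia.
  exact: dhomogM (dhomogMn 2 ht) quartic_homog.
have dr i : dY i (p + t ^+ 2 * quartic) = 0.
  by rewrite -DKt new_derivD new_derivM dK mul0r add0r Dc addrr_pchar2.
have [s hs Es] := sqrt_homog k2 hr (new_deriv_eq0 dr).
exists s, t; split=> //.
by rewrite -Es addrCA addrr_pchar2 ?addr0.
Qed.

End Kernel.

End Frame.

(** * Local rings of the quotient in affine coordinates *)

Fact local_subproof (E : fieldType) (a b y t q s : E) : b != 0 -> y != 0 ->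
    a * b = t ^+ 2 * q + s ^+ 2 ->
  a / b = (s / b) ^+ 2 + ((t * y ^+ 2) / b) ^+ 2 * (q / y ^+ 4).
Proof.
move=> b0 y0 h; have -> : a / b = (a * b) / b ^+ 2 by field.
by rewrite h; field; rewrite b0 y0.
Qed.

Fact local_subproof2 (E : fieldType) (a1 b1 a2 b2 y q : E) :
    b1 != 0 -> b2 != 0 -> y != 0 ->
  (a1 / b1) ^+ 2 + (a2 / b2) ^+ 2 * (q / y ^+ 4) =
  ((a1 * b2 * y ^+ 2) ^+ 2 + (a2 * b1) ^+ 2 * q) / (b1 * b2 * y ^+ 2) ^+ 2.
Proof. by move=> b10 b20 y0; field; rewrite b10 b20 y0. Qed.

Section LocalChart.
Variables (k : closedFieldType) (m : 'M[k]_3).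
Hypothesis k2 : 2%N \in [pchar k].
Variables (M : 'M[k]_3) (unitM : M \in unitmx).
Variable L : set 'rV[k]_3 -> set (ratfun k -> ratfun k).
Hypothesis gen : generated_by L m.
Local Notation Px := {mpoly k[3]}.
Local Notation Pxy := {mpoly k[2]}.
Local Notation F := {fraction Px}.
Local Notation K := (ratfun k).
Local Notation tf := (@tofrac Px).
Local Notation Y := (new_coord M).
Local Notation A := (new_field m M).
Local Notation Q := (quartic m M).
Let u012 : uniq [:: 0; 1; 2 : 'I_3] := isT.
Let px2 := pchar2_mpoly 3 k2.

Lemma tfX (a : Px) n : tf (a ^+ n) = tf a ^+ n. Proof. exact: (rmorphXn tf). Qed.
Lemma tfM (a b : Px) : tf (a * b) = tf a * tf b. Proof. exact: (rmorphM tf). Qed.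
Lemma tfD (a b : Px) : tf (a + b) = tf a + tf b. Proof. exact: (rmorphD tf). Qed.

(** The matrix, in the basis formed by the rows of M, of the Frobenius-semilinear
    map x -> x^(2) m. *)
Definition frame_matrix : 'M[k]_3 := map_mx (fun a => a ^+ 2) M *m m *m invmx M.

Lemma new_field_frob j : A j = \sum_r frame_matrix r j *: Y r ^+ 2.
Proof.
have E s : 'X_s ^+ 2 = \sum_r M r s ^+ 2 *: Y r ^+ 2.
  rewrite (coord_new unitM s) (sqr_sum2 px2); apply: eq_bigr => r _.
  by rewrite exprZn.
rewrite /new_field /frob_field.
under eq_bigr => i _ do rewrite scaler_sumr.
transitivity (\sum_r \sum_i \sum_s (M r s ^+ 2 * m s i * invmx M i j) *: Y r ^+ 2).
  rewrite exchange_big; rewrite [RHS]exchange_big /=.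
  under [RHS]eq_bigr => i _ do rewrite exchange_big.
  rewrite [RHS]exchange_big /=; apply: eq_bigr => s _; apply: eq_bigr => i _.
  rewrite E !scaler_sumr; apply: eq_bigr => r _.
  by rewrite !scalerA; congr (_ *: _); rewrite mulrC mulrCA mulrA mulrAC.
apply: eq_bigr => r _; rewrite mxE scaler_suml; apply: eq_bigr => i _.
rewrite mxE mulr_suml scaler_suml; apply: eq_bigr => s _.
by rewrite !mxE.
Qed.

Lemma nabla_quartic : nabla m Q = 0.
Proof.
rewrite (nabla_new m unitM) (sum_ord3 _ u012) deriv_quartic0 // deriv_quartic1 //.
rewrite deriv_quartic2 //.
move: (Y 0) (Y 1) (Y 2) (A 0) (A 1) (A 2) => y0 y1 y2 a0 a1 a2.
have -> : a0 * (y1 * a2 + y2 * a1) + a1 * (y0 * a2 + y2 * a0) + a2 * (y0 * a1 + y1 * a0)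
  = (a0 * y1 * a2 + a0 * y2 * a1 + a1 * y0 * a2) *+ 2 by ring.
exact: mulrn_pchar.
Qed.

Let P : 'rV[k]_3 := row 0 M.

Lemma meval_coord j : (Y j).@[P 0] = (0 == j)%:R.
Proof.
rewrite -(sum_invmxl unitM) raddf_sum; apply: eq_bigr => r _ /=.
by rewrite mevalZ mevalXU mxE mulrC.
Qed.

Lemma frame_point_neq0 : P != 0.
Proof.
apply: contraNneq (oner_neq0 k) => P0.
have <- : (Y 0).@[P 0] = 1 by rewrite meval_coord eqxx.
rewrite P0 raddf_sum big1 //= => i _.
by rewrite mevalZ mevalXU mxE mulr0.
Qed.

Let l := Y 0.
Let hl : l \is 1.-homog := new_coord_homog M 0.
Let lP : l.@[P 0] != 0. Proof. by rewrite meval_coord eqxx oner_neq0. Qed.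
Let l0 : l != 0 := meval_neq0 lP.

Definition xy_coord (i : 'I_2) : K := dehom l (Y (lift 0 i)).

Fact iota_key : unit. Proof. exact: tt. Qed.
(** Evaluation at the affine coordinates Y_1/Y_0 and Y_2/Y_0. *)
Definition iota : {rmorphism Pxy -> K} :=
  locked_with iota_key (mmap (@ratconst k) xy_coord : {rmorphism Pxy -> K}).

Lemma iotaC c : iota c%:MP = ratconst c.
Proof. by rewrite [iota]unlock /= mmapC. Qed.
Lemma iotaX i : iota 'X_i = dehom l (Y (lift 0 i)).
Proof. by rewrite [iota]unlock /= mmapX mmap1U. Qed.

Fact restr_key : unit. Proof. exact: tt. Qed.
(** Restriction to Y_0 = 1, with Y_1 and Y_2 as the two variables. *)
Definition restr : {rmorphism Px -> Pxy} :=
  locked_with restr_key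
    (mmap (@mpolyC 2 k) (fun i => (M 0 i)%:MP + M 1 i *: 'X_0 + M 2 i *: 'X_1)
     : {rmorphism Px -> Pxy}).

Lemma restrC c : restr c%:MP = c%:MP.
Proof. by rewrite [restr]unlock /= mmapC. Qed.
Lemma restrX i : restr 'X_i = (M 0 i)%:MP + M 1 i *: 'X_0 + M 2 i *: 'X_1.
Proof. by rewrite [restr]unlock /= mmapX mmap1U. Qed.
Lemma restrZ c p : restr (c *: p) = c *: restr p.
Proof. by rewrite -!mul_mpolyC rmorphM restrC. Qed.

Lemma restr_coord j : restr (Y j) =
  (0 == j)%:R%:MP + (1 == j)%:R *: 'X_0 + (2 == j)%:R *: 'X_1.
Proof.
rewrite -!(sum_invmxl unitM) (raddf_sum (@mpolyC 2 k)) !scaler_suml -!big_split.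
rewrite (rmorph_sum restr).
apply: eq_bigr => i _; rewrite restrZ restrX !scalerDr !scalerA -mul_mpolyC -mpolyCM.
by rewrite ![invmx M i j * _]mulrC.
Qed.

Lemma dehom_scale c p : dehom l (c *: p) = ratconst c * dehom l p.
Proof. by rewrite -mul_mpolyC rmorphM dehomC. Qed.

Lemma dehom_l : dehom l l = 1.
Proof.
apply: ratfun_val_inj; rewrite (dehomE hl l0 hl) expr1 rmorph1 divff //.
by rewrite tofrac_eq0.
Qed.

Lemma iota_restr a : iota (restr a) = dehom l a.
Proof.
elim/mpoly_ring_ind: a => [c|i|p q Ep Eq|p q Ep Eq].
- by rewrite restrC iotaC dehomC.
- rewrite restrX (coord_new unitM i) (rmorph_sum (dehom l)) (sum_ord3 _ u012).
  rewrite !dehom_scale dehom_l mulr1 !(rmorphD iota) -!mul_mpolyC !(rmorphM iota).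
  rewrite !iotaC !iotaX.
  by congr (_ + _ * dehom l (Y _) + _ * dehom l (Y _)); apply/val_inj.
- by rewrite !rmorphD Ep Eq.
- by rewrite !rmorphM Ep Eq.
Qed.

Lemma meval_restr a : (restr a).@[fun=> 0] = a.@[P 0].
Proof.
elim/mpoly_ring_ind: a => [c|i|p q Ep Eq|p q Ep Eq].
- by rewrite restrC !mevalC.
- by rewrite restrX !mevalD !mevalZ !mevalXU mevalC !mulr0 !addr0 mxE.
- by rewrite rmorphD !mevalD Ep Eq.
- by rewrite rmorphM !mevalM Ep Eq.
Qed.

Lemma homogenize (p : Pxy) : exists d a, a \is d.-homog /\ restr a = p.
Proof.
have lE d : restr (l ^+ d) = 1.
  rewrite rmorphXn restr_coord eqxx /= !scale0r !addr0 mpolyC1.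
  exact: expr1n.
have hlE d : l ^+ d \is d.-homog by rewrite -{2}[d]mul1n; apply: dhomogMn hl.
elim/mpoly_ring_ind: p => [c|i|p q [d [a [ha <-]]] [e [b [hb <-]]]|
                             p q [d [a [ha <-]]] [e [b [hb <-]]]].
- exists 0%N, c%:MP; rewrite restrC; split=> //.
  by rewrite -[c]mulr1 mpolyCM mul_mpolyC rpredZ ?dhomog1.
- exists 1%N, (Y (lift 0 i)); split; first exact: new_coord_homog.
  rewrite restr_coord; case: i => -[|[|//]] Hi; rewrite /= !scale0r mpolyC0.
    by rewrite add0r addr0 scale1r; congr 'X_ _; apply/val_inj.
  by rewrite !add0r scale1r; congr 'X_ _; apply/val_inj.
- exists (d + e)%N, (a * l ^+ e + b * l ^+ d); split.
    by apply: rpredD; [apply: dhomogM | rewrite addnC; apply: dhomogM].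
  by rewrite rmorphD !rmorphM !lE !mulr1.
- by exists (d + e)%N, (a * b); rewrite rmorphM; split=> //; apply: dhomogM.
Qed.

Lemma iota_inj p : iota p = 0 -> p = 0.
Proof.
have [d [a [ha <-]]] := homogenize p; rewrite iota_restr => /eqP h.
have [->|a0] := eqVneq a 0; first by rewrite rmorph0.
by have := dehom_neq0 hl l0 ha a0; rewrite h.
Qed.

Lemma regular_iota g : regular_at P g <->
  exists p b, b.@[fun=> 0] != 0 /\ g = iota p / iota b.
Proof.
split=> [/regular_rep[d [a [b [ha hb b0 Dg]]]]|[p [b [b0 ->]]]].
  exists (restr a), (restr b); rewrite meval_restr; split=> //.
  by rewrite !iota_restr; exact: (dehom_div hl l0 ha hb (meval_neq0 b0) Dg).
have [d [a [ha Da]]] := homogenize p; have [e [c [hc Dc]]] := homogenize b.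
rewrite -Da -Dc !iota_restr; apply: regularM; first exact: (regular_dehom hl l0 lP).
by apply: (regular_dehomV hl l0 hc); rewrite -meval_restr Dc.
Qed.

Lemma iota_quartic : ratfun_val (iota (restr Q)) = tf Q / tf l ^+ 4.
Proof. by rewrite iota_restr; exact: (dehomE hl l0 (quartic_homog m M)). Qed.

(** For g = a/b the form ab is annihilated by the vector field, so it is
    t^2 q + s^2 with q the quartic, by [kernel_nabla]; divide by b^2. *)
Lemma OY_iota g : OY_at L P g <-> exists s t, [/\ regular_at P s, regular_at P t
  & g = s ^+ 2 + t ^+ 2 * iota (restr Q)].
Proof.
have P0 := frame_point_neq0; have tl0 : tf l != 0 by rewrite tofrac_eq0.
have reg d a b f : a \is d.-homog -> b \is d.-homog -> b.@[P 0] != 0 ->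
    ratfun_val f = tf a / tf b -> regular_at P f.
  by move=> ha hb b0 Df; exists a, b; split=> //; exact: hom_fraction0 ha hb.
have mk d a b : a \is d.-homog -> b \is d.-homog -> b.@[P 0] != 0 ->
    exists2 f : K, regular_at P f & ratfun_val f = tf a / tf b.
  move=> ha hb b0; apply: twist_ratfun; exists a, b; split=> //.
  exact: hom_fraction0 ha hb.
split=> [Og|[s [t [rs rt Dg]]]].
  have /regular_rep[d [a [b [ha hb b0 Dg]]]] := gen_regular gen P0 Og.
  have nab := iffLR (gen_OY gen P0 ha hb b0 Dg) Og.
  have hab : a * b \is (d.*2).-homog by rewrite -addnn; apply: dhomogM.
  have [s [t [hs ht t0 Eab]]] := kernel_nabla k2 unitM gen hab nab.
  have [u ru Du] := mk d s b hs hb b0.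
  have hv : t * l ^+ 2 \is d.-homog.
    have [d2|d2] := ltnP d 2; first by rewrite t0 // mul0r rpred0.
    by have := dhomogM ht (dhomogMn 2 hl); rewrite mul1n subnK.
  have [v rv Dv] := mk d _ b hv hb b0.
  exists u, v; split=> //; apply: ratfun_val_inj.
  have Ev : tf (t * l ^+ 2) = tf t * tf l ^+ 2 by rewrite tfM tfX.
  rewrite rmorphD rmorphM !rmorphXn /= iota_quartic Dg Du Dv Ev.
  apply: local_subproof tl0 _; first by rewrite tofrac_eq0 (meval_neq0 b0).
  by rewrite -tfM Eab tfD tfM !tfX.
have [d [a1 [b1 [ha1 hb1 b10 Ds]]]] := regular_rep rs.
have [e [a2 [b2 [ha2 hb2 b20 Dt]]]] := regular_rep rt.
set c1 := a1 * b2 * l ^+ 2; set c2 := a2 * b1; set b := b1 * b2 * l ^+ 2.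
have Dg' : ratfun_val g = tf (c1 ^+ 2 + c2 ^+ 2 * Q) / tf (b ^+ 2).
  rewrite Dg rmorphD rmorphM !(rmorphXn (@ratfun_val k)) /= iota_quartic Ds Dt.
  have -> : tf (c1 ^+ 2 + c2 ^+ 2 * Q) =
      (tf a1 * tf b2 * tf l ^+ 2) ^+ 2 + (tf a2 * tf b1) ^+ 2 * tf Q.
    have <- : tf c1 = tf a1 * tf b2 * tf l ^+ 2 by rewrite tfM tfX tfM.
    have <- : tf c2 = tf a2 * tf b1 by exact: tfM.
    by rewrite tfD [tf (_ * Q)]tfM !tfX.
  have -> : tf (b ^+ 2) = (tf b1 * tf b2 * tf l ^+ 2) ^+ 2.
    have <- : tf b = tf b1 * tf b2 * tf l ^+ 2 by rewrite tfM tfX tfM.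
    exact: tfX.
  by apply: local_subproof2; rewrite ?tofrac_eq0 ?(meval_neq0 b10) ?(meval_neq0 b20).
have hc1 : c1 \is (d + e + 2).-homog by exact: dhomogM (dhomogM ha1 hb2) (dhomogMn 2 hl).
have hc2 : c2 \is (d + e).-homog by rewrite addnC; exact: dhomogM.
have hb : b \is (d + e + 2).-homog by exact: dhomogM (dhomogM hb1 hb2) (dhomogMn 2 hl).
have hnum : c1 ^+ 2 + c2 ^+ 2 * Q \is ((d + e + 2) * 2).-homog.
  apply: rpredD; first exact: dhomogMn.
  rewrite (_ : (d + e + 2) * 2 = (d + e) * 2 + 4)%N; last by rewrite mulnDl.
  exact: dhomogM (dhomogMn 2 hc2) (quartic_homog m M).
have hden : b ^+ 2 \is ((d + e + 2) * 2).-homog by exact: dhomogMn.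
have bP : (b ^+ 2).@[P 0] != 0.
  have lP2 : (l ^+ 2).@[P 0] != 0 by rewrite rmorphXn expf_neq0.
  by rewrite rmorphXn expf_neq0 //= !mevalM !mulf_neq0.
apply/(gen_OY gen P0 hnum hden bP Dg').
by rewrite nablaM // nablaD nablaM // !nabla_sqr // nabla_quartic !(mulr0, mul0r, addr0).
Qed.

End LocalChart.

(** * Completed local rings *)

Section LowDegree.
Variables (R : comNzRingType) (n : nat).
Implicit Types (p q : {mpoly R[n]}) (m : 'X_{1..n}).

Definition order_ge d p := forall m, (mdeg m < d)%N -> p@_m = 0.

Lemma order_ge0 p : order_ge 0 p. Proof. by []. Qed.

Lemma order_geW d e p : (d <= e)%N -> order_ge e p -> order_ge d p.
Proof. by move=> de h m md; apply: h; apply: leq_trans md de. Qed.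

Lemma order_geD d p q : order_ge d p -> order_ge d q -> order_ge d (p + q).
Proof. by move=> hp hq m md; rewrite mcoeffD hp // hq // addr0. Qed.

Lemma order_geM d e p q : order_ge d p -> order_ge e q -> order_ge (d + e) (p * q).
Proof.
move=> hp hq m md; rewrite mcoeffM big1 // => k /eqP Dm.
have [k1|k1] := ltnP (mdeg k.1) d; first by rewrite hp // mul0r.
have kd : (mdeg k.1 + mdeg k.2 < d + e)%N by rewrite -mdegD -Dm.
rewrite hq ?mulr0 // -(ltn_add2l d); apply: leq_ltn_trans kd.
by rewrite leq_add2r.
Qed.

Lemma order_ge_sum d I (r : seq I) (P : pred I) (E : I -> {mpoly R[n]}) :
  (forall i, P i -> order_ge d (E i)) -> order_ge d (\sum_(i <- r | P i) E i).
Proof.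
move=> h; apply: (big_ind (order_ge d)) => //; first by move=> m _; rewrite mcoeff0.
by move=> p q; apply: order_geD.
Qed.

Lemma order_geX d m : (d <= mdeg m)%N -> order_ge d 'X_[m].
Proof.
move=> dm m' m'd; rewrite mcoeffX; case: eqP => // E.
by move: (leq_trans m'd dm); rewrite E ltnn.
Qed.

Lemma order_geZ d c p : order_ge d p -> order_ge d (c *: p).
Proof. by move=> h m md; rewrite mcoeffZ h // mulr0. Qed.

Lemma order_ge_msupp d p m : order_ge d p -> m \in msupp p -> (d <= mdeg m)%N.
Proof.
move=> h; rewrite leqNgt; apply: contraL => md.
by rewrite -mcoeff_eq0 h.
Qed.

End LowDegree.

Section CompletionCriterion.
Variables (k R : comNzRingType) (c : {rmorphism k -> R}) (A m : set R) (N : nat).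
Variable a : 'I_N -> R.
Hypothesis Ac : forall x, A (c x).
Hypothesis AD : forall x y, A x -> A y -> A (x + y).
Hypothesis AM : forall x y, A x -> A y -> A (x * y).
Hypothesis mA : forall x, m x -> A x.
Hypothesis ma : forall i, m (a i).
Hypothesis m_gen : forall x, m x ->
  exists b : 'I_N -> R, (forall i, A (b i)) /\ x = \sum_i b i * a i.
Hypothesis residue : forall x, A x -> exists y, m (x - c y).

Local Notation I := (ideal_exp A m).

Lemma A0 : A 0. Proof. by rewrite -(rmorph0 c). Qed.
Lemma A1 : A 1. Proof. by rewrite -(rmorph1 c). Qed.
Lemma AN x : A x -> A (- x).
Proof. by move=> Ax; rewrite -mulN1r -(rmorph1 c) -rmorphN; apply: AM. Qed.

Lemma ideal_expD n x y : I n x -> I n y -> I n (x + y).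
Proof.
case: n => [|n]; first exact: AD.
move=> [s [hs ->]] [t [ht ->]]; exists (s ++ t); rewrite big_cat; split=> // z.
by rewrite mem_cat => /orP[/hs|/ht].
Qed.

Lemma ideal_expM n x y : A x -> I n y -> I n (x * y).
Proof.
elim: n y => [|n IH] y Ax; first exact: AM.
move=> [s [hs ->]]; exists [seq (z.1, x * z.2) | z <- s]; split.
  by move=> _ /mapP[z zs ->] /=; have [mz Iz] := hs _ zs; split=> //; apply: IH.
rewrite big_map mulr_sumr; apply: eq_bigr => z _ /=; exact: mulrCA.
Qed.

Lemma ideal_expN n x : I n x -> I n (- x).
Proof. by move=> Ix; rewrite -mulN1r; apply: ideal_expM => //; apply/AN/A1. Qed.

Lemma ideal_exp0 n : I n 0.
Proof. by case: n => [|n]; [exact: A0 | exists [::]; rewrite big_nil]. Qed.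

Lemma ideal_exp_sum n T (r : seq T) (E : T -> R) :
  (forall i, I n (E i)) -> I n (\sum_(i <- r) E i).
Proof.
move=> h; apply: (big_ind (I n)) => //; first exact: ideal_exp0.
by move=> x y; apply: ideal_expD.
Qed.

Lemma ideal_expS n x y : m x -> I n y -> I n.+1 (x * y).
Proof.
move=> mx Iy; exists [:: (x, y)]; rewrite big_seq1; split=> // z.
by rewrite inE => /eqP ->.
Qed.

Lemma ideal_exp_pred n x : I n.+1 x -> I n x.
Proof.
move=> [s [hs ->]]; rewrite big_seq; apply: (big_ind (I n)).
- exact: ideal_exp0.
- by move=> y z; apply: ideal_expD.
- by move=> z /hs[mz Iz]; apply: ideal_expM => //; apply: mA.
Qed.

Lemma ideal_expW n n' x : (n <= n')%N -> I n' x -> I n x.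
Proof.
move=> /subnK <-; elim: (n' - n)%N => [|d IH] //.
by rewrite addSn => /ideal_exp_pred.
Qed.

Definition ev_gen : {rmorphism {mpoly k[N]} -> R} := mmap c a.

Lemma ev_genC x : ev_gen x%:MP = c x. Proof. exact: mmapC. Qed.
Lemma ev_genX i : ev_gen 'X_i = a i. Proof. exact: (etrans (mmapX _ _ _) (mmap1U _ _)). Qed.

Lemma ev_gen_mon mu : I (mdeg mu) (ev_gen 'X_[mu]).
Proof.
move En: (mdeg mu) => n; elim: n mu En => [|n IH] mu En.
  move/eqP: En; rewrite mdeg_eq0 => /eqP ->.
  by rewrite mpolyX0 rmorph1; apply: A1.
have [i mi] : exists i, mu i != 0%N.
  apply: contrapT => h; move: En; rewrite mdegE big1 // => i _.
  by apply/eqP; apply: contrapT => /negP ?; apply: h; exists i.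
have Dmu : mu = (U_(i) + (mu - U_(i)))%MM by rewrite addmC submK // lep1mP.
rewrite Dmu mpolyXD rmorphM ev_genX; apply: ideal_expS => //; apply: IH.
by move: En; rewrite {1}Dmu mdegD mdeg1 add1n => -[].
Qed.

Lemma ev_gen_order n p : order_ge n p -> I n (ev_gen p).
Proof.
move=> hp; rewrite (mpolyE p) rmorph_sum big_seq; apply: (big_ind (I n)).
- exact: ideal_exp0.
- by move=> y z; apply: ideal_expD.
move=> mu /(order_ge_msupp hp) h; rewrite -mul_mpolyC rmorphM ev_genC.
by apply: ideal_expM => //; apply: ideal_expW h (ev_gen_mon mu).
Qed.

Lemma A_ev p : A (ev_gen p).
Proof. exact: (@ev_gen_order 0). Qed.

(** Modulo the next power, an element of a power of the maximal ideal is the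
    value of a form in the generators. *)
Lemma ideal_exp_form n x : I n x -> exists q : {mpoly k[N]},
  (forall mu, mdeg mu != n -> q@_mu = 0) /\ I n.+1 (x - ev_gen q).
Proof.
elim: n x => [|n IH] x.
  move=> /residue[y my]; exists y%:MP; split.
    by move=> mu; rewrite mdeg_eq0 mcoeffC eq_sym => /negPf ->; rewrite mulr0.
  by rewrite ev_genC -[_ - _]mulr1; apply: ideal_expS => //; apply: A1.
move=> [s [hs ->]]; elim: s hs => [|z s IHs] hs.
  exists 0; split=> [mu _|]; first exact: mcoeff0.
  by rewrite big_nil rmorph0 subr0; apply: ideal_exp0.
have [|q [qh Iq]] := IHs; first by move=> t ts; apply: hs; rewrite inE ts orbT.
have [mz Iz] := hs z (mem_head _ _).
have [q2 [q2h Iq2]] := IH _ Iz.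
have [b [Ab Dz]] := m_gen mz.
have [y my] := choice (fun i => residue (Ab i)).
exists (\sum_i y i *: ('X_i * q2) + q); split.
  move=> mu hmu; rewrite mcoeffD qh // addr0 raddf_sum big1 //= => i _.
  rewrite mcoeffZ; have [mi|mi] := eqVneq (mu i) 0%N.
    rewrite mcoeffM big1 ?mulr0 // => h /eqP Dmu.
    rewrite mcoeffX; case: eqP => [E|]; last by rewrite mul0r.
    have := congr1 (fun mu' : 'X_{1..N} => mu' i) Dmu.
    by rewrite mnmDE -E mnm1E eqxx mi.
  have Dmu : mu = (U_(i) + (mu - U_(i)))%MM by rewrite addmC submK // lep1mP.
  rewrite mulrC Dmu [X in X@_ _]mulrC mcoeffMX q2h ?mul0r //.
  by apply: contraNneq hmu => E; rewrite Dmu mdegD mdeg1 E add1n.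
rewrite big_cons rmorphD opprD addrACA; apply: ideal_expD => //.
rewrite Dz mulr_suml rmorph_sum -sumrB; apply: ideal_exp_sum => i.
rewrite -mul_mpolyC !rmorphM ev_genC ev_genX.
have -> : b i * a i * z.2 - c (y i) * (a i * ev_gen q2) =
  (b i - c (y i)) * (a i * z.2) + c (y i) * (a i * (z.2 - ev_gen q2)) by ring.
apply: ideal_expD; first by do 2!apply: ideal_expS => //.
by apply: ideal_expM => //; apply: ideal_expS.
Qed.

Definition eval_series (g : mseries N k) (n : nat) : R := ev_gen (mstrunc n g).

Lemma eval_series_eq n p q : (forall mu, (mdeg mu < n)%N -> p@_mu = q@_mu) ->
  I n (ev_gen p - ev_gen q).
Proof.
move=> h; rewrite -rmorphB; apply: ev_gen_order => mu hmu.
by rewrite mcoeffB h // subrr.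
Qed.

Lemma eval_series_mpoly p n : I n (eval_series (series_of_mpoly p) n - ev_gen p).
Proof. by apply: eval_series_eq => mu hmu; rewrite mstruncE. Qed.

Lemma eval_seriesM f g n :
  I n (eval_series (f * g) n - eval_series f n * eval_series g n).
Proof.
rewrite /eval_series -rmorphM; apply: eval_series_eq => mu hmu.
by rewrite mstruncE // -(mstrunc_mul f g hmu).
Qed.

Lemma eval_series_coherent g : coherent A m (eval_series g).
Proof.
move=> n; split; first exact: A_ev.
by apply: eval_series_eq => mu hmu; rewrite !mstruncE // ltnW.
Qed.

(** The series is found one degree at a time, by [ideal_exp_form]. *)
Lemma eval_series_surj u : coherent A m u -> exists g, lim_eq A m (eval_series g) u.
Proof.
move=> hu.
pose step (n : nat) (p q : {mpoly k[N]}) :=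
  I n (u n - ev_gen p) -> (forall mu, mdeg mu != n -> q@_mu = 0) /\
    I n.+1 (u n.+1 - ev_gen (p + q)).
have step_ex np : exists q, step np.1 np.2 q.
  case: np => n p /=; have [h|h] := pselect (I n (u n - ev_gen p)); last first.
    by exists 0 => /h.
  have [Au hu'] := hu n.
  have /ideal_exp_form[q [qh Iq]] : I n (u n.+1 - ev_gen p).
    by rewrite -(subrK (u n) (u n.+1)) -addrA; apply: ideal_expD.
  by exists q => _; split=> //; rewrite rmorphD opprD addrA.
have [F hF] := choice step_ex.
pose ps := fix ps n := if n is n'.+1 then ps n' + F (n', ps n') else 0.
have Ips n : I n (u n - ev_gen (ps n)).
  elim: n => [|n IH]; last by have [] := hF (n, ps n) IH.
  by apply: AD; [case: (hu 0%N) | apply/AN/A_ev].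
exists (MSeries (fun mu => (F (mdeg mu, ps (mdeg mu)))@_mu)) => n.
have Dps mu d : (mdeg mu < d)%N -> (ps d)@_mu = (F (mdeg mu, ps (mdeg mu)))@_mu.
  have lo e mu' : (e <= mdeg mu')%N -> (ps e)@_mu' = 0.
    elim: e => [|e IH] he; first by rewrite mcoeff0.
    rewrite mcoeffD IH 1?ltnW // add0r.
    by have [-> //] := hF (e, ps e) (Ips e); rewrite neq_ltn he orbT.
  elim: d => // d IH; rewrite ltnS leq_eqVlt => /orP[/eqP <-|hd] /=.
    by rewrite mcoeffD lo // add0r.
  rewrite mcoeffD IH //; have [-> //] := hF (d, ps d) (Ips d).
    by rewrite addr0.
  by rewrite neq_ltn hd.
rewrite -(subrK (ev_gen (ps n)) (eval_series _ n)) -addrA; apply: ideal_expD.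
  by apply: eval_series_eq => mu hmu; rewrite mstruncE // Dps.
by rewrite -opprB; apply: ideal_expN.
Qed.

(** Series in generators of the maximal ideal represent all elements of the
    completion; only the kernel of the evaluation depends on the ring. *)
Lemma completion_criterion (f : {mpoly k[N]}) : ev_gen f = 0 ->
    (forall g, lim_eq A m (eval_series g) (fun=> 0) ->
       exists h, g = series_of_mpoly f * h) ->
  completion_iso A m c (series_of_mpoly f).
Proof.
move=> f0 ker; exists eval_series; split.
- exact: eval_series_coherent.
- split=> [x n|g h n|g h n]; last exact: eval_seriesM.
    by rewrite -ev_genC; apply: eval_series_mpoly.
  rewrite /eval_series -rmorphD; apply: eval_series_eq => mu hmu.
  by rewrite mcoeffD !mstruncE.
- exact: eval_series_surj.
move=> g; split=> [|[h ->] n]; first exact: ker.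
rewrite subr0 -[eval_series _ n](subrK (eval_series (series_of_mpoly f) n * eval_series h n)).
apply: ideal_expD; first exact: eval_seriesM.
rewrite mulrC; apply: ideal_expM; first exact: A_ev.
by have := eval_series_mpoly f n; rewrite f0 subr0.
Qed.

End CompletionCriterion.

Section Division.
Variable k : comNzRingType.
Local Notation S := (mseries 3 k).
Variable H : {mpoly k[3]}.
Definition weight2 (mu : 'X_{1..3}) := (mu 0%R + mu 1%R)%N.
Hypothesis H_supp : forall mu, H@_mu != 0 -> mu 2 = 0%N /\ (0 < weight2 mu)%N.
Let Z2 : 'X_{1..3} := (U_(2) *+ 2)%MM.

Lemma mscoefM_poly (p : {mpoly k[3]}) (g : S) d mu : (mdeg mu < d)%N ->
  mscoef (series_of_mpoly p * g) mu = (p * mstrunc d g)@_mu.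
Proof.
move=> hd; apply: msmul_mpoly => // mu' hmu'.
by rewrite mstruncE //; apply: leq_ltn_trans hmu' hd.
Qed.

Section Quotient.
Variable g : S.

Definition quo_step (q : S) : S := MSeries (fun mu =>
  mscoef g (mu + Z2)%MM - mscoef (series_of_mpoly H * q) (mu + Z2)%MM).

Lemma weight2Z mu : weight2 (mu + Z2)%MM = weight2 mu.
Proof. by rewrite /weight2 /Z2 !mnmDE ?mulmnE !mnm1E /= ?muln0 !addn0. Qed.

Lemma quo_step_contracts n q q' :
    (forall mu, (weight2 mu < n)%N -> mscoef q mu = mscoef q' mu) ->
  forall mu, (weight2 mu < n.+1)%N -> mscoef (quo_step q) mu = mscoef (quo_step q') mu.
Proof.
move=> h mu; rewrite ltnS /= => hmu; congr (_ - _).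
apply: eq_bigr => kk /eqP Dk; have [->|Hk] := eqVneq H@_kk.1 0; first by rewrite !mul0r.
have [_ wk] := H_supp Hk; congr (_ * _); apply: h.
apply: leq_trans hmu; rewrite -(weight2Z mu).
have -> : weight2 (mu + Z2)%MM = (weight2 kk.1 + weight2 kk.2)%N.
  rewrite (congr1 weight2 Dk) /weight2 !mnmDE.
  by rewrite !addnA [(_ + kk.1 1%R)%N]addnAC.
by rewrite -[X in (X < _)%N]add0n ltn_add2r.
Qed.

Definition quo_iter n := iter n quo_step 0.

Lemma quo_iter_stable n d mu : (weight2 mu < n)%N ->
  mscoef (quo_iter (n + d)) mu = mscoef (quo_iter n) mu.
Proof.
by elim: n mu => // n IH mu hmu; rewrite addSn; apply: (@quo_step_contracts n).
Qed.

Definition quo : S := MSeries (fun mu => mscoef (quo_iter (weight2 mu).+1) mu).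

Lemma quo_fix mu : mscoef (quo_step quo) mu = mscoef quo mu.
Proof.
apply: (@quo_step_contracts (weight2 mu) quo (quo_iter (weight2 mu))) => // nu hnu /=.
by rewrite -(subnKC hnu) quo_iter_stable.
Qed.

Lemma mscoef_Z2 (q : S) mu :
  mscoef (series_of_mpoly ('X_2 ^+ 2) * q) (mu + Z2)%MM = mscoef q mu.
Proof.
rewrite (mscoefM_poly _ _ (ltnSn _)) mulrC mpolyXn [X in _@_X]addmC mcoeffMX mstruncE //.
by rewrite mdegD ltnS leq_addr.
Qed.

Lemma series_mpolyD (p q : {mpoly k[3]}) :
  series_of_mpoly (p + q) = series_of_mpoly p + series_of_mpoly q.
Proof. by apply: mseriesP => mu; rewrite /= mcoeffD. Qed.

(** Weierstrass division by Z^2 + H, with H in the ideal generated by X and Y: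
    multiplication by H raises the degree in X and Y, so that the quotient is the
    limit of the iterates of [quo_step]. *)
Lemma weierstrass_division : exists q r : S,
  g = series_of_mpoly ('X_2 ^+ 2 + H) * q + r /\
  (forall mu : 'X_{1..3}, (1 < mu 2%R)%N -> mscoef r mu = 0).
Proof.
exists quo, (g - series_of_mpoly ('X_2 ^+ 2 + H) * quo); split.
  by rewrite addrC subrK.
move=> mu hmu.
have -> : mu = (mu - Z2 + Z2)%MM.
  rewrite submK //; apply/mnm_lepP => i; rewrite mulmnE mnm1E.
  by case: eqP => [<-|].
set nu := (mu - Z2)%MM; rewrite series_mpolyD mulrDl.
have := quo_fix nu; rewrite -(mscoef_Z2 quo nu) /= => /eqP.
rewrite subr_eq => /eqP ->.
by apply/eqP; rewrite subr_eq0.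
Qed.

End Quotient.
End Division.

Section LocalRingOfThePlane.
Variables (k : closedFieldType) (K : fieldType) (c : {rmorphism k -> K}).
Variable io : {rmorphism {mpoly k[2]} -> K}.
Hypothesis k2 : 2%N \in [pchar k].
Hypothesis ioC : forall x, io x%:MP = c x.
Hypothesis io_inj : forall p, io p = 0 -> p = 0.
Local Notation Pxy := {mpoly k[2]}.

Lemma order_ge1_sub (p : Pxy) : order_ge 1 (p - (p@_0%MM)%:MP).
Proof.
move=> m; rewrite ltnS leqn0 mdeg_eq0 => /eqP ->.
by rewrite mcoeffB mcoeffC eqxx mulr1 subrr.
Qed.

Lemma mcoeff0M (p q : Pxy) : (p * q)@_0%MM = p@_0%MM * q@_0%MM.
Proof.
have h : order_ge 1 (p * q - (p@_0%MM)%:MP * (q@_0%MM)%:MP).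
  have -> : p * q - (p@_0%MM)%:MP * (q@_0%MM)%:MP =
    (p - (p@_0%MM)%:MP) * q + (p@_0%MM)%:MP * (q - (q@_0%MM)%:MP) by ring.
  apply: order_geD; first exact: (order_geM (order_ge1_sub p) (order_ge0 q)).
  exact: (order_geM (order_ge0 _) (order_ge1_sub q)).
have := h 0%MM; rewrite mdeg0 => /(_ isT)/eqP.
by rewrite mcoeffB mcoeffCM mcoeffC eqxx mulr1 subr_eq0 => /eqP.
Qed.

Lemma order_unit n (p b : Pxy) : b@_0%MM != 0 -> order_ge n (p * b) -> order_ge n p.
Proof.
move=> b0 h; elim: n h => [|n IH] h //.
have hp : order_ge n p by apply: IH; apply: order_geW h.
move=> m; rewrite ltnS leq_eqVlt => /orP[/eqP mn|]; last exact: hp.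
have := h m; rewrite mn leqnn => /(_ isT).
have -> : p * b = p * (b - (b@_0%MM)%:MP) + (b@_0%MM)%:MP * p by ring.
rewrite mcoeffD (order_geM hp (order_ge1_sub b)) ?add0r; last by rewrite mn addn1.
by rewrite mcoeffCM => /eqP; rewrite mulf_eq0 (negPf b0) => /eqP.
Qed.

(** The powers of the maximal ideal of the local ring of the origin. *)
Definition in_power n (g : K) := exists p b : Pxy,
  [/\ b@_0%MM != 0, order_ge n p & g = io p / io b].
Notation O := (in_power 0).

Lemma io_neq0 (b : Pxy) : b@_0%MM != 0 -> io b != 0.
Proof.
by move=> b0; apply: contraNneq b0 => /io_inj ->; rewrite mcoeff0.
Qed.

Lemma in_power_io n p : order_ge n p -> in_power n (io p).
Proof.
move=> h; exists p, 1; split=> //; last by rewrite rmorph1 divr1.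
by rewrite mcoeff1 eqxx oner_neq0.
Qed.

Lemma in_power_ioE n p : in_power n (io p) -> order_ge n p.
Proof.
move=> [q [b [b0 hq /eqP]]]; rewrite eq_sym -[io p]divr1 -(rmorph1 io).
rewrite eqr_div ?io_neq0 ?mcoeff1 ?eqxx ?oner_neq0 // rmorph1 mulr1 -rmorphM.
rewrite -subr_eq0 -rmorphB => /eqP/io_inj/eqP; rewrite subr_eq0 => /eqP E.
by apply: (order_unit b0); rewrite -E.
Qed.

Lemma in_powerD n g h : in_power n g -> in_power n h -> in_power n (g + h).
Proof.
move=> [p [b [b0 hp ->]]] [q [d [d0 hq ->]]].
exists (p * d + q * b), (b * d); split.
- by rewrite mcoeff0M mulf_neq0.
- by apply: order_geD; rewrite -[n]addn0; apply: order_geM.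
- by rewrite addf_div ?io_neq0 // rmorphD !rmorphM.
Qed.

Lemma in_powerM n l g h : in_power n g -> in_power l h -> in_power (n + l) (g * h).
Proof.
move=> [p [b [b0 hp ->]]] [q [d [d0 hq ->]]].
exists (p * q), (b * d); split; first by rewrite mcoeff0M mulf_neq0.
  exact: order_geM.
by rewrite mulf_div !rmorphM.
Qed.

Lemma in_powerW n l g : (n <= l)%N -> in_power l g -> in_power n g.
Proof. by move=> nl [p [b [b0 h E]]]; exists p, b; split=> //; apply: order_geW h. Qed.

Lemma in_power_O n g : in_power n g -> O g.
Proof. exact: in_powerW. Qed.

Lemma in_powerMl n g h : O g -> in_power n h -> in_power n (g * h).
Proof. by move=> Og /(in_powerM Og). Qed.

Lemma in_powerC n : in_power n 0.
Proof. by rewrite -(rmorph0 io); apply: in_power_io => m _; rewrite mcoeff0. Qed.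

Lemma O_const x : O (c x).
Proof. by rewrite -ioC; apply: in_power_io. Qed.

Lemma in_powerN n g : in_power n g -> in_power n (- g).
Proof.
by move=> h; rewrite -mulN1r -(rmorph1 c) -rmorphN; apply: in_powerMl (O_const _) h.
Qed.

Lemma not_in_power1 : ~ in_power 1 1.
Proof.
rewrite -(rmorph1 io) => /in_power_ioE/(_ 0%MM); rewrite mdeg0 mcoeff1 eqxx.
by move/(_ isT)/eqP; rewrite oner_eq0.
Qed.

Lemma O_inv g : O g -> ~ in_power 1 g -> g != 0 /\ O g^-1.
Proof.
move=> [p [b [b0 _ ->]]] h.
have p0 : p@_0%MM != 0.
  apply: contra_notN h => /eqP p0; exists p, b; split=> // m.
  by rewrite ltnS leqn0 mdeg_eq0 => /eqP ->.
split; first by rewrite mulf_neq0 ?invr_eq0 ?io_neq0.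
by exists b, p; split=> //; rewrite invf_div.
Qed.

Lemma O_residue g : O g -> exists x, in_power 1 (g - c x).
Proof.
move=> [p [b [b0 _ ->]]]; exists (p@_0%MM / b@_0%MM).
exists (p - (p@_0%MM / b@_0%MM)%:MP * b), b; split=> //.
  move=> m; rewrite ltnS leqn0 mdeg_eq0 => /eqP ->.
  by rewrite mcoeffB mcoeffCM divfK // subrr.
by rewrite rmorphB (rmorphM io) ioC mulrBl mulfK // io_neq0.
Qed.

Lemma order_ge1_gen (p : Pxy) : order_ge 1 p -> exists q1 q2, p = 'X_0 * q1 + 'X_1 * q2.
Proof.
move=> hp; suff [q1 [q2 E]] : exists q1 q2, p - (p@_0%MM)%:MP = 'X_0 * q1 + 'X_1 * q2.
  by exists q1, q2; rewrite -E hp ?mdeg0 // mpolyC0 subr0.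
elim/mpoly_ring_ind: p {hp} => [x|i|p q [p1 [p2 Ep]] [q1 [q2 Eq]]|
                                 p q [p1 [p2 Ep]] [q1 [q2 Eq]]].
- by exists 0, 0; rewrite mcoeffC eqxx mulr1 subrr !mulr0 addr0.
- have -> : ('X_i : Pxy)@_0%MM = 0.
    rewrite mcoeffX; case: eqP => // /(congr1 mdeg).
    by rewrite mdeg1 mdeg0.
  rewrite mpolyC0 subr0; case: i => -[|[|//]] Hi.
    by exists 1, 0; rewrite mulr1 mulr0 addr0; congr 'X_ _; apply/val_inj.
  by exists 0, 1; rewrite mulr1 mulr0 add0r; congr 'X_ _; apply/val_inj.
- exists (p1 + q1), (p2 + q2); rewrite mcoeffD mpolyCD opprD addrACA Ep Eq; ring.
exists (p1 * q + (p@_0%MM)%:MP * q1), (p2 * q + (p@_0%MM)%:MP * q2).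
rewrite mcoeff0M mpolyCM.
have -> : p * q - (p@_0%MM)%:MP * (q@_0%MM)%:MP =
  (p - (p@_0%MM)%:MP) * q + (p@_0%MM)%:MP * (q - (q@_0%MM)%:MP) by ring.
by rewrite Ep Eq; ring.
Qed.

Lemma in_power1_gen g : in_power 1 g ->
  exists a b, [/\ O a, O b & g = a * io 'X_0 + b * io 'X_1].
Proof.
move=> [p [b [b0 /order_ge1_gen[q1 [q2 Dp]] ->]]].
exists (io q1 / io b), (io q2 / io b); split; [by exists q1, b|by exists q2, b|].
by rewrite Dp rmorphD !(rmorphM io) mulrDl ![_ / _ * _]mulrAC ![io 'X_ _ * _]mulrC.
Qed.

(** ** The ring generated by squares and one function *)

Variable f : Pxy.
Local Notation w := (io f).

Definition sqr_ring : set K := fun g => exists s t, [/\ O s, O t & g = s ^+ 2 + t ^+ 2 * w].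
Definition sqr_max : set K :=
  fun g => sqr_ring g /\ ~ (exists2 h, sqr_ring h & g * h = 1).

Let K2 : 2%N \in [pchar K] := rmorph_pchar c k2.

Lemma sqr_ring_O g : sqr_ring g -> O g.
Proof.
move=> [s [t [Os Ot ->]]]; apply: in_powerD; rewrite ?expr2; first exact: in_powerMl.
by apply: in_powerMl; [exact: in_powerMl | exact: in_power_io].
Qed.

Lemma sqr_ring_sqr s : O s -> sqr_ring (s ^+ 2).
Proof. by move=> Os; exists s, 0; split=> //; [exact: in_powerC | rewrite expr0n mul0r addr0]. Qed.

Lemma sqr_ring_w : sqr_ring w.
Proof.
exists 0, 1; split; [exact: in_powerC| |by rewrite expr0n add0r expr1n mul1r].
by rewrite -(rmorph1 c); apply: O_const.
Qed.

Lemma sqr_ringC x : sqr_ring (c x).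
Proof.
by rewrite -(sqrtkK x) rmorphXn; apply: sqr_ring_sqr; apply: O_const.
Qed.

Lemma sqr_ringD g h : sqr_ring g -> sqr_ring h -> sqr_ring (g + h).
Proof.
move=> [s [t [Os Ot ->]]] [s' [t' [Os' Ot' ->]]]; exists (s + s'), (t + t').
split; try exact: in_powerD.
by rewrite !sqrD2 // mulrDl addrACA.
Qed.

Lemma sqr_ringM g h : sqr_ring g -> sqr_ring h -> sqr_ring (g * h).
Proof.
move=> [s [t [Os Ot ->]]] [s' [t' [Os' Ot' ->]]].
exists (s * s' + t * t' * w), (s * t' + t * s'); split.
- apply: in_powerD; first exact: in_powerMl.
  by apply: in_powerMl; [exact: in_powerMl | exact: in_power_io].
- by apply: in_powerD; exact: in_powerMl.
- by rewrite !sqrD2 // !exprMn; move: (io f) => z; ring.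
Qed.

Lemma sqr_maxE g : sqr_max g <-> sqr_ring g /\ in_power 1 g.
Proof.
split=> [[Bg h]|[Bg mg]]; split=> //; last first.
  move=> [h Bh gh]; apply: not_in_power1; rewrite -gh mulrC.
  by apply: in_powerMl => //; apply: sqr_ring_O.
apply: contrapT => ng; have [g0 Og'] := O_inv (sqr_ring_O Bg) ng.
apply: h; exists (g * g^-1 ^+ 2); last by rewrite expr2 !mulrA mulfK // divff.
by apply: sqr_ringM => //; apply: sqr_ring_sqr.
Qed.

Lemma sqr_ring_residue : order_ge 1 f -> forall g, sqr_ring g ->
  exists x, sqr_max (g - c x).
Proof.
move=> hf g [s [t [Os Ot Dg]]]; have [x hx] := O_residue Os.
exists (x ^+ 2); apply/sqr_maxE.
have -> : g - c (x ^+ 2) = (s - c x) ^+ 2 + t ^+ 2 * w.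
  by rewrite Dg rmorphXn addrAC (sqrD2 K2) sqrrN (oppr_pchar2 K2).
split; first by exists (s - c x), t; split=> //; apply: in_power_O hx.
apply: in_powerD; first by rewrite expr2; exact: (in_powerMl (in_power_O hx) hx).
by rewrite mulrC; apply: (in_powerM (n := 1) (l := 0)); [exact: in_power_io | rewrite expr2; exact: in_powerMl].
Qed.

(** The term t^2 w has no constant term, hence neither has s^2. *)
Lemma sqr_max_rep : order_ge 1 f -> forall g, sqr_max g ->
  exists s t, [/\ in_power 1 s, O t & g = s ^+ 2 + t ^+ 2 * w].
Proof.
move=> hf g /sqr_maxE[[s [t [Os Ot Dg]]] mg]; exists s, t; split=> //.
apply: contrapT => ns; have [s0 Os'] := O_inv Os ns.
apply: not_in_power1.
have -> : 1 = (s^-1 * s^-1) * (g - t ^+ 2 * w).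
  by rewrite Dg addrK expr2 mulrACA mulVf // mulr1.
apply: in_powerMl; first exact: in_powerMl.
apply: in_powerD => //; apply: in_powerN; rewrite expr2.
by apply: in_powerMl; [exact: in_powerMl | exact: in_power_io].
Qed.

(** ** The regular case *)

(** The functions X and f are local coordinates, so that the ring is generated
    over the squares by f, and X^2 and f generate its maximal ideal. *)
Lemma sqr_ring_regular : order_ge 1 f ->
    (exists a b, [/\ O a, O b & io 'X_1 = a * io 'X_0 + b * w]) ->
  regular_local_ring sqr_ring sqr_max 2.
Proof.
move=> hf [a1 [b1 [Oa1 Ob1 E1]]].
have mX : in_power 1 (io 'X_0) by apply: in_power_io; apply: order_geX; rewrite mdeg1.
exists (fun i => if i == 0 then io 'X_0 ^+ 2 else w); split.
  move=> i; apply/sqr_maxE; case: ifP => _; last first.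
    by split; [exact: sqr_ring_w | exact: in_power_io].
  split; first by apply: sqr_ring_sqr; apply: in_power_O mX.
  by rewrite expr2; exact: (in_powerMl (in_power_O mX) mX).
move=> g /(sqr_max_rep hf)[s [t [ms Ot Dg]]].
have [a [b [Oa Ob Ds]]] := in_power1_gen ms.
pose a' := a + b * a1; pose b' := b * b1.
have Oa' : O a' by apply: in_powerD => //; apply: in_powerMl.
have Ob' : O b' by apply: in_powerMl.
have {}Ds : s = a' * io 'X_0 + b' * w by rewrite Ds E1 /a' /b' mulrDr mulrDl !mulrA addrA.
exists (fun i => if i == 0 then a' ^+ 2 else b' ^+ 2 * w + t ^+ 2); split.
  move=> i; case: ifP => _; first exact: sqr_ring_sqr.
  apply: sqr_ringD; last exact: sqr_ring_sqr.
  by apply: sqr_ringM; [exact: sqr_ring_sqr | exact: sqr_ring_w].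
rewrite !big_ord_recl big_ord0 /= addr0 Dg Ds sqrD2 // !exprMn.
by move: (io f) (io 'X_0) => z y; ring.
Qed.

End LocalRingOfThePlane.

(** ** Substitution *)

Section Substitution.
Variable k : comNzRingType.

Definition subst2 n (p q : {mpoly k[n]}) : {rmorphism {mpoly k[2]} -> {mpoly k[n]}} :=
  mmap (@mpolyC n k) (fun i : 'I_2 => if i == 0 then p else q).

Lemma subst2C n (p q : {mpoly k[n]}) x : subst2 p q x%:MP = x%:MP.
Proof. exact: mmapC. Qed.
Lemma subst2X n (p q : {mpoly k[n]}) i : subst2 p q 'X_i = if i == 0 then p else q.
Proof. exact: (etrans (mmapX _ _ _) (mmap1U _ _)). Qed.

Lemma mpolyX2 (m : 'X_{1..2}) : 'X_[m] = 'X_0 ^+ m 0 * 'X_1 ^+ m 1 :> {mpoly k[2]}.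
Proof.
rewrite mpolyXE_id !big_ord_recl big_ord0 mulr1.
by congr (_ * 'X_ _ ^+ m _); apply/val_inj.
Qed.

Lemma mpolyX3 (m : 'X_{1..3}) :
  'X_[m] = 'X_0 ^+ m 0 * 'X_1 ^+ m 1 * 'X_2 ^+ m 2 :> {mpoly k[3]}.
Proof.
rewrite mpolyXE_id !big_ord_recl big_ord0 mulr1 mulrA.
by congr (_ * 'X_ _ ^+ m _ * 'X_ _ ^+ m _); apply/val_inj.
Qed.

Lemma subst2_mon n (p q : {mpoly k[n]}) m : subst2 p q 'X_[m] = p ^+ m 0 * q ^+ m 1.
Proof. by rewrite mpolyX2 rmorphM !rmorphXn !subst2X. Qed.

(** A change of coordinates which is the identity to first order does not
    change the initial form. *)
Variables u v : {mpoly k[2]}.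
Hypotheses (hu : order_ge 2 (u - 'X_0)) (hv : order_ge 2 (v - 'X_1)).

Lemma order_exp (p : {mpoly k[2]}) e : order_ge 1 p -> order_ge e (p ^+ e).
Proof.
by move=> hp; elim: e => [|e IH] //; rewrite exprS; exact: (order_geM hp IH).
Qed.

Lemma order_exp_sub i (p : {mpoly k[2]}) e : order_ge 2 (p - 'X_i) ->
  order_ge e.+1 (p ^+ e - 'X_i ^+ e).
Proof.
move=> hp; have hX : order_ge 1 ('X_i : {mpoly k[2]}) by apply: order_geX; rewrite mdeg1.
have h1 : order_ge 1 p.
  by rewrite -(subrK 'X_i p); apply: order_geD => //; apply: order_geW hp.
elim: e => [|e IH]; first by rewrite subrr => m _; rewrite mcoeff0.
have -> : p ^+ e.+1 - 'X_i ^+ e.+1 = p * (p ^+ e - 'X_i ^+ e) + (p - 'X_i) * 'X_i ^+ e.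
  by rewrite !exprS; ring.
apply: order_geD; first exact: (order_geM h1 IH).
exact: (order_geM hp (order_exp (e := e) hX)).
Qed.

Lemma subst2_close d T : order_ge d T -> order_ge d.+1 (subst2 u v T - T).
Proof.
move=> hT; rewrite {1 2}(mpolyE T) rmorph_sum -sumrB big_seq; apply: order_ge_sum => m mT.
rewrite -mul_mpolyC rmorphM subst2C -mulrBr mul_mpolyC; apply: order_geZ.
apply: (@order_geW _ _ _ (m 0 + m 1).+1).
  have := order_ge_msupp hT mT; rewrite mdegE !big_ord_recl big_ord0 addn0 ltnS.
  by rewrite (_ : lift ord0 ord0 = 1) //; apply/val_inj.
rewrite subst2_mon mpolyX2.
have -> : u ^+ m 0 * v ^+ m 1 - 'X_0 ^+ m 0 * 'X_1 ^+ m 1 =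
  (u ^+ m 0 - 'X_0 ^+ m 0) * v ^+ m 1 + 'X_0 ^+ m 0 * (v ^+ m 1 - 'X_1 ^+ m 1) by ring.
have hX i : order_ge 1 ('X_i : {mpoly k[2]}) by apply: order_geX; rewrite mdeg1.
apply: order_geD.
  rewrite -addSn; apply: order_geM; first exact: order_exp_sub.
  apply: order_exp; rewrite -(subrK 'X_1 v); apply: order_geD => //.
  exact: order_geW hv.
by rewrite -addnS; apply: order_geM; [exact: order_exp | exact: order_exp_sub].
Qed.

Lemma subst2_order n T : order_ge n (subst2 u v T) -> order_ge n T.
Proof.
elim: n => [|n IH] h //.
have hT : order_ge n T by apply: IH; apply: order_geW h.
move=> m hm; rewrite -(subKr (subst2 u v T) T) mcoeffB h // (subst2_close hT) //.
by rewrite subrr.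
Qed.

End Substitution.

(** ** Rational double points *)

Section DoublePoint.
Variables (k : closedFieldType) (K : fieldType) (c : {rmorphism k -> K}).
Variable io : {rmorphism {mpoly k[2]} -> K}.
Hypothesis k2 : 2%N \in [pchar k].
Hypothesis ioC : forall x, io x%:MP = c x.
Hypothesis io_inj : forall p, io p = 0 -> p = 0.
Local Notation Pxy := {mpoly k[2]}.
Local Notation Pxyz := {mpoly k[3]}.
Local Notation O := (in_power io 0).

(* The equation is Z^2 + h(X, Y).  No monomial of h is a square, and the
   monomial mu0 of h is the only one in its class modulo squares. *)
Variables (h : Pxy) (mu0 : 'X_{1..2}).
Hypothesis h_bit : forall mu, h@_mu ^+ 2 = h@_mu.
Hypothesis h_odd : forall mu, h@_mu != 0 -> exists i, odd (mu i).
Hypothesis h_mu0 : h@_mu0 = 1.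
Hypothesis mu0_lt4 : (mdeg mu0 < 4)%N.
Hypothesis h_class : forall mu : 'X_{1..2}, (forall i, odd (mu i) = odd (mu0 i)) ->
  h@_mu != 0 -> mu = mu0.

Variables u v f : Pxy.
Hypotheses (hu : order_ge 2 (u - 'X_0)) (hv : order_ge 2 (v - 'X_1)).
Hypothesis uv_gen0 : exists a b, [/\ O a, O b & io 'X_0 = a * io u + b * io v].
Hypothesis uv_gen1 : exists a b, [/\ O a, O b & io 'X_1 = a * io u + b * io v].
Hypothesis fE : f = subst2 u v h.
Hypothesis hf : order_ge 2 f.

Local Notation B := (sqr_ring io f).
Local Notation m := (sqr_max io f).
Let K2 : 2%N \in [pchar K] := rmorph_pchar c k2.
Let p2xy : 2%N \in [pchar Pxy] := pchar2_mpoly 2 k2.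

Definition double_point_eq : Pxyz := 'X_2 ^+ 2 + subst2 'X_0 'X_1 h.

Definition gens (i : 'I_3) : K :=
  if i == 0 then io u ^+ 2 else if i == 1 then io v ^+ 2 else io f.

Let f1 : order_ge 1 f := order_geW (isT : 1 <= 2)%N hf.

Lemma order_ge1_u : order_ge 1 u.
Proof.
rewrite -(subrK 'X_0 u); apply: order_geD; first exact: order_geW hu.
by apply: order_geX; rewrite mdeg1.
Qed.
Lemma order_ge1_v : order_ge 1 v.
Proof.
rewrite -(subrK 'X_1 v); apply: order_geD; first exact: order_geW hv.
by apply: order_geX; rewrite mdeg1.
Qed.

Lemma in_power2_sqr g : in_power io 1 g -> in_power io 2 (g ^+ 2).
Proof. by move=> hg; rewrite expr2; exact: (in_powerM hg hg). Qed.

Lemma gens_power2 i : in_power io 2 (gens i).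
Proof.
rewrite /gens; case: ifP => _; last case: ifP => _; last exact: in_power_io.
  by apply: in_power2_sqr; apply: in_power_io; exact: order_ge1_u.
by apply: in_power2_sqr; apply: in_power_io; exact: order_ge1_v.
Qed.

Lemma gens_max i : m (gens i).
Proof.
apply/(sqr_maxE c k2 io_inj); split; last by apply: in_powerW (gens_power2 i).
rewrite /gens; case: ifP => _; last case: ifP => _; last exact: (sqr_ring_w ioC).
  by apply: sqr_ring_sqr => //; apply: in_power_io.
by apply: sqr_ring_sqr => //; apply: in_power_io.
Qed.

Lemma max_gen g : m g -> exists b : 'I_3 -> K,
  (forall i, B (b i)) /\ g = \sum_i b i * gens i.
Proof.
move=> /(sqr_max_rep k2 ioC io_inj f1)[s [t [ms Ot Dg]]].
have [a [b [Oa Ob Ds]]] := in_power1_gen ms.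
have [a0 [b0 [Oa0 Ob0 E0]]] := uv_gen0; have [a1 [b1 [Oa1 Ob1 E1]]] := uv_gen1.
pose p := a * a0 + b * a1; pose q := a * b0 + b * b1.
have OM x y : O x -> O y -> O (x * y) by exact: in_powerM.
have Op : O p by apply: (in_powerD io_inj); apply: OM.
have Oq : O q by apply: (in_powerD io_inj); apply: OM.
exists (fun i => if i == 0 then p ^+ 2 else if i == 1 then q ^+ 2 else t ^+ 2); split.
  by move=> i; case: ifP => _; last case: ifP => _; apply: sqr_ring_sqr.
rewrite !big_ord_recl big_ord0 /= addr0 Dg.
have -> : s = p * io u + q * io v.
  by rewrite Ds E0 E1 /p /q; move: (io u) (io v) => x y; ring.
by rewrite (sqrD2 K2) !exprMn addrA.
Qed.

Let AC x : B (c x). Proof. exact: (sqr_ringC ioC). Qed.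
Let AD x y : B x -> B y -> B (x + y). Proof. exact: (sqr_ringD c k2 io_inj). Qed.
Let AM x y : B x -> B y -> B (x * y). Proof. exact: (sqr_ringM c k2 io_inj). Qed.
Let mA x : m x -> B x. Proof. by case. Qed.
Let res x : B x -> exists y, m (x - c y).
Proof. exact: (sqr_ring_residue k2 ioC io_inj f1). Qed.

Local Notation ev := (ev_gen c gens).

(** The generators are the values at (u, v) of X^2, Y^2, h. *)
Definition pull : {rmorphism Pxyz -> Pxy} :=
  mmap (@mpolyC 2 k) (fun i : 'I_3 =>
    if i == 0 then 'X_0 ^+ 2 else if i == 1 then 'X_1 ^+ 2 else h).

Lemma pullC x : pull x%:MP = x%:MP. Proof. exact: mmapC. Qed.
Lemma pullX i : pull 'X_i =
  if i == 0 then 'X_0 ^+ 2 else if i == 1 then 'X_1 ^+ 2 else h.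
Proof. exact: (etrans (mmapX _ _ _) (mmap1U _ _)). Qed.

Lemma ev_pull p : ev p = io (subst2 u v (pull p)).
Proof.
elim/mpoly_ring_ind: p => [x|i|p q Ep Eq|p q Ep Eq].
- by rewrite ev_genC pullC subst2C ioC.
- rewrite ev_genX pullX /gens; case: ifP => _; last case: ifP => _.
  + by rewrite rmorphXn subst2X rmorphXn.
  + by rewrite rmorphXn subst2X rmorphXn.
  + by rewrite fE.
- by rewrite !rmorphD Ep Eq.
- by rewrite !rmorphM Ep Eq.
Qed.

Lemma pull_double_point : pull double_point_eq = 0.
Proof.
rewrite rmorphD rmorphXn pullX /=.
suff -> : pull (subst2 'X_0 'X_1 h) = h ^+ 2 by rewrite addrr_pchar2.
rewrite [in RHS](mpolyE h) (sqr_sum2 p2xy) {1}(mpolyE h).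
rewrite (rmorph_sum (subst2 'X_0 'X_1)) (rmorph_sum pull).
apply: eq_bigr => mu _; rewrite -mul_mpolyC (rmorphM (subst2 'X_0 'X_1)) (rmorphM pull).
rewrite subst2C pullC exprMn.
rewrite -rmorphXn h_bit subst2_mon rmorphM !rmorphXn !pullX /= (mpolyX2 k mu).
by rewrite [X in _ = _ * X]exprMn; congr (_ * (_ * _)); exact: exprAC.
Qed.

Lemma ev_double_point : ev double_point_eq = 0.
Proof. by rewrite ev_pull pull_double_point !rmorph0. Qed.

Lemma ideal_exp_power n g : ideal_exp B m n g -> in_power io n g.
Proof.
elim: n g => [|n IH] g; first exact: (sqr_ring_O io_inj).
move=> [s [hs ->]]; rewrite big_seq; apply: (big_ind (in_power io n.+1)).
- exact: in_powerC.
- by move=> x y; apply: in_powerD.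
move=> z /hs[/(sqr_maxE c k2 io_inj)[_ mz] /IH Iz].
exact: (in_powerM mz Iz).
Qed.

(** The exponents of the squares X^(2a) Y^(2b). *)
Definition dbl (a b : nat) : 'X_{1..2} := (U_(0%R) *+ a.*2 + U_(1%R) *+ b.*2)%MM.
Definition mnm3 (a b e : nat) : 'X_{1..3} :=
  (U_(0%R) *+ a + U_(1%R) *+ b + U_(2%R) *+ e)%MM.

Lemma dblE a b : dbl a b 0 = a.*2 /\ dbl a b 1 = b.*2.
Proof. by rewrite /dbl !mnmDE !mulmnE !mnm1E /= !mul1n !mul0n addn0. Qed.

Lemma mnm3E a b e : [/\ mnm3 a b e 0 = a, mnm3 a b e 1 = b & mnm3 a b e 2 = e].
Proof. by rewrite /mnm3 !mnmDE !mulmnE !mnm1E /= !mul1n !mul0n !addn0. Qed.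

Lemma mnm2P (x y : 'X_{1..2}) : x 0 = y 0 -> x 1 = y 1 -> x = y.
Proof.
move=> e0 e1; apply/mnmP; case=> -[|[|//]] Hi.
  by rewrite (_ : Ordinal Hi = 0) //; apply/val_inj.
by rewrite (_ : Ordinal Hi = 1) //; apply/val_inj.
Qed.

Lemma mnm3K (x : 'X_{1..3}) : x = mnm3 (x 0) (x 1) (x 2).
Proof.
have [e0 e1 e2] := mnm3E (x 0) (x 1) (x 2).
apply/mnmP; case=> -[|[|[|//]]] Hi.
- by rewrite (_ : Ordinal Hi = 0) //; apply/val_inj.
- by rewrite (_ : Ordinal Hi = 1) //; apply/val_inj.
- by rewrite (_ : Ordinal Hi = 2) //; apply/val_inj.
Qed.

Lemma pull_mon (x : 'X_{1..3}) : pull 'X_[x] = 'X_[dbl (x 0) (x 1)] * h ^+ x 2.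
Proof.
rewrite mpolyX3 !rmorphM !rmorphXn !pullX /=; congr (_ * _).
rewrite (mpolyX2 k (dbl _ _)); have [-> ->] := dblE (x 0) (x 1).
by rewrite -!exprM !mul2n.
Qed.

Lemma mcoeff_monM (x nu : 'X_{1..2}) (p : Pxy) :
  ('X_[x] * p)@_nu = if (x <= nu)%MM then p@_(nu - x) else 0.
Proof.
case: ifP => hx; first by rewrite -{1}(submK hx) addmC mulrC mcoeffMX.
rewrite mcoeffM big1 // => kk /eqP Dk; rewrite mcoeffX.
case: eqP => [E|]; last by rewrite mul0r.
move: hx; have -> : (x <= nu)%MM; last by [].
by rewrite E (congr1 (fun y => (kk.1 <= y)%MM) Dk) lem_addr.
Qed.

Lemma odd_mu0 : exists i, odd (mu0 i).
Proof. by apply: h_odd; rewrite h_mu0 oner_neq0. Qed.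

Lemma dbl_even a b i : odd (dbl a b i) = false.
Proof.
have [e0 e1] := dblE a b; case: i => -[|[|//]] Hi.
  by rewrite (_ : Ordinal Hi = 0) ?e0 ?odd_double //; apply/val_inj.
by rewrite (_ : Ordinal Hi = 1) ?e1 ?odd_double //; apply/val_inj.
Qed.

Lemma dbl_inj a b a' b' : dbl a b = dbl a' b' -> a = a' /\ b = b'.
Proof.
have [e0 e1] := dblE a b; have [e0' e1'] := dblE a' b'.
move=> E; split; apply: double_inj; first by rewrite -e0 -e0' E.
by rewrite -e1 -e1' E.
Qed.

(** The coefficients of a series without monomials divisible by Z^2 can be read
    off from its pull-back: those without Z at the monomials that are squares,
    the others at the class of mu0. *)
Lemma pull_mon_coef (x : 'X_{1..3}) a b e : (x 2%R <= 1)%N -> (e <= 1)%N ->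
  (pull 'X_[x])@_(dbl a b + (mu0 *+ e))%MM = (x == mnm3 a b e)%:R.
Proof.
move=> hx he; rewrite pull_mon; set nu := (_ + _)%MM; set xx := dbl (x 0) (x 1).
have x3 e' : x 2 = e' -> (x == mnm3 a b e') = (xx == dbl a b).
  move=> x2; rewrite /xx; apply/eqP/eqP => [->|/dbl_inj[ea eb]].
    by have [-> ->] := mnm3E a b e'.
  by rewrite (mnm3K x) ea eb x2.
have x3' : x 2 != e -> (x == mnm3 a b e) = false.
  by apply: contraNF => /eqP ->; have [_ _ ->] := mnm3E a b e.
have oddnu i : odd (nu i) = (e == 1)%N && odd (mu0 i).
  rewrite mnmDE oddD dbl_even mulmnE oddM.
  by case: e he {nu x3'} => [|[|//]] _ //=; rewrite ?andbF ?andbT.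
have [e0|e1] : e = 0%N \/ e = 1%N.
- by case: (e) he => [|[|//]] _; [left | right].
- have nu0 : nu = dbl a b by rewrite /nu e0 mulm0n addm0.
  case x2: (x 2) hx => [|[|//]] _.
    by rewrite expr0 mulr1 mcoeffX e0 x3 // nu0.
  rewrite x3' ?x2 ?e0 // expr1 mcoeff_monM; case: ifP => // hle.
  have [//|/h_odd[i]] := eqVneq h@_(nu - xx)%MM 0.
  have : odd (nu i) = odd ((nu - xx)%MM i).
    by rewrite -{1}(submK hle) mnmDE oddD dbl_even addbF.
  by move=> <-; rewrite oddnu e0.
have nu1 : nu = (dbl a b + mu0)%MM by rewrite /nu e1 mulm1n.
case x2: (x 2) hx => [|[|//]] _.
  rewrite x3' ?x2 ?e1 // expr0 mulr1 mcoeffX; case: eqP => // E.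
  by have [i oi] := odd_mu0; have := oddnu i; rewrite -E /xx dbl_even oi e1.
rewrite expr1 mcoeff_monM e1 x3 //; have [E|E] := eqVneq xx (dbl a b).
  by rewrite nu1 E lem_addr addmC addmK h_mu0.
case: ifP => // hle; have [//|hn] := eqVneq h@_(nu - xx)%MM 0.
have E2 : (nu - xx)%MM = mu0.
  apply: h_class hn => i; have := oddnu i; rewrite e1 /= => <-.
  by rewrite -{2}(submK hle) mnmDE oddD dbl_even addbF.
by move: (submK hle); rewrite E2 nu1 addmC => /addIm/eqP; rewrite (negPf E).
Qed.

Lemma pull_coef p a b e : (forall x, x \in msupp p -> (x 2%R <= 1)%N) -> (e <= 1)%N ->
  (pull p)@_(dbl a b + (mu0 *+ e))%MM = p@_(mnm3 a b e).
Proof.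
move=> hp he; rewrite {1}(mpolyE p) (rmorph_sum pull) [in RHS](mpolyE p).
rewrite !(raddf_sum (mcoeff _)); apply: eq_big_seq => x /hp hx /=.
by rewrite -mul_mpolyC rmorphM pullC !mcoeffCM pull_mon_coef // mcoeffX.
Qed.

Lemma equation_supp (mu : 'X_{1..3}) : (subst2 'X_0 'X_1 h : Pxyz)@_mu != 0 ->
  mu 2 = 0%N /\ (0 < weight2 mu)%N.
Proof.
move=> hmu; have [x xh Dmu] : exists2 x, x \in msupp h & mu = mnm3 (x 0) (x 1) 0.
  apply: contrapT => no; case/eqP: hmu.
  rewrite (mpolyE h) (rmorph_sum (subst2 'X_0 'X_1)) (raddf_sum (mcoeff mu)).
  rewrite big1_seq // => x /andP[_ xh].
  rewrite -mul_mpolyC (rmorphM (subst2 'X_0 'X_1)) subst2C /= mcoeffCM subst2_mon.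
  have [e0 e1 e2] := mnm3E (x 0) (x 1) 0.
  have -> : 'X_0 ^+ x 0 * 'X_1 ^+ x 1 = 'X_[mnm3 (x 0) (x 1) 0] :> Pxyz.
    by rewrite (mpolyX3 k (mnm3 _ _ _)) e0 e1 e2 expr0 mulr1.
  rewrite mcoeffX; case: eqP => [E|]; last by rewrite mulr0.
  by case: no; exists x.
have [e0 e1 e2] := mnm3E (x 0) (x 1) 0; rewrite Dmu e2; split=> //.
rewrite /weight2 e0 e1 lt0n; move: xh; rewrite mcoeff_msupp => /h_odd[i].
apply: contraL => /eqP; case: i => -[|[|//]] Hi /eqP; rewrite addn_eq0 => /andP[/eqP x0 /eqP x1].
  by rewrite (_ : Ordinal Hi = 0) ?x0 //; apply/val_inj.
by rewrite (_ : Ordinal Hi = 1) ?x1 //; apply/val_inj.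
Qed.

Local Notation I := (ideal_exp B m).

(** The remainder of the division by the equation contains no Z^2.  It vanishes
    to any order on the generators, so its coefficients, which are coefficients
    of its pull-back, are zero. *)
Lemma equation_kernel g : lim_eq B m (eval_series c gens g) (fun=> 0) ->
  exists q, g = series_of_mpoly double_point_eq * q.
Proof.
move=> hg; have [q [r [Dg hr]]] := weierstrass_division equation_supp g.
exists q; suff r0 : r = 0 by rewrite {1}Dg r0 addr0.
have Ir n : I n (ev (mstrunc n r)).
  have h1 := eval_series_eq AC AD AM mA gens_max
    (n := n) (p := mstrunc n r)
    (q := mstrunc n g - mstrunc n (series_of_mpoly double_point_eq) * mstrunc n q).
  have h2 : I n (eval_series c gens (series_of_mpoly double_point_eq) n).
    have := eval_series_mpoly AC AD AM mA gens_max double_point_eq n.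
    by rewrite ev_double_point subr0.
  rewrite -(subrK (ev (mstrunc n g - mstrunc n (series_of_mpoly double_point_eq) *
                                     mstrunc n q)) (ev (mstrunc n r))).
  apply: (ideal_expD AD).
    apply: h1 => mu hmu; rewrite mcoeffB !mstruncE // -mstrunc_mul //.
    by rewrite {1}Dg /= addrAC subrr add0r.
  rewrite rmorphB rmorphM; apply: (ideal_expD AD).
    by have := hg n; rewrite subr0.
  apply: (ideal_expN AC AM); rewrite mulrC; apply: (ideal_expM AM) h2.
  exact: (A_ev AC AD AM mA gens_max).
apply: mseriesP => mu /=; have [mu2|mu2] := ltnP 1 (mu 2); first exact: hr.
pose nu := (dbl (mu 0%R) (mu 1%R) + (mu0 *+ (mu 2%R)))%MM.
pose n := (mdeg nu + mdeg mu).+1.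
have hn : order_ge n (pull (mstrunc n r)).
  apply: (subst2_order hu hv); apply: (in_power_ioE io_inj); rewrite -ev_pull.
  exact: ideal_exp_power (Ir n).
have := hn nu; rewrite ltnS leq_addr => /(_ isT).
rewrite pull_coef // -?mnm3K => [|x].
  by rewrite mstruncE // ltnS leq_addl.
rewrite mcoeff_msupp leqNgt; apply: contra_neqN => hx.
have [hd|hd] := ltnP (mdeg x) n; first by rewrite mstruncE // hr.
rewrite (raddf_sum (mcoeff x)) big1 //= => y _; rewrite mcoeffZ mcoeffX.
case: eqP => [E|]; last by rewrite mulr0.
by move: hd; rewrite -E leqNgt (valP y).
Qed.

(** The equation vanishes on the generators because h has coefficients in the
    field with two elements, so that h(X^2, Y^2) = h(X, Y)^2. *)
Lemma double_point_completion : completion_iso B m c (series_of_mpoly double_point_eq).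
Proof.
apply: (completion_criterion AC AD AM mA gens_max max_gen res ev_double_point).
exact: equation_kernel.
Qed.

(** The three generators are independent modulo the square of the maximal
    ideal, since the latter consists of functions of order four. *)
Lemma gens_independent (y : 'I_3 -> k) :
  in_power io 4 (\sum_i c (y i) * gens i) -> forall i, y i = 0.
Proof.
pose p : Pxyz := \sum_i y i *: 'X_i.
have -> : \sum_i c (y i) * gens i = ev p.
  rewrite rmorph_sum; apply: eq_bigr => i _.
  by rewrite -mul_mpolyC rmorphM ev_genC ev_genX.
rewrite ev_pull => /(in_power_ioE io_inj)/(subst2_order hu hv) h4.
have pE (i : 'I_3) : p@_U_(i) = y i.
  rewrite raddf_sum (bigD1 i) //= mcoeffZ mcoeffX eqxx mulr1 big1 ?addr0 // => j ji.
  rewrite mcoeffZ mcoeffX; case: eqP => [/mnmP/(_ i)|]; last by rewrite mulr0.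
  by rewrite !mnm1E eqxx (negPf ji).
have p2 x : x \in msupp p -> (x 2%R <= 1)%N.
  rewrite mcoeff_msupp leqNgt; apply: contra_neqN => hx.
  rewrite raddf_sum big1 //= => j _; rewrite mcoeffZ mcoeffX.
  case: eqP => [E|]; last by rewrite mulr0.
  by move: hx; rewrite -E mnm1E; case: (_ == _).
have U a b e : (e <= 1)%N -> (mdeg (dbl a b + (mu0 *+ e))%MM < 4)%N -> p@_(mnm3 a b e) = 0.
  by move=> he hd; rewrite -pull_coef // h4.
have dU a b : mdeg (dbl a b) = (a.*2 + b.*2)%N.
  by rewrite mdegD !mdegMn !mdeg1 !mul1n.
move=> i; rewrite -pE (mnm3K U_(i)%MM) !mnm1E.
case: i => -[|[|[|//]]] Hi; apply: U; rewrite // mdegD dU mdegMn /= ?muln0 //.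
by rewrite muln1 add0n.
Qed.

(** Two generators of the maximal ideal would factor the identity of the
    three-dimensional space spanned by [gens] modulo functions of order four. *)
Lemma double_point_singular : ~ regular_local_ring B m 2.
Proof.
move=> [a [ma ha]].
have [b Hb] := choice (fun j => ha _ (gens_max j)).
have [d Hd] := choice (fun i => max_gen (ma i)).
have [yb Hyb] := choice (fun ji : 'I_3 * 'I_2 => res ((Hb ji.1).1 ji.2)).
have [yd Hyd] := choice (fun ij : 'I_2 * 'I_3 => res ((Hd ij.1).1 ij.2)).
have m2 g : m g -> in_power io 2 g.
  move=> /max_gen[e [Be ->]]; apply: (big_ind (in_power io 2)).
  - exact: in_powerC.
  - by move=> x y; apply: in_powerD.
  move=> i _; apply: in_powerMl (gens_power2 i).
  exact: (sqr_ring_O io_inj (Be i)).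
have OB x : B x -> O x := sqr_ring_O io_inj (g := x).
pose N1 : 'M[k]_(3, 2) := \matrix_(j, i) yb (j, i).
pose N2 : 'M[k]_(2, 3) := \matrix_(i, j) yd (i, j).
have N12 : N1 *m N2 = 1%:M.
  apply/matrixP => j l.
  apply/eqP; rewrite -subr_eq0; apply/eqP; move: l.
  apply: (@gens_independent (fun l => (N1 *m N2) j l - 1%:M j l)).
  have -> : \sum_l c ((N1 *m N2) j l - 1%:M j l) * gens l =
      \sum_i c (yb (j, i)) * (\sum_l c (yd (i, l)) * gens l) - gens j.
    under eq_bigr => l _ do rewrite rmorphB mulrBl.
    rewrite sumrB; congr (_ - _); last first.
      rewrite (bigD1 j) //= mxE eqxx rmorph1 mul1r big1 ?addr0 // => l lj.
      by rewrite mxE eq_sym (negPf lj) rmorph0 mul0r.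
    under [RHS]eq_bigr => i _ do rewrite mulr_sumr.
    rewrite exchange_big; apply: eq_bigr => l _ /=.
    rewrite mxE rmorph_sum mulr_suml; apply: eq_bigr => i _.
    by rewrite !mxE rmorphM mulrA.
  rewrite (Hb j).2 -sumrB; apply: (big_ind (in_power io 4)).
  - exact: in_powerC.
  - by move=> x y; apply: in_powerD.
  move=> i _.
  have e1 : in_power io 4 (c (yb (j, i)) * (\sum_l c (yd (i, l)) * gens l - a i)).
    apply: in_powerMl; first exact: (O_const ioC).
    rewrite (Hd i).2 -sumrB; apply: (big_ind (in_power io 4)).
    - exact: in_powerC.
    - by move=> x y; apply: in_powerD.
    move=> l _; rewrite -mulrBl; apply: (in_powerM (n := 2) (l := 2)); last exact: gens_power2.
    by rewrite -opprB; apply: (in_powerN ioC); apply: m2; exact: (Hyd (i, l)).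
  have e2 : in_power io 4 ((c (yb (j, i)) - b j i) * a i).
    apply: (in_powerM (n := 2) (l := 2)); last exact: m2 (ma i).
    by rewrite -opprB; apply: (in_powerN ioC); apply: m2; exact: (Hyb (j, i)).
  have := in_powerD io_inj e1 e2; congr in_power.
  by rewrite mulrBr mulrBl addrA subrK.
have := mxrankM_maxl N1 N2; rewrite N12 mxrank1 => h3.
by have := leq_trans h3 (rank_leq_col N1).
Qed.

End DoublePoint.

(** * Frobenius-semilinear maps *)

Section Semilinear.
Variables (k : closedFieldType) (n : nat) (m : 'M[k]_n).
Hypothesis k2 : 2%N \in [pchar k].

Definition frobx (p q : nat) (x : 'M[k]_(p, q)) := map_mx (fun a => a ^+ 2) x.
(** Each row x of the argument is mapped to x^(2) m. *)
Definition semilin (p : nat) (x : 'M[k]_(p, n)) := frobx x *m m.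
Local Notation phi := semilin.

Lemma frobxD p q (x y : 'M[k]_(p, q)) : frobx (x + y) = frobx x + frobx y.
Proof. by apply/matrixP => i j; rewrite !mxE sqrD2. Qed.
Lemma frobxZ p q a (x : 'M[k]_(p, q)) : frobx (a *: x) = a ^+ 2 *: frobx x.
Proof. by apply/matrixP => i j; rewrite !mxE exprMn. Qed.
Lemma frobxM p q r (x : 'M[k]_(p, q)) (y : 'M[k]_(q, r)) :
  frobx (x *m y) = frobx x *m frobx y.
Proof.
apply/matrixP => i j; rewrite !mxE sqr_sum2 //; apply: eq_bigr => l _.
by rewrite !mxE exprMn.
Qed.

Lemma semilinD p (x y : 'M[k]_(p, n)) : phi (x + y) = phi x + phi y.
Proof. by rewrite /semilin frobxD mulmxDl. Qed.
Lemma semilinZ p a (x : 'M[k]_(p, n)) : phi (a *: x) = a ^+ 2 *: phi x.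
Proof. by rewrite /semilin frobxZ scalemxAl. Qed.
Lemma semilinM p q (y : 'M[k]_(p, q)) (x : 'M[k]_(q, n)) :
  phi (y *m x) = frobx y *m phi x.
Proof. by rewrite /semilin frobxM mulmxA. Qed.
Lemma semilin0 p : phi (0 : 'M_(p, n)) = 0.
Proof.
rewrite /semilin (_ : frobx 0 = 0) ?mul0mx //.
by apply/matrixP => i j; rewrite !mxE expr0n.
Qed.
Lemma semilin_sum I (r : seq I) (E : I -> 'rV[k]_n) :
  phi (\sum_(i <- r) E i) = \sum_(i <- r) phi (E i).
Proof. exact: (big_morph (@semilin 1) (@semilinD 1) (@semilin0 1)). Qed.

Lemma frobx_surj p q (y : 'M[k]_(p, q)) : exists x, frobx x = y.
Proof.
by exists (map_mx (@sqrtk k) y); apply/matrixP => i j; rewrite !mxE sqrtkK.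
Qed.

Lemma addmx2 p q (x : 'M[k]_(p, q)) : x + x = 0.
Proof. by apply/matrixP => i j; rewrite !mxE addrr_pchar2. Qed.

Section Extension.
Variables (s : nat) (F : 'M[k]_(s, n)).
Hypothesis fixF : phi F = F.

Lemma semilin_sub (x : 'rV[k]_n) : (x <= F)%MS -> (phi x <= F)%MS.
Proof. by move=> /submxP[y ->]; rewrite semilinM fixF submxMl. Qed.

(** Every entry is obtained from an equation b^2 + b = a. *)
Lemma artin_schreier p q (y : 'M[k]_(p, q)) : exists x, frobx x + x = y.
Proof.
have h a : exists b : k, b ^+ 2 + b == a.
  have /closed_rootP[b] : size ('X^2 + ('X - a%:P)) != 1%N.
    by rewrite size_polyDl ?size_polyXn // size_XsubC.
  rewrite rootE !hornerE => /eqP E; exists b.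
  by apply/eqP; apply: subr0_eq; exact E.
exists (\matrix_(i, j) xchoose (h (y i j))); apply/matrixP => i j; rewrite !mxE.
exact/eqP/(xchooseP (h (y i j))).
Qed.

Variable v : 'rV[k]_n.
Local Notation orb i := (iter i (@semilin 1) v).

Fixpoint orbit_span d : 'M[k]_n :=
  if d is d'.+1 then (orbit_span d' + orb d')%MS else <<F>>%MS.

Lemma orbit_spanP d (x : 'rV[k]_n) : (x <= orbit_span d)%MS ->
  exists (c : nat -> k) (z : 'rV[k]_n), (z <= F)%MS /\ x = \sum_(i < d) c i *: orb i + z.
elim: d x => [|d IH] x /=.
  by rewrite genmxE => xF; exists (fun=> 0), x; rewrite big_ord0 add0r.
move=> /sub_addsmxP[[y1 y2] /= ->].
have [c [z [zF E]]] := IH _ (submxMl y1 (orbit_span d)).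
exists (fun i => if i == d then y2 0 0 else c i), z; split=> //.
rewrite big_ord_recr /= eqxx E addrAC; congr (_ + _ + _).
  by apply: eq_bigr => i _; rewrite ltn_eqF.
by rewrite [y2]mx11_scalar mul_scalar_mx mxE eqxx mulr1n.
Qed.

Lemma orbit_span_F d (z : 'rV[k]_n) : (z <= F)%MS -> (z <= orbit_span d)%MS.
Proof.
move=> zF; elim: d => [|d IH] /=; first by rewrite genmxE.
exact: submx_trans IH (addsmxSl _ _).
Qed.

Lemma orbit_span_orb d i : (i < d)%N -> (orb i <= orbit_span d)%MS.
Proof.
elim: d => // d IH; rewrite ltnS leq_eqVlt /= => /orP[/eqP ->|/IH h].
  exact: addsmxSr.
exact: submx_trans h (addsmxSl _ _).
Qed.

(** The value of [root_poly c i] at t, multiplied by t^2, is the i-th coordinate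
    of a fixed vector whose last coordinate is t. *)
Fixpoint root_poly (c : nat -> k) (i : nat) : {poly k} :=
  if i is i'.+1 then ('X * root_poly c i') ^+ 2 + (c i)%:P else (c 0%N)%:P.

Lemma size_Xmul (p : {poly k}) : p != 0 -> (1 < size ('X * p)%R)%N.
Proof. by move=> p0; rewrite mulrC size_mulX // ltnS size_poly_gt0. Qed.

Lemma root_poly_neq0 c e i : (i <= e)%N -> c i != 0 -> root_poly c e != 0.
Proof.
elim: e i => [|e IH] i.
  by rewrite leqn0 => /eqP -> /= c0; rewrite polyC_eq0.
move=> ie ci /=; have [E|E] := eqVneq (root_poly c e) 0.
  move: ie; rewrite leq_eqVlt => /orP[/eqP <-|ie]; last first.
    by have := IH i ie ci; rewrite E eqxx.
  by rewrite E mulr0 expr0n add0r polyC_eq0.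
have hs := size_Xmul E; have X0 : 'X * root_poly c e != 0.
  by rewrite -size_poly_gt0 ltnW.
rewrite -size_poly_gt0 size_polyDl expr2 size_mul //.
  by move: hs; case: (size _) => [|[|z]] // _; rewrite addSn addnS.
apply: leq_ltn_trans (size_polyC_leq1 _) _.
by move: hs; case: (size _) => [|[|z]] // _; rewrite addSn addnS.
Qed.

Lemma root_poly_root c e i : (i <= e)%N -> c i != 0 ->
  exists2 t, t != 0 & t * (root_poly c e).[t] = 1.
Proof.
move=> ie ci; have r0 := root_poly_neq0 ie ci; have hs := size_Xmul r0.
have /closed_rootP[t] : size ('X * root_poly c e - 1) != 1%N.
  rewrite size_polyDl ?size_polyN ?size_poly1 //.
  by rewrite neq_ltn hs orbT.
rewrite rootE !hornerE subr_eq0 => /eqP E; exists t => //.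
by apply: contra_eq_neq E => ->; rewrite mul0r eq_sym oner_neq0.
Qed.

(** On the span of the orbit of v, either a high power of the map takes values
    in F, or the relation satisfied by the orbit gives a new fixed vector. *)
Lemma fixed_or_nilpotent : row_free F ->
  (exists w : 'rV[k]_n, phi w = w /\ ~~ (w <= F)%MS) \/ (orb (n - s) <= F)%MS.
Proof.
move=> freeF.
have ex_d : exists d, (d <= n - s)%N && (orb d <= orbit_span d)%MS.
  apply: contrapT => no.
  have rk d : (d <= (n - s).+1)%N -> (s + d <= \rank (orbit_span d))%N.
    elim: d => [|d IH] hd /=; first by rewrite addn0 genmxE (eqP freeF).
    rewrite addnS; apply: leq_ltn_trans (IH (ltnW hd)) _; apply: rank_ltmx.
    rewrite /ltmx addsmxSl addsmx_sub submx_refl /=; apply/negP => vd.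
    by apply: no; exists d; rewrite -ltnS hd vd.
  have := leq_trans (rk _ (leqnn _)) (rank_leq_col _).
  have sn : (s <= n)%N by rewrite -(eqP freeF) rank_leq_col.
  by rewrite addnS subnKC // ltnn.
case: (ex_minnP ex_d) => d /andP[dn vd] dmin {ex_d}.
have [c [z [zF Ed]]] := orbit_spanP vd.
have [[i [id ci]]|no] := pselect (exists i, (i < d)%N /\ c i != 0); last first.
  right; have : (orb d <= F)%MS.
    rewrite Ed big1 ?add0r // => i _; have [->|ci] := eqVneq (c i) 0.
      by rewrite scale0r.
    by case: no; exists i.
  by rewrite -(subnK dn); elim: (n - s - d)%N => // e IH /IH /semilin_sub.
left; case: d dn vd dmin Ed id => // d dn vd dmin Ed id.
have [t t0 Et] := @root_poly_root c d i id ci.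
pose x (j : nat) := t ^+ 2 * (root_poly c j).[t].
have xd : x d = t by rewrite /x expr2 -mulrA Et mulr1.
have x0 : x 0%N = t ^+ 2 * c 0%N by rewrite /x /= hornerC.
have xS j : x j.+1 = x j ^+ 2 + t ^+ 2 * c j.+1.
  by rewrite /x /= !hornerE; ring.
pose w := \sum_(j < d.+1) x j *: orb j.
have phiw : phi w = w + t ^+ 2 *: z.
  rewrite /w semilin_sum; under eq_bigr => j _ do rewrite semilinZ -iterS.
  rewrite big_ord_recr /= xd -/(orb d.+1) Ed scalerDr addrA; congr (_ + _).
  rewrite scaler_sumr [in RHS]big_ord_recl big_ord_recl /= x0 scalerA addrCA; congr (_ + _).
  rewrite -big_split; apply: eq_bigr => j _ /=.
  by rewrite /bump /= add1n xS scalerDl scalerA.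
have wF : ~~ (w <= F)%MS.
  apply/negP => wF; have := dmin d; rewrite (leq_trans (leqnSn d) dn) /= => h.
  suff /h : (orb d <= orbit_span d)%MS by rewrite ltnn.
  have -> : orb d = t^-1 *: (w - \sum_(j < d) x j *: orb j).
    by rewrite /w big_ord_recr /= addrAC subrr add0r xd scalerA mulVf // scale1r.
  apply: scalemx_sub; apply: addmx_sub; first exact: orbit_span_F.
  rewrite eqmx_opp; apply: summx_sub => j _; apply: scalemx_sub.
  exact: orbit_span_orb.
have /submxP[y Dz] := zF.
have [g Dg] := artin_schreier (t ^+ 2 *: y).
exists (w + g *m F); split.
  rewrite semilinD semilinM fixF phiw Dz scalemxAl -addrA -mulmxDl -Dg.
  by rewrite addrAC addmx2 add0r.
apply: contra wF => wF; rewrite -(addrK (g *m F) w); apply: addmx_sub => //.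
by rewrite eqmx_opp submxMl.
Qed.

End Extension.

(** Take F maximal; [fixed_or_nilpotent] then always gives the second case. *)
Lemma maximal_fixed : exists s (F : 'M[k]_(s, n)),
  [/\ row_free F, phi F = F & forall v : 'rV[k]_n, (iter (n - s) (@semilin 1) v <= F)%MS].
Proof.
pose fixset s := exists F : 'M[k]_(s, n), row_free F /\ phi F = F.
have ex0 : exists s, `[< fixset s >].
  exists 0%N; apply/asboolP; exists 0; split; last exact: semilin0.
  by rewrite /row_free mxrank0.
have bnd s : `[< fixset s >] -> (s <= n)%N.
  by move=> /asboolP[F [/eqP rF _]]; rewrite -rF; exact: rank_leq_col.
case: (ex_maxnP ex0 bnd) => s /asboolP[F [freeF fixF]] smax.
exists s, F; split=> // v; have [[w [fixw wF]]|//] := fixed_or_nilpotent fixF v freeF.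
suff /smax : `[< fixset (s + 1)%N >] by rewrite addn1 ltnn.
apply/asboolP; exists (col_mx F w); split.
  have rk : (\rank F < \rank (F + w)%MS)%N.
    by apply: rank_ltmx; rewrite /ltmx addsmxSl addsmx_sub submx_refl.
  by rewrite /row_free eqn_leq rank_leq_row -addsmxE addn1 -{1}(eqP freeF).
have -> : phi (col_mx F w) = col_mx (phi F) (phi w).
  by rewrite /semilin /frobx map_col_mx mul_col_mx.
by rewrite fixF fixw.
Qed.

End Semilinear.

Section NormalForms.
Variables (k : closedFieldType) (m : 'M[k]_3).
Hypothesis k2 : 2%N \in [pchar k].
Local Notation phi := (@semilin k 3 m 1).
Implicit Types e P : 'rV[k]_3.

Definition frame e0 e1 e2 : 'M[k]_3 := \matrix_(i < 3) nth 0 [:: e0; e1; e2] i.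

Lemma frame_row0 e0 e1 e2 : row 0 (frame e0 e1 e2) = e0. Proof. exact: rowK. Qed.
Lemma frame_row1 e0 e1 e2 : row 1 (frame e0 e1 e2) = e1. Proof. exact: rowK. Qed.
Lemma frame_row2 e0 e1 e2 : row 2 (frame e0 e1 e2) = e2. Proof. exact: rowK. Qed.

Lemma mul_frame e0 e1 e2 (x : 'rV_3) :
  x *m frame e0 e1 e2 = x 0 0 *: e0 + x 0 1 *: e1 + x 0 2 *: e2.
Proof.
rewrite mulmx_sum_row (sum_ord3 _ (isT : uniq [:: 0; 1; 2 : 'I_3])).
by rewrite frame_row0 frame_row1 frame_row2.
Qed.

Lemma vec3_mul_frame e0 e1 e2 a b c :
  vec3 a b c *m frame e0 e1 e2 = a *: e0 + b *: e1 + c *: e2.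
Proof. by rewrite mul_frame !mxE. Qed.

Lemma frame_ext (M : 'M[k]_3) : M = frame (row 0 M) (row 1 M) (row 2 M).
Proof.
apply/row_matrixP => i; rewrite rowK.
by case: i => -[|[|[|//]]] hi; congr row; apply/val_inj.
Qed.

Lemma frame_unit e0 e1 e2 :
    (forall a b c, a *: e0 + b *: e1 + c *: e2 = 0 -> [/\ a = 0, b = 0 & c = 0]) ->
  frame e0 e1 e2 \in unitmx.
Proof.
move=> free; rewrite -row_free_unit -kermx_eq0; apply/rowV0P => x /sub_kermxP.
rewrite mul_frame => /free[x0 x1 x2]; apply/rowP => i; rewrite mxE.
case: i => -[|[|[|//]]] hi; [rewrite -[RHS]x0|rewrite -[RHS]x1|rewrite -[RHS]x2].
all: by congr (x _ _); apply/val_inj.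
Qed.

Lemma scale_eq0 a e : a *: e = 0 -> e != 0 -> a = 0.
Proof. by move=> /eqP; rewrite scaler_eq0 => /orP[/eqP->|->]. Qed.

Lemma sub_scale a e (s : nat) (F : 'M[k]_(s, 3)) :
  a != 0 -> (a *: e <= F)%MS -> (e <= F)%MS.
Proof. by move=> a0; rewrite eqmx_scale. Qed.

(** Fitting decomposition: the map has a basis of fixed vectors on a subspace and
    is nilpotent on a complement.  The kernel has dimension at most 1 because of
    the rank, so the nilpotent part is a single Jordan block, of size 0 to 3. *)
Lemma semilin_normal_form : (1 < \rank m)%N -> exists e0 e1 e2,
  frame e0 e1 e2 \in unitmx /\
  [\/ [/\ phi e0 = e0, phi e1 = e1 & phi e2 = e2],
      [/\ phi e0 = 0, phi e1 = e1 & phi e2 = e2],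
      [/\ phi e0 = 0, phi e1 = e1 & phi e2 = e0]
    | [/\ phi e0 = 0, phi e1 = e2 & phi e2 = e0]].
Proof.
move=> rkm; have [s [F [freeF fixF nilF]]] := maximal_fixed m k2.
have s3 : (s <= 3)%N by rewrite -(eqP freeF) rank_leq_col.
have phi_row (i : 'I_s) : phi (row i F) = row i F.
  by rewrite -[in RHS]fixF /semilin /frobx map_row row_mul.
have phi0 : phi 0 = 0 by exact: semilin0.
case: s F freeF fixF nilF s3 phi_row => [|[|[|[|//]]]] F freeF fixF nilF _ phi_row.
- have nil3 v : phi (phi (phi v)) = 0.
    have /submxP[y Dy] := nilF v; apply: (etrans Dy).
    by rewrite [y]thinmx0 mul0mx.
  have [v v0] : exists v, phi (phi v) != 0.
    apply: contrapT => no; have : frobx m *m m = 0.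
      apply/row_matrixP => i; rewrite row0 rowE.
      have [x Dx] := frobx_surj (delta_mx 0 i : 'rV[k]_3).
      have [y Dy] := frobx_surj x.
      rewrite -Dx -Dy mulmxA -frobxM //.
      by apply: contrapT => h; apply: no; exists y; apply/eqP.
    have -> : frobx m = map_mx (pFrobenius_aut k2) m.
      by apply/matrixP => i j; rewrite !mxE.
    move=> /mulmx0_rank_max; rewrite mxrank_map leqNgt => /negP[].
    by rewrite (@leq_add 2 2).
  exists (phi (phi v)), v, (phi v); split; last by constructor 4.
  apply: frame_unit => a b c E.
  have b0 : b = 0.
    have /(congr1 phi)/(congr1 phi) := E.
    rewrite !(semilinD, semilinZ) // !nil3 !phi0 !scaler0 !addr0 add0r.
    by move=> /scale_eq0 => /(_ v0)/eqP; rewrite !expf_eq0 => /eqP.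
  move: E; rewrite b0 scale0r addr0 => E.
  have c0 : c = 0.
    have /(congr1 phi) := E.
    rewrite !(semilinD, semilinZ) // nil3 scaler0 add0r phi0.
    by move=> /scale_eq0 => /(_ v0)/eqP; rewrite !expf_eq0 => /eqP.
  by move: E; rewrite c0 scale0r addr0 => /scale_eq0 -> .
- have F0 : F != 0 by rewrite -mxrank_eq0 (eqP freeF).
  have [v vF] : exists v, ~~ (phi v <= F)%MS.
    apply: contrapT => no; suff /mxrankS : (m <= F)%MS.
      by rewrite (eqP freeF) leqNgt rkm.
    apply/row_subP => i; rewrite rowE.
    have [x Dx] := frobx_surj (delta_mx 0 i : 'rV[k]_3).
    by rewrite -Dx; apply: contrapT => /negP h; apply: no; exists x.
  have /submxP[y Dy] := nilF v.
  have [g1 Dg1] := frobx_surj y; have [g Dg] := frobx_surj g1.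
  set w := v + g *m F.
  have phiw : phi w = phi v + g1 *m F by rewrite semilinD // semilinM // fixF Dg.
  have phiw2 : phi (phi w) = 0.
    rewrite phiw semilinD // semilinM // fixF Dg1.
    by move: Dy => /= ->; rewrite addmx2.
  have wF : ~~ (phi w <= F)%MS.
    apply: contra vF => wF; rewrite -(addrK (g1 *m F) (phi v)) -phiw.
    by apply: addmx_sub => //; rewrite eqmx_opp submxMl.
  move: w phiw2 wF {phiw} => w phiw2 wF.
  exists (phi w), F, w; split; last by constructor 3.
  apply: frame_unit => a b c E.
  have c0 : c = 0.
    apply/eqP; apply: contraNT wF => c0; have c20 : c ^+ 2 != 0 by rewrite expf_neq0.
    apply: (sub_scale c20).
    have /(congr1 phi) := E; rewrite !(semilinD, semilinZ) // phiw2 scaler0 add0r.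
    rewrite fixF phi0 => /eqP; rewrite addr_eq0 -eqr_oppLR => /eqP <-.
    by rewrite eqmx_opp scalemx_sub.
  move: E; rewrite c0 scale0r addr0 => E.
  have a0 : a = 0.
    apply/eqP; apply: contraNT wF => a0; apply: (sub_scale a0).
    by move/eqP: E; rewrite addr_eq0 => /eqP ->; rewrite eqmx_opp scalemx_sub.
  by move: E; rewrite a0 scale0r add0r => /scale_eq0 ->.
- have [v vF] : exists v : 'rV_3, ~~ (v <= F)%MS.
    apply: contrapT => no; suff /mxrankS : ((1%:M : 'M[k]_3) <= F)%MS.
      by rewrite (eqP freeF) mxrank1.
    by apply/row_subP => i; apply: contrapT => /negP h; apply: no; exists (row i 1%:M).
  have /submxP[y Dy] := nilF v; have [g Dg] := frobx_surj y.
  set w := v + g *m F.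
  have phiw : phi w = 0.
    by rewrite semilinD // semilinM // fixF Dg; move: Dy => /= ->; rewrite addmx2.
  have wF : ~~ (w <= F)%MS.
    apply: contra vF => wF; rewrite -(addrK (g *m F) v).
    by apply: addmx_sub => //; rewrite eqmx_opp submxMl.
  move: w phiw wF => w phiw wF.
  exists w, (row 0 F), (row 1 F); split; last by constructor 2.
  apply: frame_unit => a b c E; pose z : 'rV[k]_2 := \row_j [:: b; c]`_j.
  have Dz : b *: row 0 F + c *: row 1 F = z *m F.
    by rewrite mulmx_sum_row !big_ord_recl big_ord0 addr0 !mxE (_ : lift _ _ = 1) //; apply/val_inj.
  move: E; rewrite -addrA Dz => E.
  have a0 : a = 0.
    apply/eqP; apply: contraNT wF => a0; apply: (sub_scale a0).
    by move/eqP: E; rewrite addr_eq0 => /eqP ->; rewrite eqmx_opp submxMl.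
  move: E; rewrite a0 scale0r add0r => /(congr1 (mulmx^~ (pinvmx F))) /=.
  rewrite mul0mx mulmxKp // => z0.
  by split=> //; [have := congr1 (fun x : 'rV[k]_2 => x 0 0) z0|have := congr1 (fun x : 'rV[k]_2 => x 0 1) z0]; rewrite !mxE.
- exists (row 0 F), (row 1 F), (row 2 F); split; last by constructor 1.
  by rewrite -frame_ext -row_free_unit.
Qed.

End NormalForms.

(** * Singular points of the quotient *)

(** ** Equations in two variables with coefficients 0 and 1 *)

Section Equations.
Variable k : closedFieldType.
Local Notation Pxy := {mpoly k[2]}.
Implicit Types s : seq (nat * nat).

Definition eqn (R : comNzRingType) (u v : R) s := \sum_(z <- s) u ^+ z.1 * v ^+ z.2.

(** For the equation Z^2 + [eqn] X Y s: no monomial of s is a square, z0 is the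
    only exponent in its class modulo 2, and there are no terms of degree less
    than 2. *)
Definition double_eqn s z0 :=
  [&& uniq s, all (fun z => odd z.1 || odd z.2) s, z0 \in s, (z0.1 + z0.2 < 4)%N,
      all (fun z => (odd z.1 == odd z0.1) && (odd z.2 == odd z0.2) ==> (z == z0)) s
    & all (fun z => 1 < z.1 + z.2)%N s].

Lemma subst2_eqn n (p q : {mpoly k[n]}) s : subst2 p q (eqn 'X_0 'X_1 s) = eqn p q s.
Proof.
rewrite /eqn rmorph_sum; apply: eq_bigr => z _.
by rewrite rmorphM !rmorphXn !subst2X.
Qed.

Definition mon (z : nat * nat) : 'X_{1..2} := [multinom nth 0%N [:: z.1; z.2] i | i < 2].

Lemma mcoeff_eqn s (mu : 'X_{1..2}) : uniq s ->
  (eqn 'X_0 'X_1 s : Pxy)@_mu = ((mu 0, mu 1) \in s)%:R.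
Proof.
have coef z : ('X_0 ^+ z.1 * 'X_1 ^+ z.2 : Pxy)@_mu = ((mu 0, mu 1) == z)%:R.
  have -> : 'X_0 ^+ z.1 * 'X_1 ^+ z.2 = 'X_[mon z] :> Pxy.
    by rewrite [RHS]mpolyX2 !mnmE.
  rewrite mcoeffX; congr (_ %:R); congr nat_of_bool; apply/eqP/eqP => [<-|Ez].
    by rewrite !mnmE; case: z.
  by apply: mnm2P; rewrite mnmE -Ez.
rewrite /eqn; elim: s => [|z s IH] /=; first by rewrite big_nil mcoeff0.
move=> /andP[zs us]; rewrite big_cons mcoeffD coef IH // in_cons.
by case: eqP => [->|]; rewrite ?(negPf zs) ?addr0 ?add0r.
Qed.

Lemma order_eqn (u v : Pxy) s : order_ge 1 u -> order_ge 1 v ->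
  all (fun z => 1 < z.1 + z.2)%N s -> order_ge 2 (eqn u v s).
Proof.
move=> hu hv /allP hs; rewrite /eqn big_seq; apply: order_ge_sum => z /hs hz.
exact: order_geW hz (order_geM (order_exp hu) (order_exp hv)).
Qed.

End Equations.

Lemma meval0_coef (k : closedFieldType) (p : {mpoly k[2]}) : p.@[fun=> 0] = p@_0%MM.
Proof.
elim/mpoly_ring_ind: p => [c|i|p q Ep Eq|p q Ep Eq].
- by rewrite mevalC mcoeffC eqxx mulr1.
- by rewrite mevalXU mcoeffX mnm1_eq0.
- by rewrite mevalD mcoeffD Ep Eq.
- by rewrite mevalM mcoeff0M Ep Eq.
Qed.

Fact local_gens_subproof (E : fieldType) (x d a u b v : E) :
  d != 0 -> x * d = a * u + b * v -> x = a / d * u + b / d * v.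
Proof. by move=> d0 h; rewrite -[LHS](mulfK d0) h; field. Qed.

(** ** Local equations in a frame *)

Section Frames.
Variables (k : closedFieldType) (m : 'M[k]_3).
Hypothesis k2 : 2%N \in [pchar k].
Variable L : set 'rV[k]_3 -> set (ratfun k -> ratfun k).
Hypothesis gen : generated_by L m.
Local Notation Pxy := {mpoly k[2]}.
Local Notation phi := (@semilin k 3 m 1).
Local Notation x := ('X_0 : Pxy).
Local Notation y := ('X_1 : Pxy).
Implicit Types e P n : 'rV[k]_3.

(** The quartic in the affine coordinates at the first vector of a frame; n0, n1
    and n2 are the coordinates of the images of the vectors of the frame under the
    semilinear map. *)
Definition local_equation n0 n1 n2 : Pxy :=
  let a j := (n0 0 j)%:MP + (n1 0 j)%:MP * x ^+ 2 + (n2 0 j)%:MP * y ^+ 2 in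
  a 0 * x * y + a 1 * y + a 2 * x.

Section OneFrame.
Variables e0 e1 e2 n0 n1 n2 : 'rV[k]_3.
Local Notation M := (frame e0 e1 e2).
Hypothesis unitM : M \in unitmx.
Hypotheses (phi0 : phi e0 = n0 *m M) (phi1 : phi e1 = n1 *m M) (phi2 : phi e2 = n2 *m M).
Local Notation io := (iota M).
Local Notation f := (local_equation n0 n1 n2).

Lemma frame_matrix_frame : frame_matrix m M = frame n0 n1 n2.
Proof.
rewrite /frame_matrix -[map_mx _ _ *m m]/(semilin m M).
suff -> : semilin m M = frame n0 n1 n2 *m M by rewrite mulmxK.
have rowphi i : row i (semilin m M) = phi (row i M).
  by rewrite /semilin /frobx map_row row_mul.
by rewrite [LHS]frame_ext [RHS]frame_ext !rowphi !row_mul !frame_row0 !frame_row1 !frame_row2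
  phi0 phi1 phi2.
Qed.

Lemma restr_quartic : restr M (quartic m M) = f.
Proof.
have rY0 : restr M (new_coord M 0) = 1 by rewrite restr_coord // !scale0r !addr0 mpolyC1.
have rY1 : restr M (new_coord M 1) = x by rewrite restr_coord // scale1r scale0r mpolyC0 add0r addr0.
have rY2 : restr M (new_coord M 2) = y by rewrite restr_coord // scale1r scale0r mpolyC0 !add0r.
have rA j : restr M (new_field m M j) =
    (n0 0 j)%:MP + (n1 0 j)%:MP * x ^+ 2 + (n2 0 j)%:MP * y ^+ 2.
  rewrite (new_field_frob m k2 unitM) (sum_ord3 _ (isT : uniq [:: 0; 1; 2 : 'I_3])).
  rewrite frame_matrix_frame !(rmorphD (restr M)) !restrZ !(rmorphXn (restr M)) rY0 rY1 rY2.
  by rewrite expr1n -!mul_mpolyC mulr1 !mxE.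
rewrite /quartic !(rmorphD (restr M)) !(rmorphM (restr M)) rY0 rY1 rY2 !rA /local_equation.
by rewrite !mulr1.
Qed.

Lemma regular_in_power g : regular_at e0 g <-> in_power io 0 g.
Proof.
have E := @meval0_coef.
rewrite -{1}(frame_row0 e0 e1 e2) regular_iota //; split.
  by move=> [p [b [b0 ->]]]; exists p, b; rewrite -E.
by move=> [p [b [b0 _ ->]]]; exists p, b; rewrite E.
Qed.

Lemma OY_frame : OY_at L e0 = sqr_ring io f.
Proof.
apply/funext => g; apply/propext; rewrite -[in OY_at _ _](frame_row0 e0 e1 e2).
rewrite (OY_iota k2 unitM gen) restr_quartic frame_row0.
by split=> -[s [t [hs ht ->]]]; exists s, t; split=> //; apply/regular_in_power.
Qed.

Lemma mY_frame : mY_at L e0 = sqr_max io f.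
Proof. by rewrite /mY_at OY_frame. Qed.

End OneFrame.
End Frames.

(** ** Types of the singular points *)

Section SingularityTypes.
Variables (k : closedFieldType) (m : 'M[k]_3).
Hypothesis k2 : 2%N \in [pchar k].
Variable L : set 'rV[k]_3 -> set (ratfun k -> ratfun k).
Hypothesis gen : generated_by L m.
Local Notation Pxy := {mpoly k[2]}.
Local Notation Pxyz := {mpoly k[3]}.
Local Notation phi := (@semilin k 3 m 1).
Local Notation x := ('X_0 : Pxy).
Local Notation y := ('X_1 : Pxy).
Implicit Types e P n : 'rV[k]_3.

Definition has_type P (g : Pxyz) := singularity_type L P g /\ singular_at L P.

(** A change of coordinates (u, v) brings the local equation to the form [eqn].
    The two existence hypotheses say that u and v generate the maximal ideal of
    the plane at the point. *)
Lemma double_point_frame e0 e1 e2 n0 n1 n2 s z0 (u v : Pxy) :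
    frame e0 e1 e2 \in unitmx -> phi e0 = n0 *m frame e0 e1 e2 ->
    phi e1 = n1 *m frame e0 e1 e2 -> phi e2 = n2 *m frame e0 e1 e2 ->
    double_eqn s z0 -> local_equation n0 n1 n2 = eqn u v s ->
    order_ge 2 (u - x) -> order_ge 2 (v - y) ->
    (exists a b d : Pxy, d@_0%MM != 0 /\ x * d = a * u + b * v) ->
    (exists a b d : Pxy, d@_0%MM != 0 /\ y * d = a * u + b * v) ->
  has_type e0 ('X_2 ^+ 2 + eqn 'X_0 'X_1 s).
Proof.
move=> unitM phi0 phi1 phi2 /and5P[us odds s0 z04 /andP[cls ords]] Ef hu hv gx gy.
pose io := iota (frame e0 e1 e2).
have ioC := iotaC (frame e0 e1 e2); have io_inj := @iota_inj _ _ unitM.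
have gens_io z : (exists a b d : Pxy, d@_0%MM != 0 /\ z * d = a * u + b * v) ->
    exists a b, [/\ in_power io 0 a, in_power io 0 b & io z = a * io u + b * io v].
  move=> [a [b [d [d0 E]]]]; exists (io a / io d), (io b / io d).
  split; [by exists a, d | by exists b, d | ].
  apply: (local_gens_subproof (io_neq0 io_inj d0)).
  by rewrite -!(rmorphM io) -(rmorphD io) E.
have h1 i z : order_ge 2 (z - 'X_i : Pxy) -> order_ge 1 z.
  move=> hz; rewrite -(subrK 'X_i z); apply: order_geD; first exact: order_geW hz.
  by apply: order_geX; rewrite mdeg1.
have hf : order_ge 2 (local_equation n0 n1 n2).
  by rewrite Ef; apply: order_eqn (h1 _ _ hu) (h1 _ _ hv) ords.
have fE : local_equation n0 n1 n2 = subst2 u v (eqn x y s) by rewrite subst2_eqn.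
have h_bit mu : (eqn x y s)@_mu ^+ 2 = (eqn x y s)@_mu.
  by rewrite mcoeff_eqn //; case: (_ \in _); rewrite ?expr1n ?expr0n.
have h_mem mu : (eqn x y s)@_mu != 0 -> (mu 0, mu 1) \in s.
  by rewrite mcoeff_eqn //; case: (_ \in _); rewrite ?eqxx.
have h_odd mu : (eqn x y s)@_mu != 0 -> exists i, odd (mu i).
  by move=> /h_mem/(allP odds)/orP[h|h]; [exists 0 | exists 1].
have mon0 : mon z0 0 = z0.1 by rewrite mnmE.
have mon1 : mon z0 1 = z0.2 by rewrite mnmE.
have h_mu0 : (eqn x y s)@_(mon z0) = 1.
  by rewrite mcoeff_eqn // mon0 mon1 -surjective_pairing s0.
have mu04 : (mdeg (mon z0) < 4)%N.
  rewrite mdegE !big_ord_recl big_ord0 addn0 mon0 (_ : lift _ _ = 1) ?mon1 //.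
  exact/val_inj.
have h_class (mu : 'X_{1..2}) : (forall i, odd (mu i) = odd (mon z0 i)) ->
    (eqn x y s)@_mu != 0 -> mu = mon z0.
  move=> par /h_mem/(allP cls); rewrite /= !par mon0 mon1 !eqxx /= => /eqP Ez.
  by apply: mnm2P; rewrite mnmE -Ez.
have gx' := gens_io _ gx; have gy' := gens_io _ gy.
split.
  rewrite /singularity_type (mY_frame k2 gen unitM phi0 phi1 phi2).
  rewrite (OY_frame k2 gen unitM phi0 phi1 phi2).
  have := double_point_completion (c := @ratconst k) k2 ioC io_inj h_bit h_odd h_mu0
    h_class hu hv gx' gy' fE hf.
  by rewrite /double_point_eq subst2_eqn.
rewrite /singular_at (mY_frame k2 gen unitM phi0 phi1 phi2).
rewrite (OY_frame k2 gen unitM phi0 phi1 phi2).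
exact: (double_point_singular (c := @ratconst k) k2 ioC io_inj h_odd h_mu0 mu04
    h_class hu hv gx' gy' fE hf).
Qed.

(** If P and its image are independent then, in a frame that begins with them,
    the local equation has the linear term y. *)
Lemma singular_eigenvector P : P != 0 -> singular_at L P -> exists a, phi P = a *: P.
Proof.
move=> P0 singP; apply: contrapT => no; apply: singP.
have phiP : phi P != 0 by apply/eqP => h; apply: no; exists 0; rewrite scale0r.
have [e2 e2P] : exists e, ~~ (e <= col_mx P (phi P))%MS.
  apply: contrapT => all_sub; suff /mxrankS : ((1%:M : 'M[k]_3) <= col_mx P (phi P))%MS.
    by rewrite mxrank1 leqNgt ltnS rank_leq_row.
  by apply/row_subP => i; apply: contrapT => /negP h; apply: all_sub; exists (row i 1%:M).
have unitM : frame P (phi P) e2 \in unitmx.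
  apply: frame_unit => a b c E.
  have c0 : c = 0.
    apply/eqP; apply: contraNT e2P => c0; apply: (sub_scale c0).
    move/eqP: E; rewrite addrC addr_eq0 => /eqP ->; rewrite eqmx_opp -addsmxE.
    by apply: addmx_sub_adds; apply: scalemx_sub.
  move: E; rewrite c0 scale0r addr0 => E.
  have b0 : b = 0.
    apply/eqP; apply: contra_notT no => b0; exists (- (b^-1 * a)).
    move/eqP: E; rewrite addrC addr_eq0 => /eqP/(congr1 (fun z => b^-1 *: z)).
    by rewrite scalerA mulVf // scale1r scalerN scalerA scaleNr.
  by move: E; rewrite b0 scale0r addr0 => /scale_eq0 ->.
set M := frame P (phi P) e2 in unitM *; set io := iota M.
have coord e : e = (e *m invmx M) *m M by rewrite mulmxKV.
have phi0 : phi P = vec3 0 1 0 *m M by rewrite vec3_mul_frame !scale0r scale1r add0r addr0.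
rewrite (mY_frame k2 gen unitM phi0 (coord _) (coord _)).
rewrite (OY_frame k2 gen unitM phi0 (coord _) (coord _)).
move: (phi (phi P) *m invmx M) (phi e2 *m invmx M) => n1 n2.
have ioC := iotaC M; have io_inj := @iota_inj _ _ unitM.
have hX (i : 'I_2) : order_ge 1 ('X_i : Pxy) by apply: order_geX; rewrite mdeg1.
have hM (p q : Pxy) : order_ge 1 q -> order_ge 1 (p * q) by apply: (@order_geM _ _ 0).
apply: (sqr_ring_regular (c := @ratconst k) k2 ioC io_inj).
  by rewrite /local_equation; apply: order_geD; [apply: order_geD |]; apply: hM.
pose r j : Pxy := (n1 0 j)%:MP * x ^+ 2 + (n2 0 j)%:MP * y ^+ 2.
have d0 : (1 + r 1)@_0%MM != 0.
  rewrite mcoeffD mcoeff1 eqxx /r mcoeffD !expr2 !mcoeff0M !mcoeffX !mnm1_eq0.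
  by rewrite !mulr0 !addr0 oner_neq0.
exists (io (- (r 0 * y + r 2)) / io (1 + r 1)), (io 1 / io (1 + r 1)); split.
- by exists (- (r 0 * y + r 2)), (1 + r 1).
- by exists 1, (1 + r 1).
apply: (local_gens_subproof (io_neq0 io_inj d0)).
rewrite -!(rmorphM io) -(rmorphD io); congr (io _).
by rewrite /local_equation /r !mxE /= mpolyC0 mpolyC1; ring.
Qed.

End SingularityTypes.

(** * The four configurations *)

Section Configurations.
Variables (k : closedFieldType) (m : 'M[k]_3).
Hypothesis k2 : 2%N \in [pchar k].
Variable L : set 'rV[k]_3 -> set (ratfun k -> ratfun k).
Hypothesis gen : generated_by L m.
Local Notation Pxy := {mpoly k[2]}.
Local Notation phi := (@semilin k 3 m 1).
Local Notation x := ('X_0 : Pxy).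
Local Notation y := ('X_1 : Pxy).
Implicit Types e P : 'rV[k]_3.

Lemma order_ge2M i j (p : Pxy) : order_ge 2 ('X_i * 'X_j * p).
Proof.
have hX l : order_ge 1 ('X_l : Pxy) by apply: order_geX; rewrite mdeg1.
exact: (order_geM (order_geM (hX i) (hX j)) (order_ge0 p)).
Qed.
Lemma order_ge_sub0 (p : Pxy) : order_ge 2 (p - p).
Proof. by rewrite subrr => mu _; rewrite mcoeff0. Qed.

Lemma frame_vec0 e0 e1 e2 : e0 = vec3 1 0 0 *m frame e0 e1 e2.
Proof. by rewrite vec3_mul_frame !scale0r !addr0 scale1r. Qed.
Lemma frame_vec1 e0 e1 e2 : e1 = vec3 0 1 0 *m frame e0 e1 e2.
Proof. by rewrite vec3_mul_frame !scale0r addr0 add0r scale1r. Qed.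
Lemma frame_vec2 e0 e1 e2 : e2 = vec3 0 0 1 *m frame e0 e1 e2.
Proof. by rewrite vec3_mul_frame !scale0r !add0r scale1r. Qed.
Lemma frame_vecN e0 e1 e2 : 0 = vec3 0 0 0 *m frame e0 e1 e2.
Proof. by rewrite vec3_mul_frame !scale0r !addr0. Qed.

Let coef1 : (1 : Pxy)@_0%MM != 0.
Proof. by rewrite mcoeff1 eqxx oner_neq0. Qed.

Lemma A1_eqE : A1_eq k = 'X_2 ^+ 2 + eqn 'X_0 'X_1 [:: (1, 1)%N].
Proof. by rewrite /eqn big_seq1. Qed.
Lemma D0_eqE n : D0_eq k n = 'X_2 ^+ 2 + eqn 'X_0 'X_1 [:: (2, 1); (1, n)]%N.
Proof. by rewrite /eqn big_cons big_seq1 addrA. Qed.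
Lemma E70_eqE : E70_eq k = 'X_2 ^+ 2 + eqn 'X_0 'X_1 [:: (3, 0); (1, 3)]%N.
Proof. by rewrite /eqn big_cons big_seq1 /= mulr1 addrA. Qed.

Lemma gens_x (g : Pxy) : exists a b d : Pxy, d@_0%MM != 0 /\ x * d = a * x + b * g.
Proof. by exists 1, 0, 1; split=> //; ring. Qed.
Lemma gens_y (g : Pxy) : exists a b d : Pxy, d@_0%MM != 0 /\ y * d = a * g + b * y.
Proof. by exists 0, 1, 1; split=> //; ring. Qed.
Lemma gens_yM (d g : Pxy) : d@_0%MM = 1 ->
  exists a b d' : Pxy, d'@_0%MM != 0 /\ y * d' = a * g + b * (y * d).
Proof. by move=> d1; exists 0, 1, d; split; [rewrite d1 oner_neq0 | ring]. Qed.

(** The local equation is x y (1 + x + y). *)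
Lemma type_A1_fixed e0 e1 e2 : frame e0 e1 e2 \in unitmx ->
  phi e0 = e0 -> phi e1 = e1 -> phi e2 = e2 -> has_type L e0 (A1_eq k).
Proof.
move=> uM h0 h1 h2; rewrite A1_eqE.
have M0 := frame_vec0 e0 e1 e2; have M1 := frame_vec1 e0 e1 e2; have M2 := frame_vec2 e0 e1 e2.
apply: (double_point_frame k2 gen uM (etrans h0 M0) (etrans h1 M1) (etrans h2 M2)
  (z0 := (1, 1)%N) (u := x) (v := y * (1 + x + y))) => //.
- by rewrite /eqn big_seq1 /local_equation !mxE /= mpolyC0 mpolyC1; ring.
- exact: order_ge_sub0.
- rewrite (_ : _ - y = x * y * 1 + y * y * 1); last by ring.
  by apply: order_geD; exact: order_ge2M.
- exact: gens_x.
- by apply: gens_yM; rewrite !mcoeffD mcoeff1 !mcoeffX !mnm1_eq0 eqxx !addr0.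
Qed.

(** The local equation is x y (1 + x). *)
Lemma type_A1_kernel e0 e1 e2 : frame e0 e1 e2 \in unitmx ->
  phi e0 = e0 -> phi e1 = e1 -> phi e2 = 0 -> has_type L e0 (A1_eq k).
Proof.
move=> uM h0 h1 h2; rewrite A1_eqE.
have M0 := frame_vec0 e0 e1 e2; have M1 := frame_vec1 e0 e1 e2; have MN := frame_vecN e0 e1 e2.
apply: (double_point_frame k2 gen uM (etrans h0 M0) (etrans h1 M1) (etrans h2 MN)
  (z0 := (1, 1)%N) (u := x) (v := y * (1 + x))) => //.
- by rewrite /eqn big_seq1 /local_equation !mxE /= mpolyC0 mpolyC1; ring.
- exact: order_ge_sub0.
- rewrite (_ : _ - y = x * y * 1); last by ring.
  exact: order_ge2M.
- exact: gens_x.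
- by apply: gens_yM; rewrite !mcoeffD mcoeff1 !mcoeffX !mnm1_eq0 eqxx !addr0.
Qed.

(** The local equation is (x + y^2) y. *)
Lemma type_A1_nilpotent e0 e1 e2 : frame e0 e1 e2 \in unitmx ->
  phi e0 = e0 -> phi e1 = 0 -> phi e2 = e1 -> has_type L e0 (A1_eq k).
Proof.
move=> uM h0 h1 h2; rewrite A1_eqE.
have M0 := frame_vec0 e0 e1 e2; have M1 := frame_vec1 e0 e1 e2; have MN := frame_vecN e0 e1 e2.
apply: (double_point_frame k2 gen uM (etrans h0 M0) (etrans h1 MN) (etrans h2 M1)
  (z0 := (1, 1)%N) (u := x + y ^+ 2) (v := y)) => //.
- by rewrite /eqn big_seq1 /local_equation !mxE /= mpolyC0 mpolyC1; ring.
- rewrite (_ : _ - x = y * y * 1); last by ring.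
  exact: order_ge2M.
- exact: order_ge_sub0.
- by exists 1, (- y), 1; split=> //; ring.
- exact: gens_y.
Qed.

(** For the other types the vectors of the frame are already adapted to the local
    equation, which has the two terms listed in [eqn]. *)
Lemma type_adapted e0 e1 e2 n0 n1 n2 s z0 : frame e0 e1 e2 \in unitmx ->
    phi e0 = n0 *m frame e0 e1 e2 -> phi e1 = n1 *m frame e0 e1 e2 ->
    phi e2 = n2 *m frame e0 e1 e2 -> double_eqn s z0 ->
    local_equation n0 n1 n2 = eqn x y s ->
  has_type L e0 ('X_2 ^+ 2 + eqn 'X_0 'X_1 s).
Proof.
move=> uM h0 h1 h2 hs Ef; apply: (double_point_frame k2 gen uM h0 h1 h2 hs Ef).
- exact: order_ge_sub0.
- exact: order_ge_sub0.
- exact: gens_x.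
- exact: gens_y.
Qed.

Lemma type_D4 e0 e1 e2 : frame e0 e1 e2 \in unitmx ->
  phi e0 = 0 -> phi e1 = e1 -> phi e2 = e2 -> has_type L e0 (D0_eq k 2).
Proof.
move=> uM h0 h1 h2; rewrite D0_eqE.
apply: (type_adapted (z0 := (2, 1)%N) uM (etrans h0 (frame_vecN e0 e1 e2))
  (etrans h1 (frame_vec1 e0 e1 e2)) (etrans h2 (frame_vec2 e0 e1 e2))) => //.
by rewrite /eqn big_cons big_seq1 /local_equation !mxE /= mpolyC0 mpolyC1; ring.
Qed.

Lemma type_D6 e0 e1 e2 : frame e0 e1 e2 \in unitmx ->
  phi e0 = 0 -> phi e1 = e1 -> phi e2 = e0 -> has_type L e0 (D0_eq k 3).
Proof.
move=> uM h0 h1 h2; rewrite D0_eqE.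
apply: (type_adapted (z0 := (2, 1)%N) uM (etrans h0 (frame_vecN e0 e1 e2))
  (etrans h1 (frame_vec1 e0 e1 e2)) (etrans h2 (frame_vec0 e0 e1 e2))) => //.
by rewrite /eqn big_cons big_seq1 /local_equation !mxE /= mpolyC0 mpolyC1; ring.
Qed.

Lemma type_E7 e0 e1 e2 : frame e0 e1 e2 \in unitmx ->
  phi e0 = 0 -> phi e1 = e2 -> phi e2 = e0 -> has_type L e0 (E70_eq k).
Proof.
move=> uM h0 h1 h2; rewrite E70_eqE.
apply: (type_adapted (z0 := (3, 0)%N) uM (etrans h0 (frame_vecN e0 e1 e2))
  (etrans h1 (frame_vec2 e0 e1 e2)) (etrans h2 (frame_vec0 e0 e1 e2))) => //.
by rewrite /eqn big_cons big_seq1 /local_equation !mxE /= mpolyC0 mpolyC1; ring.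
Qed.

Lemma meval_scale d (g : {mpoly k[3]}) (c : k) P : g \is d.-homog ->
  g.@[(c *: P) 0] = c ^+ d * g.@[P 0].
Proof.
move=> hg; rewrite !mevalE mulr_sumr big_seq [RHS]big_seq; apply: eq_bigr => mu hmu.
rewrite mulrCA; congr (_ * _); rewrite -(dhomogP _ _ _ hg mu hmu) /= mdegE -prodrXr -big_split.
by apply: eq_bigr => i _; rewrite mxE exprMn.
Qed.

(** Open subsets of the plane are cones. *)
Lemma OY_at_scale c P : c != 0 -> OY_at L (c *: P) = OY_at L P.
Proof.
move=> c0; apply/funext => g; apply/propext.
have cone U (Q : 'rV[k]_3) (b : k) : b != 0 -> zopen U -> U Q -> U (b *: Q).
  move=> b0 /zopenE[G [hG UG]] /UG[Q0 [h Gh hQ]]; apply/UG; split.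
    by apply/eqP => E; move: b0; rewrite (scale_eq0 E Q0) eqxx.
  have [d hd] := hG h Gh; exists h => //.
  by rewrite (meval_scale _ _ hd) mulf_neq0 // expf_neq0.
split=> -[U [oU UP OU]]; exists U; split=> //; last exact: cone.
by rewrite -(scale1r P) -(mulVf c0) -scalerA; apply: cone; rewrite ?invr_eq0.
Qed.

Lemma singular_at_scale c P : c != 0 -> singular_at L P -> singular_at L (c *: P).
Proof. by move=> c0; rewrite /singular_at /mY_at OY_at_scale. Qed.

(** The singular points are the eigenvectors: the points listed in s have to be
    singular, and by [singular_eigenvector] every other singular point is excluded
    by solving the eigenvector equation in the coordinates of a frame. *)
Lemma sing_configP e0 e1 e2 (s : seq ('rV[k]_3 * {mpoly k[3]})) :
    frame e0 e1 e2 \in unitmx ->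
    (forall z, z \in s -> has_type L (z.1 *m frame e0 e1 e2) z.2) ->
    (forall (v : 'rV[k]_3) (a : k), v != 0 -> v 0 0 ^+ 2 *: phi e0 + v 0 1 ^+ 2 *: phi e1 + v 0 2 ^+ 2 *: phi e2
        = (a * v 0 0) *: e0 + (a * v 0 1) *: e1 + (a * v 0 2) *: e2 ->
      exists2 z, z \in s & proj_eq v z.1) ->
  sing_config L s.
Proof.
move=> uM types eig; exists (frame e0 e1 e2) => //; split; last by move=> z /types[].
move=> P P0; split=> [|[z /types[_ sz] [c c0 ->]]]; last exact: singular_at_scale.
move=> /(singular_eigenvector k2 gen P0)[a].
have -> : P = (P *m invmx (frame e0 e1 e2)) *m frame e0 e1 e2 by rewrite mulmxKV.
have : P *m invmx (frame e0 e1 e2) != 0.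
  by apply: contraNneq P0 => v0; rewrite -(mulmxKV uM P) v0 mul0mx.
move: (P *m _) => v v0 E; have [z zs [c c0 ->]] : exists2 z, z \in s & proj_eq v z.1.
  apply: (eig v a v0); move: E.
  by rewrite mul_frame !(semilinD, semilinZ) // !scalerDr !scalerA.
by exists z => //; exists c => //; rewrite scalemxAl.
Qed.

End Configurations.

(** ** Eigenvectors of the normal forms *)

Section FrameChange.
Variable k : closedFieldType.
Implicit Types e v : 'rV[k]_3.

Lemma frame_inj e0 e1 e2 a b c a' b' c' : frame e0 e1 e2 \in unitmx ->
  a *: e0 + b *: e1 + c *: e2 = a' *: e0 + b' *: e1 + c' *: e2 ->
  [/\ a = a', b = b' & c = c'].
Proof.
move=> uM; rewrite -!vec3_mul_frame => /(can_inj (mulmxK uM)) E.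
have h (i : 'I_3) : vec3 a b c 0 i = vec3 a' b' c' 0 i by rewrite E.
by split; [have := h 0 | have := h 1 | have := h 2]; rewrite !mxE.
Qed.

Lemma frame_free e0 e1 e2 a b c : frame e0 e1 e2 \in unitmx ->
  a *: e0 + b *: e1 + c *: e2 = 0 -> [/\ a = 0, b = 0 & c = 0].
Proof.
by move=> uM E; apply: (frame_inj uM); rewrite E !scale0r !addr0.
Qed.

Lemma frame_swap01 e0 e1 e2 : frame e0 e1 e2 \in unitmx -> frame e1 e0 e2 \in unitmx.
Proof.
move=> uM; apply: frame_unit => a b c; rewrite (addrC (a *: _)) => /(frame_free uM).
by case=> -> -> ->.
Qed.

Lemma frame_swap12 e0 e1 e2 : frame e0 e1 e2 \in unitmx -> frame e0 e2 e1 \in unitmx.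
Proof.
move=> uM; apply: frame_unit => a b c; rewrite addrAC => /(frame_free uM).
by case=> -> -> ->.
Qed.

Lemma frame_add01 e0 e1 e2 : frame e0 e1 e2 \in unitmx -> frame (e0 + e1) e1 e2 \in unitmx.
Proof.
move=> uM; apply: frame_unit => a b c; rewrite scalerDr -(addrA (a *: _)) -scalerDl.
by move=> /(frame_free uM)[-> /eqP + ->]; rewrite add0r => /eqP ->.
Qed.

Lemma vec3_scale v t a b c :
  v 0 0 = t * a -> v 0 1 = t * b -> v 0 2 = t * c -> v = t *: vec3 a b c.
Proof.
move=> E0 E1 E2; apply/rowP => i; rewrite !mxE.
by case: i => -[|[|[|//]]] hi; [rewrite -E0|rewrite -E1|rewrite -E2]; congr (v _ _); apply/val_inj.
Qed.

Lemma row3_neq0 v : v != 0 -> [\/ v 0 0 != 0, v 0 1 != 0 | v 0 2 != 0].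
Proof.
move=> v0; have [E0|] := eqVneq (v 0 0) 0; last by constructor 1.
have [E1|] := eqVneq (v 0 1) 0; last by constructor 2.
have [E2|] := eqVneq (v 0 2) 0; last by constructor 3.
by case/eqP: v0; rewrite (@vec3_scale v 0 0 0 0) ?mul0r // scale0r.
Qed.

Lemma sqr_eq_mul (a t : k) : t ^+ 2 = a * t -> t = 0 \/ t = a.
Proof.
move=> /eqP; rewrite expr2 -subr_eq0 -mulrBl mulf_eq0 subr_eq0.
by move=> /orP[/eqP ->|/eqP ->]; [right | left].
Qed.

End FrameChange.

Section Conclusion.
Variables (k : closedFieldType) (m : 'M[k]_3).
Hypothesis k2 : 2%N \in [pchar k].
Variable L : set 'rV[k]_3 -> set (ratfun k -> ratfun k).
Hypothesis gen : generated_by L m.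
Local Notation phi := (@semilin k 3 m 1).
Variables e0 e1 e2 : 'rV[k]_3.
Hypothesis uM : frame e0 e1 e2 \in unitmx.

Let simplv := (vec3_mul_frame, scale0r, scale1r, add0r, addr0).

(** The eigenvectors are the seven points with coordinates in the field with two
    elements, and three independent ones among them form a frame of fixed vectors. *)
Lemma config_three_fixed : phi e0 = e0 -> phi e1 = e1 -> phi e2 = e2 -> config_7A1 L.
Proof.
move=> h0 h1 h2; have type := type_A1_fixed k2 gen.
have u102 := frame_swap01 uM; have u201 := frame_swap01 (frame_swap12 uM).
have u021 := frame_swap12 uM; have u120 := frame_swap12 u102.
have D a b : phi a = a -> phi b = b -> phi (a + b) = a + b.
  by move=> ha hb; rewrite semilinD // ha hb.
exists 1, 1, 1, 1, 1, 1, 1, 1, 1; split; first by rewrite /= oner_neq0.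
apply: (sing_configP k2 gen uM) => [z|v a v0].
  rewrite !inE => /or4P[/eqP ->|/eqP ->|/eqP ->|/or4P[] /eqP ->]; rewrite /= !simplv.
  - exact: type uM h0 h1 h2.
  - exact: type u102 h1 h0 h2.
  - exact: type u201 h2 h0 h1.
  - exact: type (frame_add01 u120) (D _ _ h1 h2) h2 h0.
  - exact: type (frame_add01 u021) (D _ _ h0 h2) h2 h1.
  - exact: type (frame_add01 uM) (D _ _ h0 h1) h1 h2.
  - exact: type (frame_add01 (frame_swap12 (frame_add01 uM)))
      (D _ _ (D _ _ h0 h1) h2) h2 h1.
rewrite h0 h1 h2 => /(frame_inj uM)[/sqr_eq_mul E0 /sqr_eq_mul E1 /sqr_eq_mul E2].
have a0 : a != 0.
  apply/eqP => a0; move: E0 E1 E2; rewrite a0 => E0 E1 E2.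
  by case: (row3_neq0 v0); [case: E0 => -> | case: E1 => -> | case: E2 => ->]; rewrite eqxx.
set s := [:: _, _, _ & _].
have found i j l : (vec3 i j l, A1_eq k) \in s ->
    v 0 0 = a * i -> v 0 1 = a * j -> v 0 2 = a * l ->
    exists2 z, z \in s & proj_eq v z.1.
  by move=> hz *; eexists; [exact: hz | exists a => //; exact: vec3_scale].
case: E0 => E0; case: E1 => E1; case: E2 => E2.
- by case: (row3_neq0 v0); rewrite ?E0 ?E1 ?E2 eqxx.
- by apply: (found 0 0 1); rewrite ?inE ?eqxx ?orbT // ?mulr0 ?mulr1.
- by apply: (found 0 1 0); rewrite ?inE ?eqxx ?orbT // ?mulr0 ?mulr1.
- by apply: (found 0 1 1); rewrite ?inE ?eqxx ?orbT // ?mulr0 ?mulr1.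
- by apply: (found 1 0 0); rewrite ?inE ?eqxx ?orbT // ?mulr0 ?mulr1.
- by apply: (found 1 0 1); rewrite ?inE ?eqxx ?orbT // ?mulr0 ?mulr1.
- by apply: (found 1 1 0); rewrite ?inE ?eqxx ?orbT // ?mulr0 ?mulr1.
- by apply: (found 1 1 1); rewrite ?inE ?eqxx ?orbT // ?mulr0 ?mulr1.
Qed.

(** The kernel gives the point of type D_4; the other eigenvectors are the three
    fixed vectors of the span of e1 and e2. *)
Lemma config_two_fixed : phi e0 = 0 -> phi e1 = e1 -> phi e2 = e2 -> config_D40_3A1 L.
Proof.
move=> h0 h1 h2; have type := type_A1_kernel k2 gen.
have u120 := frame_swap12 (frame_swap01 uM).
exists 1, 1; rewrite oner_neq0; split=> //.
apply: (sing_configP k2 gen uM) => [z|v a v0].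
  rewrite !inE => /or4P[] /eqP ->; rewrite /= !simplv.
  - exact: (type_D4 k2 gen uM h0 h1 h2).
  - exact: type u120 h1 h2 h0.
  - exact: type (frame_swap01 u120) h2 h1 h0.
  - have h12 : phi (e1 + e2) = e1 + e2 by rewrite semilinD // h1 h2.
    exact: type (frame_add01 u120) h12 h2 h0.
rewrite h0 h1 h2 scaler0 -(scale0r e0) => /(frame_inj uM)[E0 /sqr_eq_mul E1 /sqr_eq_mul E2].
have [a0|a0] := eqVneq a 0.
  move: E1 E2; rewrite a0 => E1 E2; exists (vec3 1 0 0, D0_eq k 2); first by rewrite inE eqxx.
  have v1 : v 0 1 = 0 by case: E1.
  have v2 : v 0 2 = 0 by case: E2.
  exists (v 0 0); last by apply: vec3_scale; rewrite ?mulr1 ?mulr0.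
  by case: (row3_neq0 v0); rewrite ?v1 ?v2 ?eqxx.
have v00 : v 0 0 = 0 by move/esym/eqP: E0; rewrite mulf_eq0 (negPf a0) => /eqP.
case: E1 => E1; case: E2 => E2.
- by case: (row3_neq0 v0); rewrite ?v00 ?E1 ?E2 eqxx.
- exists (vec3 0 0 1, A1_eq k); first by rewrite !inE eqxx !orbT.
  by exists a => //; apply: vec3_scale; rewrite ?mulr0 ?mulr1.
- exists (vec3 0 1 0, A1_eq k); first by rewrite !inE eqxx !orbT.
  by exists a => //; apply: vec3_scale; rewrite ?mulr0 ?mulr1.
- exists (vec3 0 1 1, A1_eq k); first by rewrite !inE eqxx !orbT.
  by exists a => //; apply: vec3_scale; rewrite ?mulr0 ?mulr1.
Qed.

(** The eigenvectors are the kernel e0 and the fixed vector e1. *)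
Lemma config_one_fixed : phi e0 = 0 -> phi e1 = e1 -> phi e2 = e0 -> config_D60_A1 L.
Proof.
move=> h0 h1 h2; apply: (sing_configP k2 gen uM) => [z|v a v0].
  rewrite !inE => /orP[] /eqP ->; rewrite /= !simplv.
  - exact: (type_D6 k2 gen uM h0 h1 h2).
  - exact: (type_A1_nilpotent k2 gen (frame_swap01 uM) h1 h0 h2).
rewrite h0 h1 h2 scaler0 add0r addrC -[X in X + _]addr0 -(scale0r e2) addrAC.
move=> /(frame_inj uM)[E0 /sqr_eq_mul E1 E2].
have [a0|a0] := eqVneq a 0.
  move: E0 E1; rewrite a0 mul0r => /eqP; rewrite expf_eq0 => /eqP E0 E1.
  have v1 : v 0 1 = 0 by case: E1.
  exists (vec3 1 0 0, D0_eq k 3); first by rewrite inE eqxx.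
  exists (v 0 0); last by apply: vec3_scale; rewrite ?mulr1 ?mulr0.
  by case: (row3_neq0 v0); rewrite ?v1 ?E0 ?eqxx.
have v2 : v 0 2 = 0 by move/esym/eqP: E2; rewrite mulf_eq0 (negPf a0) => /eqP.
have v00 : v 0 0 = 0.
  by move/esym/eqP: E0; rewrite v2 expr0n mulf_eq0 (negPf a0) => /eqP.
exists (vec3 0 1 0, A1_eq k); first by rewrite !inE eqxx orbT.
exists a => //; apply: vec3_scale; rewrite ?mulr0 ?mulr1 //.
by case: E1 => // v1; case: (row3_neq0 v0); rewrite ?v00 ?v1 ?v2 eqxx.
Qed.

(** A nilpotent map has no eigenvectors outside of its kernel. *)
Lemma config_nilpotent : phi e0 = 0 -> phi e1 = e2 -> phi e2 = e0 -> config_E70 L.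
Proof.
move=> h0 h1 h2; apply: (sing_configP k2 gen uM) => [z|v a v0].
  by rewrite inE => /eqP ->; rewrite /= !simplv; exact: (type_E7 k2 gen uM h0 h1 h2).
rewrite h0 h1 h2 scaler0 add0r addrC -[X in X + _]addr0 -(scale0r e1).
move=> /(frame_inj uM)[E0 E1 E2].
have v10 : v 0 1 = 0.
  have [a0|a0] := eqVneq a 0.
    by move/eqP: E2; rewrite a0 mul0r expf_eq0 => /eqP.
  by move/esym/eqP: E1; rewrite mulf_eq0 (negPf a0) => /eqP.
have v20 : v 0 2 = 0.
  have [a0|a0] := eqVneq a 0.
    by move/eqP: E0; rewrite a0 mul0r expf_eq0 => /eqP.
  by move/esym/eqP: E2; rewrite v10 expr0n mulf_eq0 (negPf a0) => /eqP.
exists (vec3 1 0 0, E70_eq k); first by rewrite inE eqxx.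
exists (v 0 0); last by apply: vec3_scale; rewrite ?mulr1 ?mulr0.
by case: (row3_neq0 v0); rewrite ?v10 ?v20 ?eqxx.
Qed.

End Conclusion.

Theorem mainTheorem1 (k : closedFieldType) (hchar : 2%N \in [pchar k])
    (L : set 'rV[k]_3 -> set (ratfun k -> ratfun k))
    (Lfol : one_foliation 2 L) (Linv : invertible_sheaf L)
    (Ldeg : has_degree L (-1)) :
  [\/ config_7A1 L, config_D40_3A1 L, config_D60_A1 L | config_E70 L].
Proof.
have [m gen] := foliation_generated hchar Lfol Ldeg.
have [e0 [e1 [e2 [uM normal]]]] := semilin_normal_form hchar (gen_rank gen).
case: normal => -[h0 h1 h2].
- by constructor 1; apply: (config_three_fixed hchar gen uM h0 h1 h2).
- by constructor 2; apply: (config_two_fixed hchar gen uM h0 h1 h2).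
- by constructor 3; apply: (config_one_fixed hchar gen uM h0 h1 h2).
- by constructor 4; apply: (config_nilpotent hchar gen uM h0 h1 h2).
Qed.
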